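(* Let $\mu,\upsilon>-1$, $0<\rho\le1$, and let $N\ge1$ be an integer. If $f\bigl(1-(1-t)^{1/\rho}\bigr)\in B_{\mu,\upsilon}^{1,1}(J)$, then the interpolation operator $J_{N,\rho}^{\mu,\upsilon}$ satisfies $$\|J_{N,\rho}^{\mu,\upsilon}f\|_{0,\varkappa^{\mu,\upsilon,\rho}}\le c\Bigl(\|f\|_{0,\varkappa^{\mu,\upsilon,\rho}}+N^{-1}\|\mathcal{D}_\rho f\|_{0,\varkappa^{\mu+1,\upsilon+1,\rho}}\Bigr),$$ where $c$ is a constant independent of $N$ and $f$.
   Context: $J=[0,1]$. The weight is $\varkappa^{a,b,\rho}(t)=\rho(1-t)^{\rho(a+1)-1}\bigl(1-(1-t)^\rho\bigr)^b$; in particular $\varkappa^{a,b,1}(t)=(1-t)^a t^b$. $\|f\|_{0,\varkappa}=(\int_0^1 f^2\varkappa\,dt)^{1/2}$ and $L^2_\varkappa(J)$ is the associated space. $\mathcal{D}_\rho f(t)=\frac{(1-t)^{1-\rho}}{\rho}f'(t)$. $B_{\mu,\upsilon}^{1,1}(J)=\{f:\ \partial_t^kf\in L^2_{\varkappa^{\mu+k,\upsilon+k,1}}(J),\ k=0,1\}$ (weak derivatives; elements are identified with their continuous representatives on $(0,1)$). With $\mathcal{P}_r^{\mu,\upsilon}$ the classical Jacobi polynomial of degree $r$ on $[-1,1]$ (weight $(1-x)^\mu(1+x)^\upsilon$), set $\mathcal{P}_r^{\mu,\upsilon,\rho}(t)=\mathcal{P}_r^{\mu,\upsilon}(1-2(1-t)^\rho)$.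 The nodes $\{t_i\}_{i=0}^N\subset(0,1)$ are the zeros of $\mathcal{P}_{N+1}^{\mu,\upsilon,\rho}$, and $$h_{j,\rho}^{\mu,\upsilon}(t)=\prod_{i=0,\,i\ne j}^N\frac{(1-t)^\rho-(1-t_i)^\rho}{(1-t_j)^\rho-(1-t_i)^\rho},\qquad J_{N,\rho}^{\mu,\upsilon}f(t)=\sum_{j=0}^Nf(t_j)\,h_{j,\rho}^{\mu,\upsilon}(t).$$ *)

(* Defs.v *)
From HB Require Import structures.
From mathcomp Require Import all_boot all_order all_algebra.
From mathcomp Require Import all_classical all_reals all_analysis.

Set Implicit Arguments.
Unset Strict Implicit.
Unset Printing Implicit Defensive.

Import Order.TTheory GRing.Theory Num.Theory.
Import numFieldNormedType.Exports.

Local Open Scope classical_set_scope.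
Local Open Scope ring_scope.

Section WeightedSpaces.
Context {R : realType}.
Implicit Types (a b rho mu ups t : R) (kappa f g w phi : R -> R).

Definition weight a b rho t : R :=
  rho * (1 - t) `^ (rho * (a + 1) - 1) * (1 - (1 - t) `^ rho) `^ b.

(* Extended-real valued, so that a divergent integral gives +oo. *)
Definition wnorm kappa f : \bar R :=
  sqrte (\int[@lebesgue_measure R]_(t in `[0%R, 1%R]) (f t ^+ 2 * kappa t)%:E)%E.

Definition L2w kappa : set (R -> R) :=
  [set f : R -> R | measurable_fun (`[0, 1] : set R) f /\ (wnorm kappa f < +oo)%E].

(* C_c^oo(]0, 1[): smooth functions vanishing off a compact subinterval. *)
Definition test_function : set (R -> R) :=
  [set phi : R -> R | (forall n x, derivable (derive1n n phi) x 1) /\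
    exists c d : R, [/\ 0 < c, c < d, d < 1 &
      forall x, x \notin `[c, d] -> phi x = 0]].

Definition is_weak_derivative f w : Prop :=
  [/\ locally_integrable `]0, 1[ f, locally_integrable `]0, 1[ w &
    forall phi, test_function phi ->
      \int[@lebesgue_measure R]_(t in `]0, 1[) (f t * derive1 phi t) =
      - \int[@lebesgue_measure R]_(t in `]0, 1[) (w t * phi t)].

Definition weakly_derivable f : Prop := exists w, is_weak_derivative f w.

(* A weak derivative is unique up to a null set; one is selected here.  The
   value is junk (the zero function) when f is not weakly derivable. *)
Definition weak_deriv f : R -> R :=
  xget (cst 0 : R -> R) [set w | is_weak_derivative f w].

(* B^{1,1}_{mu,ups}(J).  Each class is represented by the member that is
   continuous on ]0, 1[; the values at 0 and 1 are irrelevant. *)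
Definition B11 mu ups : set (R -> R) :=
  [set g : R -> R | [/\ {in `]0, 1[, continuous g},
               L2w (weight mu ups 1) g,
               weakly_derivable g &
               L2w (weight (mu + 1) (ups + 1) 1) (weak_deriv g)]].

Definition Drho rho f t : R := (1 - t) `^ (1 - rho) / rho * weak_deriv f t.

End WeightedSpaces.

Section JacobiInterpolation.
Context {R : realType}.
Implicit Types (rho mu ups x : R) (f : R -> R).

Definition gbinom (z : R) (k : nat) : R :=
  (\prod_(i < k) (z - i%:R)) / (k`!)%:R.

(* Classical Jacobi polynomial for the weight (1 - x)^mu (1 + x)^ups, with the
   standard normalization P_n(1) = gbinom (n + mu) n:
   P_n(x) = \sum_s C(n+mu, n-s) C(n+ups, s) ((x-1)/2)^s ((x+1)/2)^(n-s)
   (Szego, Orthogonal Polynomials, (4.3.2)). *)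
Definition jacobi mu ups (n : nat) : {poly R} :=
  \sum_(s < n.+1)
    (gbinom (n%:R + mu) (n - s) * gbinom (n%:R + ups) s) *:
      ((2^-1 *: ('X - 1)) ^+ s * (2^-1 *: ('X + 1)) ^+ (n - s)).

Definition jacobi_rho mu ups rho (n : nat) x : R :=
  (jacobi mu ups n).[1 - 2 * (1 - x) `^ rho].

(* t enumerates, without repetition, the zeros of jacobi_rho of index N + 1
   in ]0, 1[. *)
Definition jacobi_nodes mu ups rho (N : nat) (t : 'I_N.+1 -> R) : Prop :=
  injective t /\
  forall x, (exists i, t i = x) <->
            (0 < x < 1 /\ jacobi_rho mu ups rho N.+1 x = 0).

Definition lagrange rho (N : nat) (t : 'I_N.+1 -> R) (j : 'I_N.+1) x : R :=
  \prod_(i < N.+1 | i != j)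
    (((1 - x) `^ rho - (1 - t i) `^ rho) /
     ((1 - t j) `^ rho - (1 - t i) `^ rho)).

Definition interp rho (N : nat) (t : 'I_N.+1 -> R) f x : R :=
  \sum_(j < N.+1) f (t j) * lagrange rho t j x.

End JacobiInterpolation.

(* Main.v *)
(** With s = 1 - (1 - t)^rho the interpolant is the Lagrange interpolant at the
    zeros x_j of a Jacobi polynomial P of degree n = N + 1, and the fundamental
    polynomials l_j are orthogonal for w(s) = s^ups (1 - s)^mu (Gauss quadrature),
    so the square of the norm on the left is the sum of f(t_j)^2 L(l_j^2), L
    being integration against w.

    Let p = s (1 - s), W = w sqrt p and lam = n (n + mu + ups + 1).  In Liouville
    form the differential equation of P yields the energy
    H = W (p Y^2 + lam P^2), Y = P' + (W' / 2 W) P.  By Gronwall H is constant up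
    to bounded factors on [d, 1 - d] with d comparable to 1 / lam; outside, P is
    controlled by the sum of 1 / x_j, which the equation gives at the singular
    endpoints.  Hence lam L(P^2) <= C H(x_j), which is L(l_j^2) <= C W(x_j) / sqrt lam.

    The function kappa = W (1 - lam W P^2 / H) equals W at the nodes, vanishes
    between any two of them (where Y = 0, by Rolle), and has
    |kappa'| <= C sqrt lam w.  Integrating (f^2 kappa(s(t)))' from such a zero to
    a node bounds the sum of W(x_j) f(t_j)^2 by the integral of |f^2 kappa'| and
    |2 f f' kappa|, and the arithmetic-geometric mean inequality concludes. *)
From HB Require Import structures.
Require Import Defs.
From mathcomp Require Import all_boot all_order all_algebra.
From mathcomp Require Import all_classical all_reals all_analysis.
From mathcomp Require Import measurable_realfun ring lra.

Import Order.TTheory GRing.Theory Num.Theory.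
Import numFieldNormedType.Exports.

Set Implicit Arguments.
Unset Strict Implicit.
Unset Printing Implicit Defensive.

Local Open Scope classical_set_scope.
Local Open Scope ring_scope.

(** No asymptotics and no separation of the zeros enter: the energy bounds each [L(l_j^2)] from
    above, and [kappa] supplies between two nodes the zero that replaces a spacing estimate.
    Uniformity in [N] rests on one scaling. The growth rate of [H] is of order
    [lam^(-1/2) p^(-3/2)], whose integral from [d] is of order [(lam d)^(-1/2)]; likewise the bound
    on [kappa'] is [sqrt lam * w] times a function of [lam d]. Taking [d = c1 / lam] freezes that
    product, and [c1] is small enough for the sums of reciprocals to keep every node at distance at
    least [2 d] from the endpoints. The factor [1 / N] comes from [N^2 <= lam].

    The other obstacle is regularity: [f] has only a weak derivative, and the weights and the
    substitution may be singular at the endpoints. The weak derivative is therefore turned into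
    indefinite Lebesgue integrals on compact subintervals of []0, 1[], a notion stable under
    products and increasing substitutions, and integrals over []0, 1[] are reached by exhaustion. *)

Section RealDerivatives.
Context (R : realType).
Implicit Types (f g : R -> R) (x a b : R).

(* The library's rules with the functions as explicit lambdas, so that they
   chain by unification. *)
Lemma fun_deriveD f g x a b : is_derive x (1 : R) f a -> is_derive x (1 : R) g b ->
  is_derive x (1 : R) (fun y => f y + g y) (a + b).
Proof. by move=> *; exact: is_deriveD. Qed.

Lemma fun_deriveN f x a : is_derive x (1 : R) f a -> is_derive x (1 : R) (fun y => - f y) (- a).
Proof. by move=> *; exact: is_deriveN. Qed.

Lemma fun_deriveB f g x a b : is_derive x (1 : R) f a -> is_derive x (1 : R) g b ->
  is_derive x (1 : R) (fun y => f y - g y) (a - b).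
Proof. by move=> *; exact: is_deriveB. Qed.

Lemma fun_deriveM f g x a b : is_derive x (1 : R) f a -> is_derive x (1 : R) g b ->
  is_derive x (1 : R) (fun y => f y * g y) (a * g x + f x * b).
Proof.
move=> fa gb; apply: is_derive_eq (is_deriveM fa gb) _.
by rewrite /GRing.scale /= addrC mulrC.
Qed.

Lemma fun_derive_cst (c x : R) : is_derive x (1 : R) (fun _ : R => c) (0 : R).
Proof. exact: is_derive_cst. Qed.

Lemma fun_derive_id x : is_derive x (1 : R) (fun y : R => y) (1 : R).
Proof. exact: is_derive_id. Qed.

Lemma fun_derive_comp f g x a b : is_derive (g x) (1 : R) f a -> is_derive x (1 : R) g b ->
  is_derive x (1 : R) (fun y => f (g y)) (a * b).
Proof. by move=> *; exact: is_derive1_comp. Qed.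

Lemma fun_deriveV f x a : f x != 0 -> is_derive x (1 : R) f a ->
  is_derive x (1 : R) (fun y => (f y)^-1) (- a / f x ^+ 2).
Proof.
move=> fx0 [df fa].
have -> : - a / f x ^+ 2 = (- f x ^- 2) * a.
  by rewrite mulrC mulNr mulrN.
apply: (DeriveDef (derivableV fx0 df)).
by rewrite deriveV// fa.
Qed.

Lemma fun_deriveX f x a n : is_derive x (1 : R) f a ->
  is_derive x (1 : R) (fun y => f y ^+ n) (n%:R * f x ^+ n.-1 * a).
Proof.
move=> fa; elim: n => [|n ih].
  by rewrite mul0r mul0r; under eq_fun do rewrite expr0; exact: fun_derive_cst.
under eq_fun do rewrite exprS.
apply: is_derive_eq (fun_deriveM fa ih) _ => /=.
case: n ih => [|n] _ /=; first by rewrite expr0; ring.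
by rewrite exprS -[n.+2%:R]natr1; ring.
Qed.

Lemma fun_derive_poly (p : {poly R}) x : is_derive x (1 : R) (fun y => p.[y]) p^`().[x].
Proof. exact: is_derive_poly. Qed.

Lemma is_derive_continuous f x a : is_derive x (1 : R) f a -> {for x, continuous f}.
Proof. by move=> [df _]; apply/differentiable_continuous/derivable1_diffP. Qed.

(** The difference quotient is at most [C * |h|]. This handles the points where a piecewise
    definition is glued to zero and the usual rules do not apply. *)
Lemma is_derive_quadratic f x (C : R) : (forall y, `|f y - f x| <= C * (y - x) ^+ 2) ->
  is_derive x (1 : R) f 0.
Proof.
move=> fC.
have C0 : 0 <= C.
  have := fC (x + 1); rewrite addrAC subrr add0r expr1n mulr1.
  exact: le_trans.
have H : h^-1 *: ((f \o shift x) (h *: (1 : R)) - f x) @[h --> 0^'] --> (0 : R).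
  apply/cvgrPdist_le => e e0.
  near=> h.
  have h0 : h != 0 by near: h; exact: nbhs_dnbhs_neq.
  rewrite sub0r normrN normrZ normfV ler_pdivrMl ?normr_gt0//.
  rewrite /= /shift /= /GRing.scale /= mulr1.
  apply: le_trans (fC _) _; rewrite addrK.
  rewrite -(real_normK (num_real h)) expr2 mulrCA ler_pM2l ?normr_gt0//.
  have : `|h| <= e / (C + 1).
    near: h; apply: dnbhs0_le; rewrite divr_gt0// ltr_pwDr//.
  rewrite ler_pdivlMr ?ltr_pwDr// => /(le_trans _); apply.
  by rewrite mulrC ler_wpM2l// lerDl.
by apply: DeriveDef; [apply/cvg_ex; exists 0|apply: cvg_lim].
Unshelve. all: by end_near. Qed.

Lemma near_is_derive f g x a : (\forall y \near x, f y = g y) ->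
  is_derive x (1 : R) f a -> is_derive x (1 : R) g a.
Proof. by move=> fg; apply: near_eq_is_derive. Qed.

End RealDerivatives.

(** * Weighted substitution and primitives *)

Section Density.
Context d (T : measurableType d) (R : realType).
Import HBNNSimple.
Variable mu : {measure set T -> \bar R}.
Local Open Scope ereal_scope.

(** The measure with density [k]. Measurability and positivity are arguments of the definition so
    that the measure structure can be attached to it for every such [k]. *)
Definition density (k : T -> R) of measurable_fun setT k & (forall x, 0 <= k x)%R :=
  fun A : set T => \int[mu]_(x in A) (k x)%:E.

Variables (k : T -> R) (mk : measurable_fun setT k) (k0 : forall x, (0 <= k x)%R).
Local Notation m := (density mk k0).

Let density0 : m set0 = 0.
Proof. by rewrite /density integral_set0. Qed.

Let density_ge0 A : 0 <= m A.
Proof. by rewrite /density integral_ge0// => x _; rewrite lee_fin. Qed.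

Let density_sigma_additive : semi_sigma_additive m.
Proof.
move=> /= F mF tF mUF; rewrite /density; apply: cvg_toP.
  apply: ereal_nondecreasing_is_cvgn => i j ij.
  apply: lee_sum_nneg_natr => // n _ _; apply: integral_ge0 => x _.
  by rewrite lee_fin.
rewrite ge0_integral_bigcup//=.
- by apply/measurable_EFinP; exact: measurable_funTS.
- by move=> x _; rewrite lee_fin.
Qed.

HB.instance Definition _ := isMeasure.Build _ _ _ m
  density0 density_ge0 density_sigma_additive.

(** Monotone convergence along the simple approximations [h n] reduces both sides to simple
    functions, and finite additivity reduces these to indicators of level sets, where the identity
    is the definition of the measure. *)
Lemma ge0_integral_density (f : T -> \bar R) :
  measurable_fun setT f -> (forall x, 0 <= f x) ->
  \int[m]_x f x = \int[mu]_x (f x * (k x)%:E).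
Proof.
move=> mf f0.
pose h := nnsfun_approx measurableT mf.
have -> : \int[m]_x f x = lim (\int[m]_x (EFin \o h n) x @[n --> \oo]).
  have fE x : f x = lim ((EFin \o h n) x @[n --> \oo]).
    by apply/esym/cvg_lim => //; exact: cvg_nnsfun_approx.
  under eq_integral do rewrite fE.
  apply: monotone_convergence => //.
  - move=> n; exact/measurable_EFinP.
  - by move=> n x _ /=; rewrite lee_fin.
  - by move=> x _ a b ab; rewrite lee_fin; exact/lefP/nd_nnsfun_approx.
have mkE : measurable_fun setT (EFin \o k) by exact/measurable_EFinP.
have -> : \int[mu]_x (f x * (k x)%:E) =
    lim (\int[mu]_x ((EFin \o h n) x * (k x)%:E) @[n --> \oo]).
  have fg x : f x * (k x)%:E = lim (((EFin \o h n) x * (k x)%:E) @[n --> \oo]).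
    by apply/esym/cvg_lim => //; apply: cvgeZr => //; exact: cvg_nnsfun_approx.
  under eq_integral do rewrite fg.
  apply: monotone_convergence => [//| | |].
  - by move=> n; apply/emeasurable_funM => //; exact/measurable_EFinP.
  - by move=> n x _ /=; rewrite mule_ge0 ?lee_fin.
  - by move=> x Ex a b ab/=; rewrite lee_wpmul2r ?lee_fin//; exact/lefP/nd_nnsfun_approx.
suff suf n : \int[mu]_x ((EFin \o h n) x * (k x)%:E) = \int[m]_x (EFin \o h n) x.
  by congr (lim (_ @ \oo)); apply/funext => n; rewrite -suf.
transitivity (\int[m]_x
   (\sum_(y \in range (h n)) (y * \1_(h n @^-1` [set y]) x)%:E)); last first.
  by apply: eq_integral => t tE; rewrite /= fimfunE -fsumEFin.
have indich r : measurable_fun setT (fun x => (r * \1_(h n @^-1` [set r]) x)%:E).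
  by apply: (measurable_comp measurableT) => //; exact: measurable_funM.
rewrite ge0_integral_fsum//; last by move=> j y Ey; exact: nnfun_muleindic_ge0.
transitivity (\int[mu]_x (\sum_(y \in range (h n))
    (y * \1_(h n @^-1` [set y]) x)%:E * (k x)%:E)).
  under [RHS]eq_integral => x xE.
    rewrite -ge0_mule_fsuml => [|y]; last exact: nnfun_muleindic_ge0.
    rewrite fsumEFin // -(fimfunE _ x); over.
  by [].
rewrite ge0_integral_fsum//; last 2 first.
  - by move=> y; apply: emeasurable_funM.
  - by move=> j y Ey; apply: mule_ge0; [exact: nnfun_muleindic_ge0|rewrite lee_fin].
apply: eq_fsbigr => r rhn.
under [RHS]eq_integral do rewrite EFinM.
rewrite integralZl_indic_nnsfun => //.
under eq_integral do rewrite EFinM -muleA.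
have mh : measurable (h n @^-1` [set r]).
  by rewrite -[X in measurable X]setTI; exact: measurable_funP.
have [r0|r0] := ltP r 0%R.
  have hn0 : h n @^-1` [set r] = set0.
    by apply: preimage_nnfun0.
  rewrite hn0 !indic0; under eq_integral do rewrite mul0e mule0.
  by rewrite !integral0 mule0.
rewrite ge0_integralZl//.
- under eq_integral do rewrite muleC.
  rewrite (eq_integral ((EFin \o k) \_ (h n @^-1` [set r]))); last first.
    by move=> x xE; rewrite epatch_indic.
  by rewrite -integral_mkcondr integral_indic// setIC.
- by apply: emeasurable_funM => //; exact/measurable_EFinP.
- by move=> x _; rewrite mule_ge0// lee_fin.
Qed.
End Density.

Section ChangeOfVariables.
Context (R : realType).
Local Notation mu := (@lebesgue_measure R).

Lemma FTC2_is_derive (a b : R) (F f : R -> R) : a <= b ->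
  {within `[a, b], continuous F} -> {within `[a, b], continuous f} ->
  (forall x, x \in `]a, b[ -> is_derive x 1 F (f x)) ->
  (\int[mu]_(x in `[a, b]) (f x)%:E = (F b - F a)%:E :> \bar R)%E.
Proof.
rewrite le_eqVlt => /predU1P[<- _ _ _|ab cF cf dF].
  by rewrite set_itv1 integral_set1 subrr.
have [_ Fa Fb] := (continuous_within_itvP _ ab).1 cF.
rewrite (@continuous_FTC2 _ f F)// ?EFinB//.
- by split => // x /dF [].
- by move=> x /dF dFx; rewrite derive1E; exact: derive_val.
Qed.

(** The point [c] is the preimage of [x] clamped to [[a, b]]: [a] below the range, [b] above it, and
    given by the intermediate value theorem inside. One [c] describes both the preimage and the
    image of the ray, whose two masses can then be compared. *)
Lemma increasing_preimage_ray (a b : R) (s : R -> R) (x : R) :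
a < b -> {in `[a, b] &, {homo s : x y / x < y}} -> {within `[a, b], continuous s} ->
exists2 c, c \in `[a, b] &
  (`]a, b]%classic `&` s @^-1` `]x, +oo[%classic = `]c, b]%classic) /\
    (`]s a, s b]%classic `&` `]x, +oo[%classic = `]s c, s b]%classic).
Proof.
move=> ab incs cs.
have lesE : {in `[a, b] &, {mono s : x y / x <= y}} by exact: le_mono_in.
have ltsE : {in `[a, b] &, {mono s : x y / x < y}} by exact: leW_mono_in.
have ain : a \in `[a, b] by rewrite in_itv/= lexx ltW.
have bin : b \in `[a, b] by rewrite in_itv/= lexx ltW.
have key c : c \in `[a, b] -> (forall y, y \in `]a, b] -> (x < s y) = (c < y)) ->
    `]a, b]%classic `&` s @^-1` `]x, +oo[%classic = `]c, b]%classic.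
  rewrite in_itv/= => /andP[ac cb] Hc; apply/seteqP; split => y /=; rewrite !in_itv/= !andbT.
    by move=> [yab]; rewrite Hc//; move/andP: yab => [_ ->] ->.
  move=> /andP[cy yb]; have yab : y \in `]a, b] by rewrite in_itv/= yb (le_lt_trans ac).
  by split; [move: yab; rewrite in_itv|rewrite Hc].
have occ y : y \in `]a, b] -> y \in `[a, b].
  by rewrite !in_itv/= => /andP[/ltW -> ->].
have [xsa|sax] := ltP x (s a).
  exists a => //; split.
    apply: key => // y /[dup] /occ yab; rewrite in_itv/= => /andP[ay yb].
    by rewrite ay (lt_trans xsa)// ltsE.
  apply/seteqP; split => y /=; rewrite !in_itv/= !andbT; first by case.
  by move=> /andP[ay yb]; rewrite ay yb (lt_trans xsa).
have [sbx|xsb] := leP (s b) x.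
  exists b => //; split.
    apply: key => // y /[dup] /occ yab; rewrite in_itv/= => /andP[ay yb].
    by rewrite !ltNge yb (le_trans _ sbx)// lesE.
  apply/seteqP; split => y /=; rewrite !in_itv/= !andbT.
    by move=> [/andP[ay yb]] xy; rewrite yb andbT (le_lt_trans sbx).
  by move=> /andP[/lt_le_trans h /h]; rewrite ltxx.
have [|c cab sc] := @IVT _ s a b x (ltW ab) cs.
  by rewrite ge_min sax le_max (ltW xsb) orbT.
exists c => //; split.
  by apply: key => // y /occ yab; rewrite -sc ltsE.
rewrite sc; apply/seteqP; split => y /=; rewrite !in_itv/= !andbT.
  by move=> [/andP[ay yb]] xy; rewrite yb xy.
by move=> /andP[xy yb]; rewrite yb xy (le_lt_trans sax).
Qed.

(* Finite Borel measures on the line that agree on rays are equal; hence the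
   image of [k dt] under [s] is the Lebesgue measure. *)
Lemma ge0_change_of_variables (a b : R) (s k : R -> R) (f : R -> \bar R) :
  a < b -> {in `[a, b] &, {homo s : x y / x < y}} ->
  measurable_fun setT s ->
  {within `[a, b], continuous s} ->
  {within `[a, b], continuous k} ->
  (forall x, x \in `[a, b] -> 0 <= k x) ->
  (forall x, x \in `]a, b[ -> is_derive x 1 s (k x)) ->
  measurable_fun setT f -> (forall x, 0 <= f x)%E ->
  (\int[mu]_(y in `]s a, s b]) f y =
   \int[mu]_(t in `]a, b]) (f (s t) * (k t)%:E) :> \bar R)%E.
Proof.
move=> ab incs ms cs ck k0 ds mf f0.
have lesE : {in `[a, b] &, {mono s : x y / x <= y}} by exact: le_mono_in.
have ltsE : {in `[a, b] &, {mono s : x y / x < y}} by exact: leW_mono_in.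
have ain : a \in `[a, b] by rewrite in_itv/= lexx ltW.
have bin : b \in `[a, b] by rewrite in_itv/= lexx ltW.
(* Cutting [k] off outside the interval makes it nonnegative and measurable on the whole line, as a
   density must be. *)
pose K := k \_ `]a, b].
have K0 x : 0 <= K x.
  rewrite /K patchE; case: ifPn => // /set_mem /=; rewrite in_itv/= => /andP[ax xb].
  by apply: k0; rewrite in_itv/= (ltW ax).
have mk : measurable_fun `]a, b] k.
  have: measurable_fun `[a, b] k by exact: subspace_continuous_measurable_fun.
  by apply: measurable_funS => //; exact: subset_itv_oc_cc.
have mK : measurable_fun setT K.
  by apply/(measurable_restrictT _ _).1.
pose I : R -> R := \1_(`]s a, s b]).
have I0 x : 0 <= I x by rewrite /I indicE.
have mI : measurable_fun setT I by exact: measurable_indic.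
have FTC c : c \in `[a, b] -> (\int[mu]_(x in `]c, b]) (k x)%:E = (s b - s c)%:E :> \bar R)%E.
  rewrite in_itv/= => /andP[ac cb].
  have sub : `[c, b] `<=` `[a, b].
    by apply: subset_itvr; rewrite bnd_simp.
  have mkc : measurable_fun `]c, b] k.
    by apply: (measurable_funS _ _ mk); [exact: measurable_itv|apply: subset_itvr; rewrite bnd_simp].
  rewrite integral_itv_obnd_cbnd; last exact/measurable_EFinP.
  have cs' : {within `[c, b], continuous s} by exact: continuous_subspaceW sub cs.
  have ck' : {within `[c, b], continuous k} by exact: continuous_subspaceW sub ck.
  have ds' x : x \in `]c, b[ -> is_derive x 1 s (k x).
    rewrite in_itv/= => /andP[cx xb]; apply: ds.
    by rewrite in_itv/= xb (le_lt_trans ac).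
  have := FTC2_is_derive cb cs' ck' ds'.
  exact.
transitivity (\int[density mu mI I0]_y f y)%E.
  rewrite (ge0_integral_density mu mI I0 mf f0) [LHS]integral_mkcond.
  by apply: eq_integral => y _; rewrite epatch_indic.
transitivity (\int[density mu mK K0]_t (f \o s) t)%E; last first.
  have mfs : measurable_fun setT (f \o s) by exact: measurableT_comp.
  rewrite (ge0_integral_density mu mK K0 mfs (fun x => f0 (s x))).
  rewrite [RHS]integral_mkcond; apply: eq_integral => y _ /=.
  by rewrite /K !patchE; case: ifPn => //; rewrite mule0.
refine (etrans _ (@ge0_integral_pushforward _ _ (measurableTypeR R) (measurableTypeR R)
  R s ms (density mu mK K0) setT f measurableT mf _)); last first.
  by move=> y _; exact: f0.
apply: eq_measure_integral => A mA _.
have ltsab : s a < s b by rewrite ltsE.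
refine (@measure_unique _ R (measurableTypeR R) (@RGenOInfty.G R)
  (fun n => `](- n%:R), +oo[%classic) _ _ _ _ _ _ _ _ A mA).
- exact: RGenOInfty.measurableE.
- move=> _ _ [x ->] [y ->]; exists (Num.max x y).
  apply/seteqP; split => z /=; rewrite !in_itv/= !andbT gt_max.
    by move=> [-> ->].
  by move=> /andP[].
- by move=> n; exists (- n%:R).
- apply/seteqP; split => // x _; exists (Num.truncn `|x|).+1 => //=.
  rewrite in_itv/= andbT ltrNl (le_lt_trans (ler_norm _))// normrN.
  by rewrite truncnS_gt.
- move=> _ [x ->]; have [c cab [r1 r2]] := increasing_preimage_ray x ab incs cs.
  rewrite /pushforward /density /=.
  rewrite [X in X = _](_ : _ = mu (`]s a, s b]%classic `&` `]x, +oo[%classic)); last first.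
    exact: integral_indic.
  rewrite r2 lebesgue_measure_itv/= lte_fin.
  rewrite [RHS](_ : _ =
      (\int[mu]_(t in `]a, b]%classic `&` s @^-1` `]x, +oo[%classic) (k t)%:E)%E); last first.
    rewrite integral_mkcondl /pushforward /density; apply: eq_integral => y _.
    by rewrite /K restrict_EFin.
  rewrite r1 FTC//.
  move: cab; rewrite in_itv/= => /andP[ac cb].
  case: ltP => // sbsc; congr EFin.
  by apply/eqP; rewrite eq_sym subr_eq0 eq_le sbsc/= lesE// in_itv/= ac cb.
- move=> n; apply: (@le_lt_trans _ _ (\int[mu]_x (I x)%:E)%E).
    rewrite /= /density; apply: ge0_subset_integral => //.
      by apply/measurable_EFinP.
    by move=> x _; rewrite lee_fin.
  rewrite [X in (X < _)%E](_ : _ = mu `]s a, s b]%classic); last first.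
    by rewrite integral_indic// setIT.
  by rewrite lebesgue_measure_itv/= lte_fin ltsab -EFinB ltry.
Qed.
End ChangeOfVariables.

(** * Absolutely continuous functions as indefinite integrals *)

Section AbsolutelyContinuous.
Context (R : realType).
Local Notation mu := (@lebesgue_measure R).
Implicit Types (a b c x : R) (f g w v : R -> R).

(** Absolute continuity of [f] with density [w], in integral form. No pointwise derivative is
    mentioned, so products follow from Fubini and compositions from a change of variables, without
    differentiation almost everywhere. *)
Definition is_primitive a b w f :=
  mu.-integrable `[a, b] (EFin \o w) /\
  forall x, x \in `[a, b] -> f x = f a + \int[mu]_(t in `[a, x]) w t.

Lemma is_primitive_continuous a b w f : a <= b -> is_primitive a b w f ->
  {within `[a, b], continuous f}.
Proof.
move=> ab [iw fE].
have ci := parameterized_integral_continuous ab iw.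
have cc : {within `[a, b], continuous (fun x => f a + parameterized_integral mu a x w)}.
  by move=> x; apply: cvgD; [exact: cvg_cst|exact: ci].
apply: (subspace_eq_continuous _ cc) => x /set_mem /= xab.
exact: esym (fE x xab).
Qed.

Lemma Rintegral_itv_split a b x w : x \in `[a, b] ->
  mu.-integrable `[a, b] (EFin \o w) ->
  \int[mu]_(t in `[a, b]) w t = \int[mu]_(t in `[a, x]) w t + \int[mu]_(t in `[x, b]) w t.
Proof.
rewrite in_itv/= => /andP[ax xb] iw.
have ixb : mu.-integrable `]x, b] (EFin \o w).
  by apply: integrableS iw => //; apply: subset_itvr; rewrite bnd_simp.
rewrite -(Rintegral_itv_obnd_cbnd ixb) -(@Rintegral_itvB _ w (BLeft a) (BRight b) x iw)//.
by rewrite addrC subrK.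
Qed.

Lemma is_primitiveS a b c d w f : a <= c -> d <= b ->
  is_primitive a b w f -> is_primitive c d w f.
Proof.
move=> ac db [iw fE].
have icd : mu.-integrable `[c, d] (EFin \o w).
  by apply: integrableS iw => //; apply: subset_itv; rewrite bnd_simp.
split => // x; rewrite in_itv/= => /andP[cx xd].
have xab : x \in `[a, b] by rewrite in_itv/= (le_trans ac cx) (le_trans xd).
have cab : c \in `[a, b] by rewrite in_itv/= ac (le_trans cx)// (le_trans xd).
rewrite (fE x xab) (fE c cab) (@Rintegral_itv_split a x c).
- by rewrite addrA.
- by rewrite in_itv/= ac.
- by apply: integrableS iw => //; apply: subset_itvl; rewrite bnd_simp (le_trans xd).
Qed.

Lemma is_primitive_end a b w f : a <= b -> is_primitive a b w f ->
  f b - f a = \int[mu]_(t in `[a, b]) w t.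
Proof.
by move=> ab [_ /(_ b)] ->; [rewrite addrC addKr|rewrite in_itv/= ab lexx].
Qed.

Lemma C1_is_primitive a b f w : a <= b ->
  {within `[a, b], continuous f} -> {within `[a, b], continuous w} ->
  (forall x, x \in `]a, b[ -> is_derive x 1 f (w x)) ->
  is_primitive a b w f.
Proof.
move=> ab cf cw df; split.
  by apply: continuous_compact_integrable => //; exact: segment_compact.
move=> x; rewrite in_itv/= => /andP[ax xb].
have sub : `[a, x] `<=` `[a, b] by apply: subset_itvl; rewrite bnd_simp.
have df' y : y \in `]a, x[ -> is_derive y 1 f (w y).
  rewrite in_itv/= => /andP[ay yx]; apply: df.
  by rewrite in_itv/= ay (lt_le_trans yx).
have := FTC2_is_derive ax (continuous_subspaceW sub cf) (continuous_subspaceW sub cw) df'.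
by rewrite /Rintegral => -> /=; rewrite addrC subrK.
Qed.

Lemma integrable_mul_continuous a b w f : mu.-integrable `[a, b] (EFin \o w) ->
  {within `[a, b], continuous f} ->
  mu.-integrable `[a, b] (EFin \o (fun x => w x * f x)).
Proof.
move=> iw cf.
have := @integrableMl _ _ _ mu _ (measurable_itv `[a, b]) (EFin \o w) f iw.
apply.
- exact: subspace_continuous_measurable_fun.
- have /(compact_bounded) : compact (f @` `[a, b]).
    by apply: continuous_compact => //; exact: segment_compact.
  move=> [M [Mr hM]]; exists M; split => // N /hM h x xab.
  by apply: h; exists x.
Qed.

(* Fubini on the triangle [t <= s]. *)
Lemma Rintegral_triangle a b w v :
  mu.-integrable `[a, b] (EFin \o w) -> mu.-integrable `[a, b] (EFin \o v) ->
  \int[mu]_(t in `[a, b]) (w t * \int[mu]_(s in `[t, b]) v s) =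
  \int[mu]_(s in `[a, b]) (v s * \int[mu]_(t in `[a, s]) w t).
Proof.
move=> iw iv.
pose W := w \_ `[a, b]; pose V := v \_ `[a, b].
have mT (u : R -> R) : mu.-integrable `[a, b] (EFin \o u) -> mu.-integrable setT (EFin \o (u \_ `[a, b])).
  by move=> iu; rewrite -restrict_EFin -integrable_mkcond.
have iW := mT _ iw; have iV := mT _ iv.
have mW : measurable_fun setT W by apply/measurable_EFinP; exact: measurable_int iW.
have mV : measurable_fun setT V by apply/measurable_EFinP; exact: measurable_int iV.
pose T := [set z : measurableTypeR R * measurableTypeR R | z.1 <= z.2].
have mT' : measurable T.
  have := @measurable_fun_ler _ _ R setT _ _ (@measurable_fst _ _ (measurableTypeR R) (measurableTypeR R))
    (@measurable_snd _ _ (measurableTypeR R) (measurableTypeR R)).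
  by move=> /(_ measurableT [set true]) /=; rewrite setTI; exact.
pose h (z : measurableTypeR R * measurableTypeR R) : \bar R := (W z.1 * V z.2 * \1_T z)%:E.
have mh : measurable_fun setT h.
  apply/measurable_EFinP; apply: measurable_funM; last exact: measurable_indic.
  by apply: measurable_funM; [exact: measurableT_comp mW measurable_fst
    |exact: measurableT_comp mV measurable_snd].
have iV1 : (\int[mu]_s `|(V s)%:E| < +oo)%E by case/integrableP: iV.
have iW1 : (\int[mu]_s `|(W s)%:E| < +oo)%E by case/integrableP: iW.
have mVa : measurable_fun setT (fun s => `|(V s)%:E|%E).
  by apply: measurableT_comp => //; exact/measurable_EFinP.
have mWa : measurable_fun setT (fun s => `|(W s)%:E|%E).
  by apply: measurableT_comp => //; exact/measurable_EFinP.
have ih : (mu \x mu)%E.-integrable setT h.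
  apply/(integrable12ltyP _ _ mh).
  apply: (@le_lt_trans _ _ (\int[mu]_t (`|(W t)%:E| * \int[mu]_s `|(V s)%:E|))%E).
    apply: ge0_le_integral => //.
    - by move=> t _; apply: integral_ge0.
    - apply: (measurable_fun_fubini_tonelli_F (fun z => `|h z|%E)) => //.
      exact: measurableT_comp.
    - exact: emeasurable_funM.
    move=> t _; rewrite -ge0_integralZl//.
    apply: ge0_le_integral => //.
    - by apply: measurableT_comp => //; exact: measurableT_comp mh (measurable_pair1 _).
    - exact: emeasurable_funM.
    move=> s _; rewrite /h /= -EFinM lee_fin !normrM ler_piMr//.
    by rewrite indicE; case: (_ \in _); rewrite /= ?normr0 ?normr1.
  rewrite ge0_integralZr//; last exact: integral_ge0.
  by rewrite lte_mul_pinfty// ?integral_ge0// ge0_fin_numE ?integral_ge0.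
have iS (u : R -> R) c d : mu.-integrable `[a, b] (EFin \o u) -> a <= c -> d <= b ->
    mu.-integrable `[c, d] (EFin \o u).
  by move=> iu ac db; apply: integrableS iu => //; apply: subset_itv; rewrite bnd_simp.
have EL t : (\int[mu]_s h (t, s))%E =
    (((fun t => w t * \int[mu]_(s in `[t, b]) v s) \_ `[a, b]) t)%:E.
  rewrite patchE; case: ifPn => [/set_mem tab|tab]; last first.
    under eq_integral do rewrite /h /= /W patchE (negbTE tab) !mul0r.
    by rewrite integral0.
  have /andP[at_ tb] : a <= t <= b by move: tab; rewrite /= in_itv.
  have it := iS v t b iv at_ (lexx _).
  rewrite /Rintegral EFinM fineK; last exact: integrable_fin_num it.
  rewrite -integralZl// integral_mkcond; apply: eq_integral => s _.
  rewrite /h /W /V !patchE /= mem_set// indicE.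
  have -> : (s \in `[t, b]%classic) = (s \in `[a, b]%classic) && ((t, s) \in T).
    apply/idP/idP => [/set_mem/=|/andP[/set_mem/= + /set_mem/=]].
      rewrite in_itv/= => /andP[ts sb]; apply/andP; split; apply/mem_set => //=.
      by rewrite in_itv/= sb (le_trans at_).
    by rewrite !in_itv/= => /andP[_ sb] ts; apply/mem_set; rewrite /= in_itv/= sb ts.
  case: (_ \in `[a, b]%classic) => /=; last by rewrite mulr0 mul0r.
  by case: (_ \in T); rewrite ?mulr1 ?mulr0// EFinM.
have ER s : (\int[mu]_t h (t, s))%E =
    (((fun s => v s * \int[mu]_(t in `[a, s]) w t) \_ `[a, b]) s)%:E.
  rewrite patchE; case: ifPn => [/set_mem sab|sab]; last first.
    under eq_integral do rewrite /h /= /V patchE (negbTE sab) mulr0 mul0r.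
    by rewrite integral0.
  have /andP[as_ sb] : a <= s <= b by move: sab; rewrite /= in_itv.
  have it := iS w a s iw (lexx _) sb.
  rewrite /Rintegral EFinM fineK; last exact: integrable_fin_num it.
  rewrite -integralZl// integral_mkcond; apply: eq_integral => t _.
  rewrite /h /W /V !patchE /= (mem_set sab) indicE.
  have -> : (t \in `[a, s]%classic) = (t \in `[a, b]%classic) && ((t, s) \in T).
    apply/idP/idP => [/set_mem/=|/andP[/set_mem/= + /set_mem/=]].
      rewrite in_itv/= => /andP[at_ ts]; apply/andP; split; apply/mem_set => //=.
      by rewrite in_itv/= at_ (le_trans ts).
    by rewrite !in_itv/= => /andP[at_ _] ts; apply/mem_set; rewrite /= in_itv/= at_ ts.
  case: (_ \in `[a, b]%classic) => /=; last by rewrite !mul0r.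
  by case: (_ \in T); rewrite ?mulr1 ?mulr0// mulrC EFinM.
rewrite Rintegral_mkcond [RHS]Rintegral_mkcond /Rintegral; congr fine.
transitivity (\int[mu]_t \int[mu]_s h (t, s))%E; first by apply: eq_integral => t _; rewrite EL.
by rewrite (Fubini ih); apply: eq_integral => s _; rewrite ER.
Qed.

(** In the triangle identity the inner integrals are [g b - g t] and [f s - f a]; expanding both
    sides leaves the boundary terms. *)
Lemma is_primitive_ibp a b w v f g : a <= b ->
  is_primitive a b w f -> is_primitive a b v g ->
  \int[mu]_(t in `[a, b]) (w t * g t) + \int[mu]_(t in `[a, b]) (v t * f t) =
  f b * g b - f a * g a.
Proof.
move=> ab pf pg; have [iw fE] := pf; have [iv gE] := pg.
have cf := is_primitive_continuous ab pf; have cg := is_primitive_continuous ab pg.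
have m_ab : measurable (`[a, b] : set (measurableTypeR R)) by [].
have iwg := integrable_mul_continuous iw cg.
have ivf := integrable_mul_continuous iv cf.
have bab : b \in `[a, b] by rewrite in_itv/= ab lexx.
have e1 : \int[mu]_(t in `[a, b]) (w t * \int[mu]_(s in `[t, b]) v s) =
    g b * \int[mu]_(t in `[a, b]) w t - \int[mu]_(t in `[a, b]) (w t * g t).
  rewrite -RintegralZl// -RintegralB//; last first.
    rewrite (_ : _ \o _ = (fun x => (g b)%:E * (EFin \o w) x)%E)//.
    exact: integrableZl.
  apply: eq_Rintegral => t /set_mem /= tab.
  have := Rintegral_itv_split tab iv.
  by rewrite (gE b bab) (gE t tab) => ->; ring.
have e2 : \int[mu]_(s in `[a, b]) (v s * \int[mu]_(t in `[a, s]) w t) =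
    \int[mu]_(t in `[a, b]) (v t * f t) - f a * \int[mu]_(t in `[a, b]) v t.
  rewrite -RintegralZl// -RintegralB//; last first.
    rewrite (_ : _ \o _ = (fun x => (f a)%:E * (EFin \o v) x)%E)//.
    exact: integrableZl.
  apply: eq_Rintegral => t /set_mem /= tab.
  by rewrite (fE t tab); ring.
have := Rintegral_triangle iw iv; rewrite e1 e2.
have -> : \int[mu]_(t in `[a, b]) w t = f b - f a by rewrite (is_primitive_end ab pf).
have -> : \int[mu]_(t in `[a, b]) v t = g b - g a by rewrite (is_primitive_end ab pg).
lra.
Qed.

(** Integration by parts on every [[a, x]] is the product rule in integral form. *)
Lemma is_primitiveM a b w v f g : a <= b ->
  is_primitive a b w f -> is_primitive a b v g ->
  is_primitive a b (fun t => w t * g t + v t * f t) (fun t => f t * g t).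
Proof.
move=> ab pf pg; have [iw fE] := pf; have [iv gE] := pg.
have cf := is_primitive_continuous ab pf; have cg := is_primitive_continuous ab pg.
have iwg := integrable_mul_continuous iw cg.
have ivf := integrable_mul_continuous iv cf.
split.
  rewrite (_ : _ \o _ = ((EFin \o (fun t => w t * g t)%R) \+ (EFin \o (fun t => v t * f t)%R))%E)//.
  exact: integrableD.
move=> x xab; have /andP[ax xb] : a <= x <= b by move: xab; rewrite in_itv.
have iS (u : R -> R) : mu.-integrable `[a, b] (EFin \o u) ->
    mu.-integrable `[a, x] (EFin \o u).
  by move=> iu; apply: integrableS iu => //; apply: subset_itvl; rewrite bnd_simp.
rewrite RintegralD//; [|exact: iS iwg|exact: iS ivf].
rewrite (is_primitive_ibp ax (is_primitiveS (lexx _) xb pf) (is_primitiveS (lexx _) xb pg)).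
by rewrite addrC subrK.
Qed.

End AbsolutelyContinuous.

Section PrimitiveComp.
Context (R : realType).
Local Notation mu := (@lebesgue_measure R).

(** The nonnegative formula applied to the positive and negative parts; since [k] is nonnegative,
    multiplying by it commutes with taking these parts. *)
Lemma change_of_variables_oc (a b : R) (s k u : R -> R) :
  a < b -> {in `[a, b] &, {homo s : x y / x < y}} ->
  measurable_fun setT s ->
  {within `[a, b], continuous s} ->
  {within `[a, b], continuous k} ->
  (forall x, x \in `[a, b] -> 0 <= k x) ->
  (forall x, x \in `]a, b[ -> is_derive x 1 s (k x)) ->
  measurable_fun setT u ->
  (\int[mu]_(y in `]s a, s b]) (u y)%:E =
   \int[mu]_(t in `]a, b]) (u (s t) * k t)%:E :> \bar R)%E.
Proof.
move=> ab incs ms cs ck k0 ds mu_.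
have mE : measurable_fun setT (EFin \o u) by exact/measurable_EFinP.
rewrite integralE [RHS]integralE; congr (_ - _)%E.
- rewrite (@ge0_change_of_variables _ a b s k ((EFin \o u)^\+)%E ab incs ms cs ck k0 ds)//.
  + apply: eq_integral => t /set_mem /=; rewrite in_itv/= => /andP[at_ tb].
    have kt : 0 <= k t by apply: k0; rewrite in_itv/= (ltW at_).
    by rewrite !funeposE /= EFinM maxe_pMl// mul0e.
  + exact: measurable_funepos.
- rewrite (@ge0_change_of_variables _ a b s k ((EFin \o u)^\-)%E ab incs ms cs ck k0 ds)//.
  + apply: eq_integral => t /set_mem /=; rewrite in_itv/= => /andP[at_ tb].
    have kt : 0 <= k t by apply: k0; rewrite in_itv/= (ltW at_).
    by rewrite !funenegE /= maxe_pMl ?lee_fin// mul0e -EFinM mulNr.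
  + exact: measurable_funeneg.
Qed.

Lemma is_primitive_comp (a b : R) (s k w g : R -> R) :
  a < b -> {in `[a, b] &, {homo s : x y / x < y}} ->
  measurable_fun setT s ->
  {within `[a, b], continuous s} ->
  {within `[a, b], continuous k} ->
  (forall x, x \in `[a, b] -> 0 <= k x) ->
  (forall x, x \in `]a, b[ -> is_derive x 1 s (k x)) ->
  is_primitive (s a) (s b) w g ->
  is_primitive a b (fun t => w (s t) * k t) (g \o s).
Proof.
move=> ab incs ms cs ck k0 ds [iw gE].
have lesE : {in `[a, b] &, {mono s : x y / x <= y}} by exact: le_mono_in.
have ain : a \in `[a, b] by rewrite in_itv/= lexx ltW.
have bin : b \in `[a, b] by rewrite in_itv/= lexx ltW.
(* Only measurability on [[s a, s b]] is known for [w], whereas the change of variables asks for it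
   on the whole line; extension by zero repairs this. *)
pose u := w \_ `[s a, s b].
have mu_ : measurable_fun setT u.
  apply/(measurable_restrictT _ _).1 => //.
  by apply/measurable_EFinP; exact: measurable_int iw.
have uE t : t \in `[a, b] -> u (s t) = w (s t).
  by move=> tab; rewrite /u patchE mem_set//= in_itv/= !lesE.
have cov x : x \in `]a, b] ->
   (\int[mu]_(y in `]s a, s x]) (u y)%:E =
    \int[mu]_(t in `]a, x]) (u (s t) * k t)%:E :> \bar R)%E.
  rewrite in_itv/= => /andP[ax xb].
  have sub : `[a, x] `<=` `[a, b] by apply: subset_itvl; rewrite bnd_simp.
  have subb y : y \in `[a, x] -> y \in `[a, b] by exact: sub.
  have ds' y : y \in `]a, x[ -> is_derive y 1 s (k y).
    by rewrite in_itv/= => /andP[ay yx]; apply: ds; rewrite in_itv/= ay (lt_le_trans yx).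
  have incs' : {in `[a, x] &, {homo s : x y / x < y}}.
    by move=> y z /subb yab /subb zab; exact: incs.
  exact: (change_of_variables_oc ax incs' ms (continuous_subspaceW sub cs)
    (continuous_subspaceW sub ck) (fun y yx => k0 y (subb y yx)) ds' mu_).
have mun : measurable_fun setT (fun y => `|u y|) by exact: measurableT_comp.
have mk : measurable_fun `[a, b] k by exact: subspace_continuous_measurable_fun.
have muk : measurable_fun `[a, b] (fun t => u (s t) * k t).
  by apply: measurable_funM => //; apply/measurable_funTS/measurableT_comp.
have iuk : mu.-integrable `[a, b] (EFin \o (fun t => u (s t) * k t)).
  apply/integrableP; split; first exact/measurable_EFinP.
  rewrite -integral_itv_obnd_cbnd; last first.
    apply: measurableT_comp => //; apply/measurable_EFinP.
    by apply: measurable_funS muk => //; exact: subset_itv_oc_cc.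
  apply: (@le_lt_trans _ _ (\int[mu]_(y in `]s a, s b]) (`|u y|)%:E)%E).
    rewrite (change_of_variables_oc ab incs ms cs ck k0 ds mun).
    rewrite le_eqVlt; apply/orP; left; apply/eqP; apply: eq_integral => t /set_mem /=.
    by rewrite in_itv/= => /andP[at_ tb]; rewrite normrM (ger0_norm (k0 t _))// in_itv/= (ltW at_).
  move/integrableP : iw => [mw]; apply: le_lt_trans.
  apply: (@le_trans _ _ (\int[mu]_(y in `]s a, s b]) `|(w y)%:E|)%E).
    rewrite le_eqVlt; apply/orP; left; apply/eqP; apply: eq_integral => y /set_mem /=.
    by rewrite in_itv/= => /andP[ay yb]; rewrite /u patchE mem_set//= in_itv/= (ltW ay).
  apply: ge0_subset_integral => //; last exact: subset_itv_oc_cc.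
  exact: measurableT_comp.
have iwk : mu.-integrable `[a, b] (EFin \o (fun t => w (s t) * k t)).
  apply: eq_integrable iuk => // t /set_mem /= tab.
  by rewrite uE.
split => // x xab; have /andP[ax xb] : a <= x <= b by move: xab; rewrite in_itv.
have [->|ax'] := eqVneq a x; first by rewrite set_itv1 Rintegral_set1 addr0.
have axl : a < x by rewrite lt_neqAle ax'.
have sxab : s x \in `[s a, s b] by rewrite in_itv/= !lesE// ax.
rewrite /= (gE _ sxab); congr (_ + _).
have iax (v : R -> R) : mu.-integrable `[a, b] (EFin \o v) -> mu.-integrable `]a, x] (EFin \o v).
  by move=> iv; apply: integrableS iv => //; apply: subset_itv; rewrite bnd_simp.
rewrite -(Rintegral_itv_obnd_cbnd (iax _ iwk)) -Rintegral_itv_obnd_cbnd; last first.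
  by apply: integrableS iw => //; apply: subset_itv; rewrite bnd_simp// lesE.
rewrite /Rintegral; congr fine.
transitivity (\int[mu]_(y in `]s a, s x]) (u y)%:E)%E.
  apply: eq_integral => y /set_mem /=; rewrite in_itv/= => /andP[ay yx].
  by rewrite /u patchE mem_set//= in_itv/= (ltW ay) (le_trans yx)// lesE.
rewrite cov ?in_itv/= ?axl//.
apply: eq_integral => t /set_mem /=; rewrite in_itv/= => /andP[at_ tx].
by rewrite uE// in_itv/= (ltW at_) (le_trans tx).
Qed.
End PrimitiveComp.

(** * Weak derivatives and primitives *)

Section FlatFunctions.
Context (R : realType).
Implicit Types (q : {poly R}) (k n : nat) (x : R).

(** The family [q / v^k * exp(- 1 / v)] with [v = x (1 - x)], extended by zero. It is stable under
    differentiation, so smoothness of the standard bump [flat 1 0] follows by induction within the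
    family. *)
Definition flat q k x : R :=
  if 0 < x < 1 then q.[x] / (x * (1 - x)) ^+ k * expR (- (x * (1 - x))^-1) else 0.

(** The numerator after one differentiation, when the exponent of the denominator is raised by
    two. *)
Definition flat_deriv_poly q k : {poly R} :=
  let v := 'X * (1 - 'X) in
  q^`() * v ^+ 2 + (q - k%:R *: (q * v)) * v^`().

(** A single term of the exponential series at [1 / v], inverted: the exponential beats every power
    of [v]. *)
Lemma expRN_inv_le n (v : R) : 0 < v -> expR (- v^-1) <= n.+1`!%:R * v ^+ n.+1.
Proof.
move=> v0; rewrite expRN -[leRHS]invrK lef_pV2 ?posrE ?expR_gt0//; last first.
  by rewrite invr_gt0 mulr_gt0 ?exprn_gt0// ltr0n fact_gt0.
have := @expR_ge1Dxn R v^-1 n; rewrite invr_ge0 (ltW v0) => /(_ isT).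
apply: le_trans; rewrite invfM exprVn mulrC.
by rewrite ler_wpDl.
Qed.

Lemma flat_bound q k : exists C : R, forall x, 0 <= x <= 1 ->
  `|flat q k x| <= C * (x * (1 - x)) ^+ 2.
Proof.
have qc : {within `[0, 1], continuous (fun x => `|q.[x]|)}.
  apply: continuous_subspaceT => x; apply: continuous_comp; last exact: norm_continuous.
  exact: is_derive_continuous (fun_derive_poly q x).
have [c c01 cmax] := EVT_max ler01 qc.
exists (`|q.[c]| * k.+2`!%:R) => x /andP[x0 x1].
have v0 : 0 <= x * (1 - x) by rewrite mulr_ge0// subr_ge0.
rewrite /flat; case: ifP => [/andP[xp xl]|_]; last first.
  by rewrite normr0; apply: mulr_ge0; [apply: mulr_ge0|exact: exprn_ge0].
have vp : 0 < x * (1 - x) by rewrite mulr_gt0// subr_gt0.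
set v := x * (1 - x) in v0 vp *.
rewrite !normrM (ger0_norm (expR_ge0 _)) normfV (ger0_norm (exprn_ge0 _ v0)).
have h1 : `|q.[x]| <= `|q.[c]| by apply: cmax; rewrite in_itv/= x0.
(* This gives the power [k + 2] of [v]; after division by [v ^+ k] the two powers required by the
   quadratic criterion remain. *)
have h2 := expRN_inv_le k.+1 vp.
apply: (@le_trans _ _ (`|q.[c]| / v ^+ k * (k.+2`!%:R * v ^+ k.+2))).
  apply: ler_pM; [|exact: expR_ge0| |exact: h2].
    by rewrite divr_ge0// exprn_ge0.
  by rewrite ler_wpM2r// invr_ge0 exprn_ge0.
rewrite -addn2 exprD le_eqVlt; apply/orP; left; apply/eqP.
by field; rewrite expf_eq0 (gt_eqF vp) andbF.
Qed.

(** Inside []0, 1[] this is the quotient rule. At any other [x] one has [y (1 - y) <= |y - x|] for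
    [y] in []0, 1[], so [flat_bound] is a quadratic bound around [x] and the derivative is zero. *)
Lemma is_derive_flat q k x :
  is_derive x (1 : R) (flat q k) (flat (flat_deriv_poly q k) k.+2 x).
Proof.
have [C hC] := flat_bound q k.
have C0 : 0 <= C.
  have := hC 2^-1; have h2 : 0 <= (2^-1 : R) <= 1 by lra.
  move=> /(_ h2) /(le_trans (normr_ge0 _)).
  by rewrite pmulr_lge0// exprn_gt0//; lra.
have out y : ~~ (0 < y < 1) -> flat q k y = 0 by rewrite /flat => /negbTE ->.
have [/andP[x0 x1]|nx] := boolP (0 < x < 1).
  have v0 : x * (1 - x) != 0 by rewrite mulf_neq0// ?gt_eqF// subr_gt0.
  rewrite [X in is_derive _ _ _ X]/flat x0 x1 /=.
  apply: (@near_is_derive R (fun x => q.[x] / (x * (1 - x)) ^+ k * expR (- (x * (1 - x))^-1))).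
    have : x \in `]0, 1[ by rewrite in_itv/= x0.
    move/near_in_itvoo; apply: filterS => y; rewrite in_itv/= => y01.
    by rewrite /flat y01.
  have dv : is_derive x (1 : R) (fun y => y * (1 - y)) (1 * (1 - x) + x * (0 - 1)).
    exact: fun_deriveM (fun_derive_id x) (fun_deriveB (fun_derive_cst 1 x) (fun_derive_id x)).
  have vk0 : (x * (1 - x)) ^+ k != 0 by rewrite expf_neq0.
  have D := fun_deriveM (fun_deriveM (fun_derive_poly q x) (@fun_deriveV R (fun y => (y * (1 - y)) ^+ k) x _ vk0 (fun_deriveX k dv)))
    (@fun_derive_comp R (@expR R) _ x _ _ (is_derive_expR _) (fun_deriveN (@fun_deriveV R (fun y => y * (1 - y)) x _ v0 dv))).
  apply: is_derive_eq D _.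
  rewrite /flat_deriv_poly derivM derivB derivX derivC !hornerE.
  case: k vk0 {hC out} => [|k] vk0 /=.
    move: v0; rewrite mulf_eq0 negb_or => /andP[xn0 x1n0]. by field; apply/andP; split.
  move: v0; rewrite mulf_eq0 negb_or => /andP[xn0 x1n0].
  rewrite !exprS; field.
  by rewrite xn0 x1n0 expf_neq0// mulf_neq0.
have -> : flat (flat_deriv_poly q k) k.+2 x = 0 by rewrite /flat (negbTE nx).
apply: (@is_derive_quadratic _ _ _ C) => y; rewrite (out x nx) subr0.
have [/andP[y0 y1]|ny] := boolP (0 < y < 1); last first.
  by rewrite (out _ ny) normr0 mulr_ge0// sqr_ge0.
apply: le_trans (hC y _) _; first by rewrite !ltW.
rewrite ler_wpM2l//.
have v1 : 0 <= y * (1 - y) by rewrite mulr_ge0 ?subr_ge0 ?ltW.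
have [x0|x0] := leP x 0.
  apply: lerXn2r; rewrite ?nnegrE ?subr_ge0 ?(le_trans x0 (ltW y0))//.
  nra.
have x1 : 1 <= x by rewrite leNgt; apply/negP => x1; rewrite x0 x1 in nx.
rewrite -[X in _ <= X]sqrrN; apply: lerXn2r; rewrite ?nnegrE//; nra.
Qed.

Lemma flat0 q k x : ~~ (0 < x < 1) -> flat q k x = 0.
Proof. by rewrite /flat => /negbTE ->. Qed.

Lemma flat1_ge0 x : 0 <= flat 1 0 x.
Proof. by rewrite /flat; case: ifP => // _; rewrite hornerE expr0 divr1 mul1r expR_ge0. Qed.

Lemma flat1_gt0 x : 0 < x < 1 -> 0 < flat 1 0 x.
Proof. by rewrite /flat => ->; rewrite hornerE expr0 divr1 mul1r expR_gt0. Qed.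

Lemma continuous_flat q k : continuous (flat q k).
Proof. by move=> x; exact: is_derive_continuous (is_derive_flat q k x). Qed.

End FlatFunctions.

(** * Smooth steps, one-sided kernels and plateau test functions *)

Section SmoothStep.
Context (R : realType).
Local Notation mu := (@lebesgue_measure R).
Implicit Types (x e : R).

Let bump : R -> R := flat 1 0.
Let mass0 x := \int[mu]_(t in `]-oo, x]) bump t.

Let bump0 x : ~~ (0 < x < 1) -> bump x = 0. Proof. exact: flat0. Qed.

Let integrable_bump : mu.-integrable setT (EFin \o bump).
Proof.
have -> : EFin \o bump = (EFin \o bump) \_ `[0, 1].
  apply/funext => x; rewrite patchE; case: ifPn => // x01.
  rewrite /= bump0//; apply: contra x01 => /andP[x0 x1]; apply/mem_set.
  by rewrite /= in_itv/= !ltW.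
rewrite -integrable_mkcond//.
apply: continuous_compact_integrable; first exact: segment_compact.
by apply: continuous_subspaceT; exact: continuous_flat.
Qed.

Let is_derive_mass0 x : is_derive x (1 : R) mass0 (bump x).
Proof.
have [] := @continuous_FTC1 R bump -oo%O x (x + 1).
- by rewrite ltrDl.
- by apply: integrableS integrable_bump.
- exact: ltNyr.
- exact: continuous_flat.
by move=> dm dmE; apply: (DeriveDef dm); rewrite -derive1E; exact: dmE.
Qed.

Let mass0_le0 x : x <= 0 -> mass0 x = 0.
Proof.
move=> x0; rewrite /mass0 (@eq_Rintegral _ _ _ mu _ (cst 0) bump) ?Rintegral_cst ?mul0r// => t /set_mem /=.
by rewrite in_itv/= => tx; rewrite bump0// negb_and -leNgt (le_trans tx).
Qed.

Let mass0_ge1 x : 1 <= x -> mass0 x = mass0 1.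
Proof.
move=> x1; rewrite /mass0 Rintegral_mkcond [RHS]Rintegral_mkcond; congr Rintegral.
apply/funext => t; rewrite !patchE; case: ifPn => tx; case: ifPn => t1 //.
  apply: bump0; rewrite negb_and -!leNgt orbC ltW// ltNge; apply/negP => t1'.
  by move/negP: t1; apply; apply/mem_set; rewrite /= in_itv.
case/negP: tx; apply/mem_set; move/set_mem: t1; rewrite /= !in_itv/= => t1.
exact: le_trans x1.
Qed.

Let mass0_gt0 : 0 < mass0 1.
Proof.
have [c c01] := @MVT R mass0 bump 0 1 ltr01 (fun x _ => is_derive_mass0 x)
  (continuous_subspaceT (fun x => is_derive_continuous (is_derive_mass0 x))).
rewrite (mass0_le0 (lexx 0)) !subr0 mulr1 => ->.
by apply: flat1_gt0; move: c01; rewrite in_itv.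
Qed.

Definition smooth_step x : R := (\int[mu]_(t in `]-oo, x]) flat 1 0 t) / \int[mu]_(t in `]-oo, 1]) flat 1 0 t.
Definition smooth_mass : R := \int[mu]_(t in `]-oo, 1]) flat 1 0 t.

Lemma smooth_mass_gt0 : 0 < smooth_mass. Proof. exact: mass0_gt0. Qed.

Lemma smooth_step_le0 x : x <= 0 -> smooth_step x = 0.
Proof. by move=> x0; rewrite /smooth_step -/(mass0 x) (mass0_le0 x0) mul0r. Qed.

Lemma smooth_step_ge1 x : 1 <= x -> smooth_step x = 1.
Proof.
by move=> x0; rewrite /smooth_step -/(mass0 x) -/(mass0 1) (mass0_ge1 x0) divff// gt_eqF// mass0_gt0.
Qed.

Lemma is_derive_smooth_step x : is_derive x (1 : R) smooth_step (flat 1 0 x / smooth_mass).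
Proof.
apply: is_derive_eq (fun_deriveM (is_derive_mass0 x) (fun_derive_cst (mass0 1)^-1 x)) _.
by rewrite mulr0 addr0.
Qed.

(** A mollifier of mass one supported to the right of [a], in [[a, a + e]]. *)
Definition kernel (e a t : R) : R := flat 1 0 ((t - a) / e) / (smooth_mass * e).

(** A test function whose derivative is the kernel at [a] minus the kernel at [b]: inserted in the
    weak derivative identity, it compares averages of [f] near these two points. *)
Definition plateau (e a b t : R) : R := smooth_step ((t - a) / e) - smooth_step ((t - b) / e).

Lemma is_derive_affine_comp (f : R -> R) e (a t l : R) : is_derive ((t - a) / e) (1 : R) f l ->
  is_derive t (1 : R) (fun t => f ((t - a) / e)) (l / e).
Proof.
move=> fl; have D := fun_deriveM (fun_deriveB (fun_derive_id t) (fun_derive_cst a t)) (fun_derive_cst e^-1 t).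
apply: is_derive_eq (@fun_derive_comp R f (fun t => (t - a) / e) t l _ fl D) _.
by rewrite subr0 mul1r mulr0 addr0.
Qed.

Lemma is_derive_plateau (e a b t : R) :
  is_derive t (1 : R) (plateau e a b) (kernel e a t - kernel e b t).
Proof.
have D := fun_deriveB (is_derive_affine_comp (is_derive_smooth_step ((t - a) / e)))
  (is_derive_affine_comp (is_derive_smooth_step ((t - b) / e))).
by apply: is_derive_eq D _; rewrite /kernel invfM !mulrA.
Qed.

(** The induction needs the polynomial, the exponent and the scaling to vary, but they stay common
    to the two translates, so the difference keeps its shape. *)
Let flat_diff_smooth (q : {poly R}) k (c e a b : R) n :
  exists (q' : {poly R}) k' (c' : R),
  derive1n n (fun t => flat q k ((t - a) / e) * c - flat q k ((t - b) / e) * c) =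
  (fun t => flat q' k' ((t - a) / e) * c' - flat q' k' ((t - b) / e) * c').
Proof.
elim: n => [|n [q' [k' [c' ih]]]]; first by exists q, k, c.
exists (flat_deriv_poly q' k'), k'.+2, (c' / e); rewrite derive1nS ih.
apply/funext => t; rewrite derive1E.
have D z := fun_deriveM (is_derive_affine_comp (is_derive_flat q' k' ((t - z) / e))) (fun_derive_cst c' t).
have [_ ->] := fun_deriveB (D a) (D b).
by rewrite !mulr0 !addr0 -!mulrA [e^-1 * _]mulrC.
Qed.

Lemma test_function_plateau (e a b : R) : 0 < e -> 0 < a -> a < b -> b + e < 1 ->
  test_function (plateau e a b).
Proof.
move=> e0 a0 ab b1; split; last first.
  exists a, (b + e); split => //; first by rewrite (lt_trans ab)// ltrDl.
  move=> x; rewrite in_itv/= negb_and -!ltNge => /orP[xa|bx].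
    have h z : a <= z -> (x - z) / e <= 0.
      move=> az; by rewrite pmulr_lle0 ?invr_gt0// subr_le0 (le_trans (ltW xa)).
    by rewrite /plateau (smooth_step_le0 (h a (lexx _))) (smooth_step_le0 (h b (ltW ab))) subrr.
  have h z : z <= b -> 1 <= (x - z) / e.
    by move=> zb; rewrite ler_pdivlMr// mul1r lerBrDr addrC (le_trans _ (ltW bx))// lerD2r.
  by rewrite /plateau (smooth_step_ge1 (h a (ltW ab))) (smooth_step_ge1 (h b (lexx _))) subrr.
case=> [|n] x.
  by have [] := is_derive_plateau e a b x.
have -> : derive1n n.+1 (plateau e a b) = derive1n n (fun t =>
    flat 1 0 ((t - a) / e) * (smooth_mass * e)^-1 - flat 1 0 ((t - b) / e) * (smooth_mass * e)^-1).
  rewrite /derive1n iterSr; congr iter; apply/funext => t.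
  by rewrite derive1E; have [_ ->] := is_derive_plateau e a b t.
have [q [k [c ->]]] := flat_diff_smooth 1 0 (smooth_mass * e)^-1 e a b n.
have D z := fun_deriveM (is_derive_affine_comp (is_derive_flat q k ((x - z) / e))) (fun_derive_cst c x).
by have [] := fun_deriveB (D a) (D b).
Qed.

Lemma kernel_ge0 (e a t : R) : 0 < e -> 0 <= kernel e a t.
Proof. by move=> e0; rewrite divr_ge0 ?flat1_ge0// mulr_ge0// ltW// smooth_mass_gt0. Qed.

Lemma kernel_eq0 (e a t : R) : 0 < e -> ~~ (a < t < a + e) -> kernel e a t = 0.
Proof.
move=> e0 h; rewrite /kernel flat0 ?mul0r//; apply: contra h => /andP[].
rewrite pmulr_lgt0 ?invr_gt0// subr_gt0 => -> /=.
by rewrite ltr_pdivrMr// mul1r ltrBlDl.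
Qed.

Lemma continuous_kernel (e a : R) : continuous (kernel e a).
Proof.
move=> t; apply: (@is_derive_continuous R (kernel e a) t).
have D := fun_deriveM (is_derive_affine_comp (is_derive_flat 1 0 ((t - a) / e))) (fun_derive_cst (smooth_mass * e)^-1 t).
exact: D.
Qed.

Lemma Rintegral_kernel (e a c d : R) : 0 < e -> c <= a -> a + e <= d ->
  \int[mu]_(t in `[c, d]) kernel e a t = 1.
Proof.
move=> e0 ca aed.
have cd : c <= d by rewrite (le_trans ca)// (le_trans _ aed)// lerDl ltW.
have D t : is_derive t (1 : R) (fun t => smooth_step ((t - a) / e)) (kernel e a t).
  have D := is_derive_affine_comp (is_derive_smooth_step ((t - a) / e)).
  by apply: is_derive_eq D _; rewrite /kernel invfM !mulrA.
have P : is_primitive c d (kernel e a) (fun t => smooth_step ((t - a) / e)).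
  apply: (C1_is_primitive cd _ _ (fun t _ => D t)).
    by apply: continuous_subspaceT => t; exact: is_derive_continuous (D t).
  by apply: continuous_subspaceT => t; exact: continuous_kernel.
rewrite -(is_primitive_end cd P) smooth_step_ge1 ?smooth_step_le0 ?subr0//.
  by rewrite pmulr_lle0 ?invr_gt0// subr_le0.
by rewrite ler_pdivlMr// mul1r lerBrDl.
Qed.

End SmoothStep.

Section WeakDerivatives.
Context (R : realType).
Local Notation mu := (@lebesgue_measure R).
Implicit Types (f g w phi : R -> R) (a b c d x : R).

Lemma within_continuous_dist a b f x e : {within `[a, b], continuous f} ->
  x \in `[a, b] -> 0 < e ->
  exists2 r, 0 < r & forall t, t \in `[a, b] -> `|t - x| < r -> `|f t - f x| <= e.
Proof.
move=> /subspace_continuousP cf xab e0.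
have /cvgrPdist_le /(_ e e0) := cf x xab.
rewrite near_withinE => /nbhs_ballP[r /= r0 hr]; exists r => // t tab tx.
by rewrite distrC; apply: hr => //; rewrite /ball /= distrC.
Qed.

Lemma locally_integrable_itv a b w : 0 < a -> b < 1 ->
  locally_integrable `]0, 1[ w -> mu.-integrable `[a, b] (EFin \o w).
Proof.
move=> a0 b1 [mw _ lw].
have sub : `[a, b]%classic `<=` `]0, 1[%classic.
  by apply: subset_itv; rewrite bnd_simp.
apply/integrableP; split.
  by apply/measurable_EFinP; apply: measurable_funS mw.
exact: (lw _ sub (@segment_compact _ a b)).
Qed.

Lemma in_continuous_within a b f : 0 < a -> b < 1 ->
  {in `]0, 1[, continuous f} -> {within `[a, b], continuous f}.
Proof.
move=> a0 b1 cf; have sub : `[a, b]%classic `<=` `]0, 1[%classic.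
  by apply: subset_itv; rewrite bnd_simp.
apply: (continuous_subspaceW sub); rewrite continuous_open_subspace; last exact: interval_open.
by move=> x /set_mem /= x01; apply: cf; exact: x01.
Qed.

(** The kernel is a probability density living on []x, x + e[], so the average of [h] differs from
    [h x] by at most the oscillation of [h] there. *)
Lemma Rintegral_kernel_dist (a d x e r : R) (h : R -> R) : 0 < e -> a <= x -> x + e <= d ->
  {within `[a, d], continuous h} ->
  (forall t, t \in `[a, d] -> x < t < x + e -> `|h t - h x| <= r) ->
  `|\int[mu]_(t in `[a, d]) (h t * kernel e x t) - h x| <= r.
Proof.
move=> e0 ax xd ch hr.
have ck : {within `[a, d], continuous (kernel e x)}.
  by apply: continuous_subspaceT => t; exact: continuous_kernel.
have ik : mu.-integrable `[a, d] (EFin \o kernel e x).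
  by apply: continuous_compact_integrable => //; exact: segment_compact.
have ihk : mu.-integrable `[a, d] (EFin \o (fun t => h t * kernel e x t)).
  apply: continuous_compact_integrable; first exact: segment_compact.
  by move=> t; apply: cvgM; [exact: ch|exact: ck].
have icst z : mu.-integrable `[a, d] (EFin \o (fun t => z * kernel e x t)).
  apply: continuous_compact_integrable; first exact: segment_compact.
  by move=> t; apply: cvgM; [exact: cvg_cst|exact: ck].
have Icst z : \int[mu]_(t in `[a, d]) (z * kernel e x t) = z.
  by rewrite RintegralZl// Rintegral_kernel// mulr1.
have hr' t : t \in `[a, d] -> `|h t - h x| * kernel e x t <= r * kernel e x t.
  move=> tad; have [xt|xt] := boolP (x < t < x + e); last by rewrite kernel_eq0// !mulr0.
  by rewrite ler_wpM2r ?kernel_ge0// hr.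
have hl t : t \in `[a, d] -> (h x - r) * kernel e x t <= h t * kernel e x t.
  move=> tad; have := hr' t tad; have k0 := kernel_ge0 x t e0.
  have : - (h t - h x) * kernel e x t <= `|h t - h x| * kernel e x t.
    by rewrite ler_wpM2r// ler_normr lexx orbT.
  by lra.
have hu t : t \in `[a, d] -> h t * kernel e x t <= (h x + r) * kernel e x t.
  move=> tad; have := hr' t tad; have k0 := kernel_ge0 x t e0.
  have : (h t - h x) * kernel e x t <= `|h t - h x| * kernel e x t.
    by rewrite ler_wpM2r// ler_norm.
  by lra.
rewrite ler_distl; apply/andP; split.
- by rewrite -[leLHS]Icst; apply: le_Rintegral.
- by rewrite -[leRHS]Icst; apply: le_Rintegral.
Qed.

Lemma Rintegral_vanish_off (A B : set R) (u : R -> R) : 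
  (forall x, ~ (A x /\ B x) -> u x = 0) ->
  \int[mu]_(t in A) u t = \int[mu]_(t in B) u t.
Proof.
move=> u0; rewrite Rintegral_mkcond [RHS]Rintegral_mkcond; congr Rintegral.
apply/funext => t; rewrite !patchE.
case: ifPn => [/set_mem tA|tA]; case: ifPn => [/set_mem tB|tB] //.
- by apply: u0 => -[_ /mem_set]; apply/negP.
- by apply/esym/u0 => -[/mem_set + _]; apply/negP.
Qed.

(** With [W] an indefinite integral of [w] and [h = f - W], testing against a plateau shows that the
    averages of [h] just after [a] and just after [b] coincide. Shrinking the width and using
    continuity gives [h a = h b]. *)
Lemma weak_derivative_FTC f w a b : {in `]0, 1[, continuous f} ->
  is_weak_derivative f w -> 0 < a -> a < b -> b < 1 ->
  f b - f a = \int[mu]_(t in `[a, b]) w t.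
Proof.
move=> cf [_ lw fw] a0 ab b1.
(* Room to the right of [b] for the kernel supported in [[b, b + s]]. *)
pose d := (b + 1) / 2.
have bd : b < d by rewrite /d; lra.
have d1 : d < 1 by rewrite /d; lra.
have ad : a < d by exact: lt_trans bd.
have iw : mu.-integrable `[a, d] (EFin \o w) by exact: locally_integrable_itv.
pose W x := \int[mu]_(t in `[a, x]) w t.
have Wa : W a = 0 by rewrite /W set_itv1 Rintegral_set1.
have PW : is_primitive a d w W by split => // x _; rewrite Wa add0r.
pose h x := f x - W x.
have cfad : {within `[a, d], continuous f} by exact: in_continuous_within.
have cW := is_primitive_continuous (ltW ad) PW.
have ch : {within `[a, d], continuous h}.
  by move=> t; apply: cvgB; [exact: cfad|exact: cW].
suff hab : h b = h a by move: hab; rewrite /h Wa subr0 /W => <-; rewrite opprD opprK addrA subrr add0r.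
have aad : a \in `[a, d] by rewrite in_itv/= lexx ltW.
have bad : b \in `[a, d] by rewrite in_itv/= (ltW ab) ltW.
apply/eqP; rewrite -subr_eq0 -normr_le0; apply/ler_addgt0Pr => e e0; rewrite add0r.
have e20 : 0 < e / 2 by rewrite divr_gt0.
have [r1 r10 hr1] := within_continuous_dist ch aad e20.
have [r2 r20 hr2] := within_continuous_dist ch bad e20.
pose s := Num.min (Num.min r1 r2) (d - b).
have s0 : 0 < s by rewrite !lt_min r10 r20 subr_gt0.
have sr1 : s <= r1 by rewrite /s !ge_min lexx.
have sr2 : s <= r2 by rewrite /s !ge_min lexx orbT.
have sd : s <= d - b by rewrite /s !ge_min lexx orbT.
have bsd : b + s <= d by rewrite addrC -lerBrDr.
have asd : a + s <= d by rewrite (le_trans _ bsd)// lerD2r ltW.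
have bs1 : b + s < 1 by exact: le_lt_trans d1.
have Ia : `|\int[mu]_(t in `[a, d]) (h t * kernel s a t) - h a| <= e / 2.
  apply: Rintegral_kernel_dist => // t tad /andP[xt tx]; apply: hr1 => //.
  by rewrite gtr0_norm ?subr_gt0// ltrBlDl (lt_le_trans tx)// lerD2l.
have Ib : `|\int[mu]_(t in `[a, d]) (h t * kernel s b t) - h b| <= e / 2.
  apply: Rintegral_kernel_dist => //; first exact: ltW.
  move=> t tad /andP[xt tx]; apply: hr2 => //.
  by rewrite gtr0_norm ?subr_gt0// ltrBlDl (lt_le_trans tx)// lerD2l.
have ck x : {within `[a, d], continuous (kernel s x)}.
  by apply: continuous_subspaceT => t; exact: continuous_kernel.
pose phi := plateau s a b; pose phi' t := kernel s a t - kernel s b t.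
have dphi : derive1 phi = phi'.
  by apply/funext => t; rewrite derive1E; have [_ ->] := is_derive_plateau s a b t.
have cphi : {within `[a, d], continuous phi}.
  by apply: continuous_subspaceT => t; exact: is_derive_continuous (is_derive_plateau s a b t).
have cphi' : {within `[a, d], continuous phi'}.
  by move=> t; apply: cvgB; exact: ck.
have Tphi := test_function_plateau s0 a0 ab bs1.
have phi0 x : ~ (a < x < d) -> phi x = 0.
  move=> xad; have [ax|xa] := ltP a x; last first.
    have le0 z : a <= z -> (x - z) / s <= 0.
      by move=> az; rewrite pmulr_lle0 ?invr_gt0// subr_le0 (le_trans xa).
    by rewrite /phi /plateau (smooth_step_le0 (le0 a _)) ?(smooth_step_le0 (le0 b _)) ?subrr// ltW.
  have dx : d <= x by rewrite leNgt; apply/negP => xd; apply: xad; rewrite ax xd.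
  have ge1 z : z <= b -> 1 <= (x - z) / s.
    move=> zb; rewrite ler_pdivlMr// mul1r lerBrDr (le_trans _ dx)// (le_trans _ bsd)//.
    by rewrite addrC lerD2r.
  by rewrite /phi /plateau (smooth_step_ge1 (ge1 a _)) ?(smooth_step_ge1 (ge1 b _)) ?subrr// ltW.
have phi'0 x : ~ (a <= x <= d) -> phi' x = 0.
  move=> xad; rewrite /phi' !kernel_eq0// ?subrr//; apply/negP => /andP[h1 h2]; apply: xad.
    by rewrite (ltW (lt_trans ab h1)) (le_trans (ltW h2)).
  by rewrite (ltW h1) (le_trans (ltW h2)).
have sub x : a <= x <= d -> 0 < x < 1.
  by move=> /andP[ax xd]; rewrite (lt_le_trans a0)// (le_lt_trans xd).
(* The weak derivative identity, restricted to [[a, d]] because [phi] and its derivative vanish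
   elsewhere. *)
have E1 : \int[mu]_(t in `[a, d]) (f t * phi' t) = - \int[mu]_(t in `[a, d]) (w t * phi t).
  have := fw phi Tphi; rewrite dphi => fwE.
  rewrite (@Rintegral_vanish_off `[a, d]%classic `]0, 1[%classic); last first.
    move=> x; rewrite /= !in_itv/= => nx; rewrite phi'0 ?mulr0// => xad; apply: nx.
    by split => //; exact: sub.
  rewrite fwE; congr (- _); apply: Rintegral_vanish_off => x.
  rewrite /= !in_itv/= => nx; rewrite phi0 ?mulr0// => /andP[ax xd]; apply: nx.
  have axd : a <= x <= d by rewrite !ltW.
  by split => //; exact: sub.
have Pphi : is_primitive a d phi' phi.
  by apply: (C1_is_primitive (ltW ad) cphi cphi') => t _; exact: is_derive_plateau.
have E2 := is_primitive_ibp (ltW ad) PW Pphi.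
rewrite (phi0 a) ?ltxx// (phi0 d) ?ltxx ?andbF// !mulr0 subrr in E2.
have ifp : mu.-integrable `[a, d] (EFin \o (fun t => f t * phi' t)).
  apply: continuous_compact_integrable; first exact: segment_compact.
  by move=> t; apply: cvgM; [exact: cfad|exact: cphi'].
have iWp : mu.-integrable `[a, d] (EFin \o (fun t => phi' t * W t)).
  apply: continuous_compact_integrable; first exact: segment_compact.
  by move=> t; apply: cvgM; [exact: cphi'|exact: cW].
have ihk x : mu.-integrable `[a, d] (EFin \o (fun t => h t * kernel s x t)).
  apply: continuous_compact_integrable; first exact: segment_compact.
  by move=> t; apply: cvgM; [exact: ch|exact: ck].
(* [E1] is the weak identity for [f] and [E2] the integration by parts for [W]; their difference
   says that [h] integrates to zero against the derivative of the plateau. *)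
have E3 : \int[mu]_(t in `[a, d]) (h t * kernel s a t) = \int[mu]_(t in `[a, d]) (h t * kernel s b t).
  apply/eqP; rewrite -subr_eq0 -RintegralB//.
  rewrite (_ : Rintegral _ _ _ = \int[mu]_(t in `[a, d]) (f t * phi' t - phi' t * W t)); last first.
    by apply: eq_Rintegral => t _; rewrite /h /phi'; ring.
  by rewrite RintegralB// E1; apply/eqP; lra.
rewrite -E3 in Ib.
set I := \int[mu]_(t in _) _ in Ia Ib.
have -> : h b - h a = (I - h a) - (I - h b) by ring.
by apply: le_trans (ler_normB _ _) _; lra.
Qed.

Lemma weak_derivative_is_primitive f w a b : {in `]0, 1[, continuous f} ->
  is_weak_derivative f w -> 0 < a -> b < 1 -> is_primitive a b w f.
Proof.
move=> cf fw a0 b1; have [_ lw _] := fw; split; first exact: locally_integrable_itv.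
move=> x; rewrite in_itv/= => /andP[]; rewrite le_eqVlt => /predU1P[<- _|ax xb].
  by rewrite set_itv1 Rintegral_set1 addr0.
by rewrite -(weak_derivative_FTC cf fw a0 ax (le_lt_trans xb b1)) addrC subrK.
Qed.

(** Integration by parts on an interval [[a, b]] slightly larger than the support of the test
    function, where the boundary terms vanish. *)
Lemma is_primitive_weak_derivative f w : {in `]0, 1[, continuous f} ->
  locally_integrable `]0, 1[ w ->
  (forall a b, 0 < a -> a < b -> b < 1 -> is_primitive a b w f) ->
  is_weak_derivative f w.
Proof.
move=> cf lw P; split => //.
  split.
  - apply: open_continuous_measurable_fun; first exact: interval_open.
    by move=> x /set_mem /= x01; exact: cf.
  - exact: interval_open.
  - move=> K KD cK.
    have : mu.-integrable K (EFin \o f).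
      apply: continuous_compact_integrable => //.
      apply: (continuous_subspaceW KD); rewrite continuous_open_subspace; last exact: interval_open.
      by move=> x /set_mem /= x01; exact: cf.
    by case/integrableP.
move=> phi [sphi [c [d [c0 cd d1 phi0]]]].
pose a := c / 2; pose b := (d + 1) / 2.
have a0 : 0 < a by rewrite /a; lra.
have b1 : b < 1 by rewrite /b; lra.
have ac : a < c by rewrite /a; lra.
have db : d < b by rewrite /b; lra.
have ab : a < b by lra.
have dphi x : is_derive x (1 : R) phi (derive1 phi x).
  by apply: DeriveDef; [exact: (sphi 0%N x)|rewrite derive1E].
have cdphi : continuous (derive1 phi).
  by move=> x; have /derivable1_diffP /differentiable_continuous := sphi 1%N x; exact.
have dphi0 x : x \notin `[c, d] -> derive1 phi x = 0.
  move=> xcd; have [] : is_derive x (1 : R) phi 0; last by rewrite derive1E.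
  apply: (near_is_derive _ (fun_derive_cst 0 x)).
  have : x \in ~` `[c, d]%classic by apply/mem_set; exact/negP.
  have oC : open (~` `[c, d]%classic) by apply: closed_openC; exact: interval_closed.
  move=> /set_mem xC; have := open_nbhs_nbhs (conj oC xC).
  by apply: filterS => y ycd; rewrite phi0//; apply/negP.
have Pphi : is_primitive a b (derive1 phi) phi.
  apply: (C1_is_primitive (ltW ab) _ _ (fun x _ => dphi x)).
    by apply: continuous_subspaceT => t; exact: is_derive_continuous (dphi t).
  exact: continuous_subspaceT.
have := is_primitive_ibp (ltW ab) (P a b a0 ab b1) Pphi.
have aN : a \notin `[c, d] by rewrite in_itv/= negb_and -ltNge ac.
have bN : b \notin `[c, d] by rewrite in_itv/= negb_and -!ltNge db orbT.
rewrite (phi0 a aN) (phi0 b bN) !mulr0 subrr => E.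
rewrite (@Rintegral_vanish_off `]0, 1[%classic `[a, b]%classic); last first.
  move=> x nx; have [xcd|xcd] := boolP (x \in `[c, d]); last by rewrite dphi0// mulr0.
  case: nx; move: xcd; rewrite /= !in_itv/= => /andP[cx xd].
  by split; apply/andP; split; lra.
rewrite [in RHS](@Rintegral_vanish_off `]0, 1[%classic `[a, b]%classic); last first.
  move=> x nx; have [xcd|xcd] := boolP (x \in `[c, d]); last by rewrite phi0// mulr0.
  case: nx; move: xcd; rewrite /= !in_itv/= => /andP[cx xd].
  by split; apply/andP; split; lra.
under eq_Rintegral do rewrite mulrC.
by apply/eqP; rewrite -addr_eq0 addrC; apply/eqP.
Qed.
End WeakDerivatives.

(** * Jacobi polynomials and Gauss quadrature *)

Section JacobiPolynomials.
Context (R : realType).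
Variables (mu ups : R).
Implicit Types (n k : nat) (r u v : {poly R}).

(** These are the data of the Jacobi equation moved to [[0, 1]]: for the weight
    [w = s^ups (1 - s)^mu] one has [(p w)' = tau w], with [p] the polynomial [jpoly] and [tau] the
    polynomial [jtau]. *)
Definition jpoly : {poly R} := 'X * (1 - 'X).
Definition jtau : {poly R} := (ups + 1) *: (1 - 'X) - (mu + 1) *: 'X.
Definition jeig n : R := n%:R * (n%:R + mu + ups + 1).
Definition jop u : {poly R} := jpoly * u^`()^`() + jtau * u^`().

Lemma gbinomS (z : R) k : k.+1%:R * gbinom z k.+1 = (z - k%:R) * gbinom z k.
Proof.
rewrite /gbinom big_ord_recr /= factS natrM.
have f0 : (k`!)%:R != 0 :> R by rewrite pnatr_eq0 -lt0n fact_gt0.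
have k0 : k.+1%:R != 0 :> R by rewrite pnatr_eq0.
by move: k0; rewrite -natr1 => k0; field; rewrite f0 k0.
Qed.

Definition jcoef n k : R := gbinom (n%:R + mu) (n - k) * gbinom (n%:R + ups) k.

(** The ratio of consecutive coefficients, obtained by moving one factor from one binomial to the
    other; it is the cancellation condition in the proof of the differential equation. *)
Lemma jcoef_rec n k : (k < n)%N ->
  jcoef n k.+1 * (k.+1%:R * (k.+1%:R + mu)) =
  jcoef n k * ((n - k)%:R * ((n - k)%:R + ups)).
Proof.
move=> kn; rewrite /jcoef.
have E : (n - k)%N = (n - k.+1).+1 by rewrite subnSK.
rewrite E; set m := (n - k.+1)%N.
have nE : n%:R = m%:R + k%:R + 1 :> R by rewrite -addrA natr1 -natrD /m subnK.
have e1 := gbinomS (n%:R + mu) m; have e2 := gbinomS (n%:R + ups) k.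
transitivity (gbinom (n%:R + mu) m * (k.+1%:R + mu) * (k.+1%:R * gbinom (n%:R + ups) k.+1)); first ring.
transitivity (m.+1%:R * gbinom (n%:R + mu) m.+1 * gbinom (n%:R + ups) k * (m.+1%:R + ups)); last ring.
by rewrite e1 e2 nE -!natr1; ring.
Qed.

(** The classical polynomial at [2 s - 1]: the two halves [(x - 1) / 2] and [(x + 1) / 2] become
    [s - 1] and [s]. *)
Definition jacobi01 n : {poly R} :=
  \sum_(k < n.+1) jcoef n k *: (('X - 1) ^+ k * 'X ^+ (n - k)).

Lemma jacobi01E n (s : R) : (jacobi mu ups n).[2 * s - 1] = (jacobi01 n).[s].
Proof.
rewrite /jacobi /jacobi01 !horner_sum; apply: eq_bigr => k _.
rewrite !hornerE /jcoef; 
have -> : 2^-1 * (2 * s - 1 - 1) = s - 1 by field.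
have -> : 2^-1 * (2 * s - 1 + 1) = s by field.
by rewrite !mulrA.
Qed.

Lemma size_jacobi01 n : (size (jacobi01 n) <= n.+1)%N.
Proof.
apply: (leq_trans (size_sum _ _ _)); apply/bigmax_leqP => k _.
apply: (leq_trans (size_scale_leq _ _)).
apply: (leq_trans (size_polyMleq _ _)).
rewrite -[1]/(1%:P) size_exp_XsubC size_polyXn addSn /= addnS subnKC//.
by rewrite -ltnS.
Qed.

(** This basis is adapted to the operator: adding the eigenvalue of total degree [k + m] removes
    every term of that degree and leaves only those with one exponent lowered by one. *)
Lemma jop_monomial k m :
  jop (('X - 1) ^+ k * 'X ^+ m) + jeig (k + m) *: (('X - 1) ^+ k * 'X ^+ m) =
  (m%:R + ups) *: (('X - 1) ^+ k * ('X ^+ m)^`()) - (k%:R + mu) *: ((('X - 1) ^+ k)^`() * 'X ^+ m).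
Proof.
set z : {poly R} := 'X - 1; set s : {poly R} := 'X.
set e := z ^+ k * s ^+ m; set a := (z ^+ k)^`(); set b := (s ^+ m)^`().
have ds : s^`() = 1 by rewrite derivX.
have dz : z^`() = 1 by rewrite derivB derivX derivC subr0.
have za : z * a = k%:R *: z ^+ k.
  rewrite /a deriv_exp dz mul1r scaler_nat; case: (k) => [|i]; first by rewrite !mulr0n mulr0.
  by rewrite /= mulrnAr -exprS.
have sb : s * b = m%:R *: s ^+ m.
  rewrite /b deriv_exp ds mul1r scaler_nat; case: (m) => [|i]; first by rewrite !mulr0n mulr0.
  by rewrite /= mulrnAr -exprS.
have de : e^`() = a * s ^+ m + z ^+ k * b by rewrite /e derivM.
(* The logarithmic derivative of [e] cleared of denominators; differentiating it gives the
   second-order identity [E2]. *)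
have E1 : z * s * e^`() = (k%:R *: s + m%:R *: z) * e.
  rewrite de mulrDr.
  rewrite (_ : z * s * (a * s ^+ m) = (z * a) * s * s ^+ m); last ring.
  rewrite (_ : z * s * (z ^+ k * b) = (s * b) * z * z ^+ k); last ring.
  by rewrite za sb -!mul_polyC /e; ring.
have E2 : z * s * e^`()^`() = (k + m)%:R *: e + (k%:R *: s + m%:R *: z - z - s) * e^`().
  have := congr1 (@deriv R) E1.
  rewrite (derivM (z * s) e^`()) (derivM z s) (derivM (k%:R *: s + m%:R *: z) e) (derivD (k%:R *: s)) !derivZ ds dz => H.
  have -> : z * s * e^`()^`() = ((1 * s + z * 1) * e^`() + z * s * e^`()^`()) - (s + z) * e^`() by ring.
  by rewrite H natrD -!mul_polyC polyCD; ring.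
have sz : s = z + 1 by rewrite /z subrK.
have jE : jpoly = - (z * s) by rewrite /jpoly /z /s; ring.
have tE : jtau = - ((ups + 1) *: z + (mu + 1) *: s).
  by rewrite /jtau /z /s -!mul_polyC; ring.
rewrite /jop jE tE mulNr E2.
(* The relation [s = z + 1] creates the lowered terms: [F] and [G] split into a multiple of [e] and
   a lowered term, while [F'] and [G'] give multiples of [e] only. *)
have F : (k%:R + mu) *: s * (a * s ^+ m) = (k%:R + mu) *: (a * s ^+ m) + ((k%:R + mu) * k%:R) *: e.
  rewrite sz -!mul_polyC polyCM -/z.
  rewrite (_ : (k%:R + mu)%:P * (z + 1) * (a * (z + 1) ^+ m) =
   (k%:R + mu)%:P * (a * (z + 1) ^+ m) + (k%:R + mu)%:P * ((z * a) * (z + 1) ^+ m)); last ring.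
  by rewrite za -mul_polyC /e sz; ring.
have G : (m%:R + ups) *: z * (z ^+ k * b) = ((m%:R + ups) * m%:R) *: e - (m%:R + ups) *: (z ^+ k * b).
  rewrite -!mul_polyC polyCM.
  rewrite (_ : (m%:R + ups)%:P * z * (z ^+ k * b) =
   (m%:R + ups)%:P * (z ^+ k * ((z + 1) * b)) - (m%:R + ups)%:P * (z ^+ k * b)); last ring.
  by rewrite -sz sb -mul_polyC /e; ring.
have F' : (k%:R + mu) *: s * (z ^+ k * b) = ((k%:R + mu) * m%:R) *: e.
  rewrite -!mul_polyC polyCM.
  rewrite (_ : (k%:R + mu)%:P * s * (z ^+ k * b) = (k%:R + mu)%:P * z ^+ k * (s * b)); last ring.
  by rewrite sb -mul_polyC /e; ring.
have G' : (m%:R + ups) *: z * (a * s ^+ m) = ((m%:R + ups) * k%:R) *: e.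
  rewrite -!mul_polyC polyCM.
  rewrite (_ : (m%:R + ups)%:P * z * (a * s ^+ m) = (m%:R + ups)%:P * s ^+ m * (z * a)); last ring.
  by rewrite za -mul_polyC /e; ring.
transitivity ((jeig (k + m) - (k + m)%:R) *: e
   - ((k%:R + mu) *: s * (a * s ^+ m) + (k%:R + mu) *: s * (z ^+ k * b)
     + (m%:R + ups) *: z * (a * s ^+ m) + (m%:R + ups) *: z * (z ^+ k * b))).
  by rewrite de -!mul_polyC !polyCD; ring.
rewrite F F' G G' /jeig natrD -!mul_polyC.
rewrite !(polyCM, polyCD, polyCB); ring.
Qed.

(** Each basis element leaves two lowered terms, and the one from index [k] cancels against the one
    from [k + 1] by [jcoef_rec]. *)
Lemma jacobi01_ode n : jop (jacobi01 n) + jeig n *: jacobi01 n = 0.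
Proof.
have jopD u v : jop (u + v) = jop u + jop v by rewrite /jop !derivD; ring.
have jopZ c u : jop (c *: u) = c *: jop u by rewrite /jop !derivZ -!mul_polyC; ring.
have jop0 : jop 0 = 0 by rewrite /jop !deriv0; ring.
rewrite /jacobi01 (big_morph jop jopD jop0) scaler_sumr -big_split /=.
transitivity (\sum_(k < n.+1) (jcoef n k * ((n - k)%:R + ups)) *: (('X - 1) ^+ k * ('X ^+ (n - k))^`())
   - \sum_(k < n.+1) (jcoef n k * (k%:R + mu)) *: ((('X - 1) ^+ k)^`() * 'X ^+ (n - k)) : {poly R}).
  rewrite -sumrB; apply: eq_bigr => k _.
  have kn : (k <= n)%N by rewrite -ltnS.
  have := jop_monomial k (n - k); rewrite subnKC// => H.
  transitivity (jcoef n k *: (jop (('X - 1) ^+ k * 'X ^+ (n - k)) +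
    jeig n *: (('X - 1) ^+ k * 'X ^+ (n - k)))).
    by rewrite jopZ [RHS]scalerDr !scalerA (mulrC (jeig n)).
  by rewrite H scalerBr !scalerA.
(* The last term of the first sum and the first term of the second contain the derivative of a
   constant; dropping them aligns [k] with [k + 1]. *)
rewrite big_ord_recr /= subnn expr0 derivC mulr0 scaler0 addr0.
rewrite [X in _ - X]big_ord_recl /= expr0 derivC mul0r scaler0 add0r -sumrB big1// => k _.
rewrite [bump 0 k]/bump /= add1n !deriv_exp derivX derivB derivX derivC subr0 !mul1r /=.
have nk : (n - k.+1)%N = (n - k).-1 by rewrite subnS.
rewrite mulrnAr mulrnAl nk.
set u := _ * 'X^_; rewrite -[u *+ (n - k)]scaler_nat -[u *+ k.+1]scaler_nat !scalerA -scalerBl.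
have := @jcoef_rec n k (ltn_ord k) => H.
suff -> : jcoef n k * ((n - k)%:R + ups) * (n - k)%:R - jcoef n k.+1 * (k.+1%:R + mu) * k.+1%:R = 0.
  by rewrite scale0r.
apply/eqP; rewrite subr_eq0; apply/eqP.
transitivity (jcoef n k * ((n - k)%:R * ((n - k)%:R + ups))); first ring.
by rewrite -H; ring.
Qed.
End JacobiPolynomials.

(** * Orthogonality for a linear functional satisfying the integration by parts rule *)

Section JacobiFunctional.
Context (R : realType).
Variables (mu ups : R).
Local Notation D := (jop mu ups).
Local Notation tau := (jtau mu ups).
Local Notation lam := (jeig mu ups).
Local Notation p := (jpoly R).
Implicit Types (n m k : nat) (r u v P q : {poly R}).

Variable L : {poly R} -> R.
Hypothesis LD : forall u v, L (u + v) = L u + L v.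
Hypothesis LZ : forall c u, L (c *: u) = c * L u.
Hypothesis Libp : forall r, L (p * r^`() + tau * r) = 0.

Let L0 : L 0 = 0. Proof. by rewrite -(scale0r 0) LZ mul0r. Qed.
Let LN u : L (- u) = - L u. Proof. by rewrite -scaleN1r LZ mulN1r. Qed.
Let LB u v : L (u - v) = L u - L v. Proof. by rewrite LD LN. Qed.

(** Apply the integration by parts rule to [r = u' v]. *)
Lemma jacobi_green u v : L (D u * v) = - L (p * u^`() * v^`()).
Proof.
apply/eqP; rewrite -addr_eq0 -LD -[X in _ == X](Libp (u^`() * v)); apply/eqP; congr L.
by rewrite /jop derivM; ring.
Qed.

Lemma jacobi_symmetric u v : L (D u * v) = L (u * D v).
Proof. by rewrite jacobi_green [u * _]mulrC jacobi_green; congr (- L _); ring. Qed.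

(** In the monomial basis the operator is triangular with diagonal entries [- lam i]; hence adding
    [lam m] kills the coefficient of degree [m]. *)
Lemma coef_jop r i : (D r)`_i = (i.+1)%:R * (i%:R + ups + 1) * r`_i.+1 - lam i * r`_i.
Proof.
have jE : D r = 'X * r^`()^`() - 'X * ('X * r^`()^`()) + (ups + 1) *: r^`() - (mu + ups + 2) *: ('X * r^`()).
  by rewrite /jop /jpoly /jtau -!mul_polyC !(polyCD, polyCM); ring.
have n1 k : k.+1%:R = k%:R + 1 :> R by rewrite natr1.
have cd u k : u^`()`_k = k.+1%:R * u`_k.+1 by rewrite coef_deriv mulr_natl.
rewrite jE !(coefD, coefN, coefZ, coefXM) !cd /jeig.
case: i => [|[|i]] /=; rewrite ?cd ?n1; ring.
Qed.

Lemma size_jop_lt m r : (size r <= m.+1)%N -> (size (D r + lam m *: r)%R <= m)%N.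
Proof.
move=> sr; apply/leq_sizeP => i mi.
have r0 k : (m < k)%N -> r`_k = 0 by move=> mk; apply: (leq_sizeP _ _ sr).
rewrite coefD coefZ coef_jop (r0 i.+1)//.
have [->|mi'] := eqVneq m i; first ring.
have -> : r`_i = 0 by apply: r0; rewrite ltn_neqAle mi'.
ring.
Qed.

Hypothesis mu1 : -1 < mu.
Hypothesis ups1 : -1 < ups.

Lemma jeig_lt n m : (m < n)%N -> lam m < lam n.
Proof.
move=> mn; rewrite -subr_gt0.
have -> : lam n - lam m = (n%:R - m%:R) * (n%:R + m%:R + mu + ups + 1) by rewrite /jeig; ring.
rewrite mulr_gt0 ?subr_gt0 ?ltr_nat//.
have n1 : 1 <= n%:R :> R by rewrite ler1n; case: n mn.
have m0 : 0 <= m%:R :> R by exact: ler0n.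
move: mu1 ups1; lra.
Qed.

Variables (n : nat) (P : {poly R}).
Hypothesis ode : D P + lam n *: P = 0.

Let DP : D P = - (lam n *: P). Proof. by apply/eqP; rewrite -addr_eq0 ode. Qed.

(** By symmetry, [L (P (D r + lam m r)) = (lam m - lam n) L (P r)] for [r] of degree at most [m].
    The left side involves a polynomial of smaller degree, so it vanishes by induction, and the
    eigenvalues are distinct. *)
Lemma jacobi_orthogonal r : (size r <= n)%N -> L (P * r) = 0.
Proof.
suff H m : forall r, (m <= n)%N -> (size r <= m)%N -> L (P * r) = 0 by move=> sr; exact: (H n).
elim: m => [|m ih] {}r mn sr.
  by move: sr; rewrite leqn0 size_poly_eq0 => /eqP ->; rewrite mulr0 L0.
have H1 := ih (D r + lam m *: r) (ltnW mn) (size_jop_lt sr).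
have H2 := jacobi_symmetric P r.
rewrite DP mulNr -scalerAl LN LZ in H2.
rewrite mulrDr LD -scalerAr LZ -H2 addrC -mulNr -mulrDl in H1.
move/eqP: H1; rewrite mulf_eq0 subr_eq0 => /orP[|/eqP//].
by rewrite lt_eqF// jeig_lt.
Qed.

(** Cross-multiplying by the coefficients of degree [n] cancels the top terms of [r] and [P], and
    what is left is orthogonal to [P]. *)
Lemma jacobi_mul_le r : (size P <= n.+1)%N -> (size r <= n.+1)%N ->
  P`_n * L (P * r) = r`_n * L (P * P).
Proof.
move=> sP sr; apply/eqP; rewrite -subr_eq0 -!LZ -LB.
rewrite !scalerAr -mulrBr; apply/eqP; apply: jacobi_orthogonal.
apply/leq_sizeP => k; rewrite leq_eqVlt => /predU1P[<-|nk].
  by rewrite coefB !coefZ mulrC subrr.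
have rk : r`_k = 0 by exact: (leq_sizeP _ _ sr).
have Pk : P`_k = 0 by exact: (leq_sizeP _ _ sP).
by rewrite coefB !coefZ rk Pk !mulr0 subr0.
Qed.

(* [p(xi) = p + p' (xi - X) - (xi - X)^2] reduces [p(xi) L(q^2)] to products of
   [P] with polynomials of degree [n]. *)
Lemma jacobi_christoffel xi q : size P = n.+1 -> P = ('X - xi%:P) * q ->
  p.[xi] * L (q * q) = (2 * n%:R + mu + ups + 1) * L (P * P).
Proof.
move=> sP Pq.
have P0 : P != 0 by rewrite -size_poly_eq0 sP.
have q0 : q != 0 by apply: contra_neq P0 => q0; rewrite Pq q0 mulr0.
have sq : size q = n by move: sP; rewrite Pq size_monicM ?monicXsubC// size_XsubC => -[].
have n0 : (0 < n)%N by rewrite -sq lt0n size_poly_eq0.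
have Pn0 : P`_n != 0 by move: P0; rewrite -lead_coef_eq0 lead_coefE sP.
have qk k : (n <= k)%N -> q`_k = 0 by move=> nk; rewrite nth_default// sq.
have qn : q`_n = 0 by exact: qk.
have PqE : P`_n = q`_n.-1.
  by rewrite Pq mulrBl coefB coefXM coefCM qn mulr0 subr0 gtn_eqF.
have n1 k : k.+1%:R = k%:R + 1 :> R by rewrite natr1.
have cd u k : u^`()`_k = k.+1%:R * u`_k.+1 by rewrite coef_deriv mulr_natl.
have dp : p^`() = 1 - 'X - 'X.
  by rewrite /jpoly derivM derivB derivX derivC; ring.
have sqS : (size q <= n.+1)%N by rewrite sq.
have sqXq : (size ('X * q)%R <= n.+1)%N.
  by rewrite (leq_trans (size_polyMleq _ _))// size_polyX sq.
(* The top coefficient of [q] is that of [P], so a product with [P] is evaluated by reading one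
   coefficient of degree [n]. *)
have Lle r c : (size r <= n.+1)%N -> r`_n = c * q`_n.-1 -> L (P * r) = c * L (P * P).
  move=> sr rn; apply: (mulfI Pn0); rewrite jacobi_mul_le ?sP// rn PqE; ring.
have E1 : L (P * (p^`() * q)) = - 2 * L (P * P).
  rewrite dp; apply: Lle.
    rewrite (_ : _ * q = q + (- 2) *: ('X * q)); last by rewrite -mul_polyC polyCN; ring.
    by rewrite (leq_trans (size_polyD _ _))// geq_max sqS (leq_trans (size_scale_leq _ _)).
  by rewrite !mulrBl mul1r !coefB coefXM qn gtn_eqF//; ring.
have E2 : L (P * (p * q^`())) = - (n%:R - 1) * L (P * P).
  have -> : p * q^`() = 'X * q^`() - 'X * ('X * q^`()) by rewrite /jpoly; ring.
  apply: Lle.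
    apply/leq_sizeP => -[//|k]; rewrite ltnS => nk; rewrite coefB !coefXM /= !cd.
    rewrite (qk k.+1) ?(leq_trans nk)// mulr0 sub0r; case: k nk => [|k] nk /=; first by rewrite oppr0.
    by rewrite (qk k.+1)// mulr0 oppr0.
  rewrite coefB !coefXM gtn_eqF// !cd; case: (n) n0 qn => // m _ qm /=.
  rewrite qm mulr0 sub0r; case: m qm => [|m] _ /=; first by rewrite subrr oppr0 mul0r.
  by rewrite !n1; ring.
have E3 : L (P * (tau * q)) = - (mu + ups + 2) * L (P * P).
  have -> : tau * q = (ups + 1) *: q + (- (mu + ups + 2)) *: ('X * q).
    by rewrite /jtau -!mul_polyC !(polyCD, polyCN, polyCM); ring.
  apply: Lle.
    rewrite (leq_trans (size_polyD _ _))// geq_max.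
    by rewrite !(leq_trans (size_scale_leq _ _)).
  by rewrite coefD !coefZ coefXM qn gtn_eqF//; ring.
(* Integration by parts at [r = P q], with [P' q = q^2 + P q'] from the factorization of [P]. *)
have E4 : L (p * q * q) + 2 * L (P * (p * q^`())) + L (P * (tau * q)) = 0.
  rewrite -LZ -!LD -[RHS](Libp (P * q)); congr L.
  rewrite derivM [in P^`()]Pq derivM derivB derivX derivC.
  rewrite -[2 *: _]mul_polyC (_ : 2%:P = 2); last by rewrite polyCMn.
  rewrite (_ : ((1 - 0) * q + ('X - xi%:P) * q^`()) * q = q * q + (('X - xi%:P) * q) * q^`()); last ring.
  by rewrite -Pq; ring.
have E5 : p.[xi] *: (q * q) = p * q * q - P * (p^`() * q) - P * P.
  have -> : p.[xi] = xi * (1 - xi) by rewrite /jpoly !hornerE.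
  by rewrite -mul_polyC dp Pq /jpoly !(polyCM, polyCB, polyC1); ring.
rewrite -LZ E5 !LB E1; move: E4; rewrite E2 E3; lra.
Qed.

End JacobiFunctional.

(** * Lagrange polynomials at the roots and Gauss quadrature *)

Section LagrangeNodes.
Context (R : realType).
Variables (n : nat) (x : 'I_n -> R) (P : {poly R}).
Hypotheses (xinj : injective x) (sizeP : (size P <= n.+1)%N) (P0 : P != 0).
Hypothesis Px : forall i, P.[x i] = 0.

Definition lagrange_poly (j : 'I_n) : {poly R} :=
  \prod_(i < n | i != j) ((x j - x i)^-1 *: ('X - (x i)%:P)).

Lemma nodal_size : size P = n.+1.
Proof.
apply/eqP; rewrite eqn_leq sizeP /=.
have := @max_poly_roots _ P (codom x) P0.
rewrite size_codom card_ord; apply.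
  by apply/allP => _ /codomP[i ->]; rewrite rootE Px.
by rewrite map_inj_uniq ?enum_uniq.
Qed.

Lemma nodal_factor : P = lead_coef P *: \prod_(i < n) ('X - (x i)%:P).
Proof.
have sz : size P = (size (codom x)).+1 by rewrite size_codom card_ord nodal_size.
rewrite [LHS](all_roots_prod_XsubC sz).
- by rewrite big_map big_enum.
- by apply/allP => _ /codomP[i ->]; rewrite rootE Px.
- by rewrite uniq_rootsE map_inj_uniq ?enum_uniq.
Qed.

Lemma nodal_cofactor j :
  exists2 q, P = ('X - (x j)%:P) * q & q = P^`().[x j] *: lagrange_poly j.
Proof.
pose q := lead_coef P *: \prod_(i < n | i != j) ('X - (x i)%:P).
have Pq : P = ('X - (x j)%:P) * q by rewrite [LHS]nodal_factor (bigD1 j)//= scalerAr.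
exists q => //.
have -> : P^`().[x j] = q.[x j].
  rewrite Pq derivM hornerD !hornerM hornerXsubC subrr mul0r addr0.
  by rewrite derivB derivX derivC subr0 hornerC mul1r.
rewrite /q /lagrange_poly hornerZ -scalerA; congr (_ *: _).
rewrite horner_prod scaler_prod scalerA -big_split -[LHS]scale1r; congr (_ *: _).
apply/esym/big1 => i ij.
rewrite hornerXsubC /= divff// subr_eq0; apply: contra ij => /eqP /xinj ->.
by [].
Qed.

Lemma nodal_deriv_neq0 j : P^`().[x j] != 0.
Proof.
have [q Pq qE] := nodal_cofactor j.
by apply: contra_neq P0 => d0; rewrite Pq qE d0 scale0r mulr0.
Qed.

Lemma nodal_log_deriv z : (forall i, z != x i) ->
  P^`().[z] = P.[z] * \sum_(i < n) (z - x i)^-1.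
Proof.
move=> zx; rewrite nodal_factor derivZ !hornerZ -mulrA; congr (_ * _).
have H (s : seq 'I_n) : (\prod_(i <- s) ('X - (x i)%:P))^`().[z] =
    (\prod_(i <- s) ('X - (x i)%:P)).[z] * \sum_(i <- s) (z - x i)^-1.
  elim: s => [|i s ih]; first by rewrite !big_nil derivC hornerC mulr0.
  rewrite !big_cons derivM hornerD !hornerM ih derivB derivX derivC subr0 hornerC mul1r.
  by rewrite hornerXsubC; field; rewrite subr_eq0.
exact: H.
Qed.

(** The quotient [P y / P z] is the product of the factors [1 - (z - y) / (z - x_i)]. When they all
    lie in [[0, 1]], the product is at most one and at least one minus the sum of the defects. *)
Lemma nodal_near z y : (forall i, z != x i) ->
  (forall i, 0 <= (z - x i)^-1 * (z - y) <= 1) ->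
  `|P.[z]| * (1 - \sum_(i < n) (z - x i)^-1 * (z - y)) <= `|P.[y]| <= `|P.[z]|.
Proof.
move=> zx h.
have E : P.[y] = P.[z] * \prod_(i < n) (1 - (z - x i)^-1 * (z - y)).
  rewrite nodal_factor !hornerZ -mulrA !horner_prod -big_split /=; congr (_ * _).
  by apply: eq_bigr => i _; rewrite !hornerXsubC; field; rewrite subr_eq0.
have F0 i : 0 <= 1 - (z - x i)^-1 * (z - y) by rewrite subr_ge0; case/andP: (h i).
have prod0 : 0 <= \prod_(i < n) (1 - (z - x i)^-1 * (z - y)) by apply: prodr_ge0.
have H (s : seq 'I_n) : 0 <= \prod_(i <- s) (1 - (z - x i)^-1 * (z - y)) <= 1 /\
   1 - \sum_(i <- s) (z - x i)^-1 * (z - y) <= \prod_(i <- s) (1 - (z - x i)^-1 * (z - y)).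
  elim: s => [|i s [/andP[ih0 ih1] ih]]; first by rewrite !big_nil subr0 ler01 lexx.
  rewrite !big_cons; have /andP[hi0 hi1] := h i; split; last by nra.
  by rewrite mulr_ge0//= mulr_ile1// gerBl.
have [/andP[_ h1] h2] := H (index_enum 'I_n).
by rewrite E normrM (ger0_norm prod0) ler_wpM2l//= ler_piMr.
Qed.

Section Quadrature.
Variables (mu ups : R) (L : {poly R} -> R).
Hypothesis LD : forall u v, L (u + v) = L u + L v.
Hypothesis LZ : forall c u, L (c *: u) = c * L u.
Hypothesis Libp : forall r, L (jpoly R * r^`() + jtau mu ups * r) = 0.
Hypotheses (mu1 : -1 < mu) (ups1 : -1 < ups).
Hypothesis ode : jop mu ups P + jeig mu ups n *: P = 0.

Let L0 : L 0 = 0. Proof. by rewrite -(scale0r 0) LZ mul0r. Qed.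

(** The cofactor of a root is [P'(x_j)] times the fundamental polynomial, so the identity for
    cofactors becomes a formula for the Christoffel number. *)
Lemma lagrange_poly_weight j :
  L (lagrange_poly j ^+ 2) * ((jpoly R).[x j] * P^`().[x j] ^+ 2) =
  (2 * n%:R + mu + ups + 1) * L (P * P).
Proof.
have [q Pq qE] := nodal_cofactor j.
rewrite -(jacobi_christoffel LD LZ Libp mu1 ups1 ode nodal_size Pq) qE.
set l := lagrange_poly j; set d := P^`().[x j].
have -> : L (d *: l * (d *: l)) = d * (d * L (l ^+ 2)) by rewrite -scalerAl -scalerAr !LZ expr2.
by ring.
Qed.

Lemma lagrange_poly_orthogonal i j : i != j -> L (lagrange_poly i * lagrange_poly j) = 0.
Proof.
move=> ij; have [q Pq qE] := nodal_cofactor j.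
have di := nodal_deriv_neq0 j.
(* The quotient of [P'(x_j) l_i l_j] by [P]; its product omits the indices [i] and [j], which keeps
   the degree below [n]. *)
pose r := (x i - x j)^-1 *: \prod_(k < n | (k != i) && (k != j)) ((x i - x k)^-1 *: ('X - (x k)%:P)).
have E : P^`().[x j] *: (lagrange_poly i * lagrange_poly j) = P * r.
  rewrite scalerAr -qE Pq /r /lagrange_poly (bigD1 j) 1?eq_sym//=.
  by set B := \prod_(k < n | _) _; rewrite -!mul_polyC; ring.
have sr : (size r <= n)%N.
  rewrite (leq_trans (size_scale_leq _ _))//.
  apply: (leq_trans (size_prod_leq _ _)).
  set k := #|_|; have kn : (k < n)%N.
    rewrite -[n]card_ord -(cardC (fun l => (l != i) && (l != j))) -addn1 leq_add2l.
    by apply/card_gt0P; exists j; apply/negP; rewrite unfold_in /= => /andP[_]; rewrite eqxx.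
  rewrite leq_subLR; apply: (@leq_trans (k * 2).+1).
    rewrite ltnS -sum_nat_const; apply: leq_sum => l _.
    by rewrite (leq_trans (size_scale_leq _ _))// size_XsubC.
  by rewrite muln2 -addnn -addnS leq_add2l.
apply/eqP; rewrite -(mulrI_eq0 _ (mulfI di)) -LZ E.
by rewrite (jacobi_orthogonal LD LZ Libp mu1 ups1 ode sr).
Qed.

Lemma quadrature_square (a : 'I_n -> R) :
  L ((\sum_j a j *: lagrange_poly j) ^+ 2) = \sum_j a j ^+ 2 * L (lagrange_poly j ^+ 2).
Proof.
have Lsum (F : 'I_n -> {poly R}) : L (\sum_j F j) = \sum_j L (F j).
  exact: (big_morph L LD L0).
rewrite expr2 mulr_suml Lsum; apply: eq_bigr => j _.
rewrite mulr_sumr Lsum (bigD1 j)//= big1 => [|i ij].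
  by rewrite addr0 -scalerAl -scalerAr !LZ mulrA !expr2.
by rewrite -scalerAl -scalerAr !LZ lagrange_poly_orthogonal ?mulr0// eq_sym.
Qed.

End Quadrature.
End LagrangeNodes.

(** * Integration against the Jacobi weight *)

Section ImproperIntegrals.
Context (R : realType).
Local Notation mu := (@lebesgue_measure R).
Implicit Types (a b c d x : R).

(** Monotone convergence along the intervals [[1 / (n + 3), 1 - 1 / (n + 3)]]; the shift by three
    keeps them nondegenerate. *)
Lemma ge0_integral_oo_le (f : R -> \bar R) (M : \bar R) :
  measurable_fun (`]0, 1[ : set R) f -> (forall x, (0 < x < 1)%R -> 0 <= f x)%E ->
  (forall a b, 0 < a -> a < b -> b < 1 -> (\int[mu]_(x in `[a, b]) f x <= M)%E) ->
  (\int[mu]_(x in `]0%R, 1%R[) f x <= M)%E.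
Proof.
move=> mf f0 fM.
pose a n : R := n.+3%:R^-1.
pose S n : set (measurableTypeR R) := `[a n, 1 - a n]%classic.
have a0 n : 0 < a n by rewrite invr_gt0 ltr0n.
have a3 n : a n <= 3^-1 by rewrite lef_pV2 ?posrE ?ltr0n// ler_nat.
have SU : \bigcup_n S n = `]0, 1[%classic.
  apply/seteqP; split => x /=.
    move=> [n _]; rewrite /S /= !in_itv/= => /andP[ax xa].
    by rewrite (lt_le_trans (a0 n))//= (le_lt_trans xa)// ltrBlDr ltrDl.
  rewrite in_itv/= => /andP[x0 x1].
  have m0 : 0 < Num.min x (1 - x) by rewrite lt_min x0 subr_gt0.
  pose n := (Num.truncn (Num.min x (1 - x))^-1).
  have nm : a n <= Num.min x (1 - x).
    rewrite /a invf_ple ?posrE ?ltr0n//.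
    apply: (@le_trans _ _ n.+1%:R); last by rewrite ler_nat; apply: leqW; exact: leqnSn.
    by apply: ltW; exact: truncnS_gt.
  exists n => //; rewrite /S /= in_itv/=.
  by move: nm; rewrite le_min => /andP[-> h]; rewrite lerBrDr addrC -lerBrDr.
have ndS : nondecreasing_seq S.
  move=> m n mn; rewrite subsetEset; apply: subset_itv; rewrite bnd_simp.
    by rewrite lef_pV2 ?posrE ?ltr0n// ler_nat.
  by rewrite lerD2l lerN2 lef_pV2 ?posrE ?ltr0n// ler_nat.
have := @ge0_nondecreasing_set_cvg_integral _ _ R S f mu ndS.
rewrite SU => H.
have {}H : (\int[mu]_(x in S n) f x @[n --> \oo] --> \int[mu]_(x in `]0%R, 1%R[) f x)%E.
  have sub n : S n `<=` `]0, 1[%classic by rewrite -SU => x Sx; exists n.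
  apply: H => [n|n|n x /sub].
  - exact: measurable_itv.
  - by apply: (measurable_funS _ (sub n) mf); exact: measurable_itv.
  - by rewrite /= in_itv/=; exact: f0.
rewrite -(cvg_lim _ H)//; apply: lime_le; first by apply/cvg_ex; eexists; exact: H.
near=> n; apply: fM => //; have := a3 n; have := a0 n; lra.
Unshelve. all: by end_near. Qed.

Lemma is_derive_powR (a x : R) : 0 < x ->
  is_derive x (1 : R) (fun y => y `^ a) (a * x `^ (a - 1)).
Proof. by move=> x0; exact: is_derive1_powR. Qed.

Lemma powRDp (x r s : R) : 0 < x -> x `^ (r + s) = x `^ r * x `^ s.
Proof. by move=> x0; apply: powRD; rewrite (gt_eqF x0) implybT. Qed.

Lemma is_derive_powR_onem (a x : R) : x < 1 ->
  is_derive x (1 : R) (fun y => (1 - y) `^ a) (- (a * (1 - x) `^ (a - 1))).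
Proof.
move=> x1; have x0 : 0 < 1 - x by rewrite subr_gt0.
apply: is_derive_eq (@fun_derive_comp R (fun y => y `^ a) (fun y => 1 - y) x _ _ (is_derive_powR a x0)
  (fun_deriveB (fun_derive_cst 1 x) (fun_derive_id x))) _.
by rewrite sub0r mulrN1.
Qed.

Lemma within_continuous_powR (a : R) : 0 < a -> {within `[0, 1], continuous (fun x : R => x `^ a)}.
Proof.
move=> a0; apply/continuous_within_itvP => //; split.
- by move=> x; rewrite in_itv/= => /andP[x0 _]; exact: is_derive_continuous (is_derive_powR a x0).
- by rewrite powR0 ?gt_eqF//; exact: powR_cvg0.
- apply: cvg_at_left_filter; exact: is_derive_continuous (is_derive_powR a ltr01).
Qed.

Lemma within_continuous_onem (f : R -> R) : {within `[0, 1], continuous f} ->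
  {within `[0, 1], continuous (fun x => f (1 - x))}.
Proof.
move=> /subspace_continuousP cf; apply/subspace_continuousP => x /= x01.
have x01' : 1 - x \in `[0, 1] by move: x01; rewrite !in_itv/=; lra.
have := cf (1 - x) x01'; move=> /cvgrPdist_le H; apply/cvgrPdist_le => e e0.
have := H e e0; rewrite !near_withinE => /nbhs_ballP[r /= r0 hr].
apply/nbhs_ballP; exists r => //= y; rewrite /ball /= => xy yab.
apply: hr; first by rewrite /ball /= (_ : 1 - x - (1 - y) = - (x - y)) ?normrN//; ring.
by move: yab; rewrite !in_itv/=; lra.
Qed.

(** The derivative may blow up at the endpoints. The indefinite integral minus [F] is constant on
    compact subintervals of []0, 1[] by the ordinary theorem and continuous on [[0, 1]], hence
    constant up to the endpoints. *)
Lemma FTC_improper (F f : R -> R) :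
  {within `[0, 1], continuous F} -> {in `]0, 1[, continuous f} ->
  (forall x, 0 < x < 1 -> is_derive x (1 : R) F (f x)) ->
  mu.-integrable `[0, 1] (EFin \o f) ->
  \int[mu]_(x in `[0, 1]) f x = F 1 - F 0.
Proof.
move=> cF cf dF intf.
pose G x := \int[mu]_(t in `[0, x]) f t.
have PG : is_primitive 0 1 f G.
  by split => // x _; rewrite {2}/G set_itv1 Rintegral_set1 add0r.
have cG := is_primitive_continuous ler01 PG.
pose h x := G x - F x.
have ch : {within `[0, 1], continuous h} by move=> t; apply: cvgB; [exact: cG|exact: cF].
have hc a b : 0 < a -> a <= b -> b < 1 -> h a = h b.
  move=> a0 ab b1.
  have cFab : {within `[a, b], continuous F}.
    by apply: continuous_subspaceW cF; apply: subset_itv; rewrite bnd_simp ltW.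
  have cfab : {within `[a, b], continuous f} by exact: in_continuous_within.
  have dFab x : x \in `]a, b[ -> is_derive x (1 : R) F (f x).
    by rewrite in_itv/= => /andP[ax xb]; apply: dF; rewrite (lt_trans a0)// (lt_trans xb).
  have PF := C1_is_primitive ab cFab cfab dFab.
  have PGab := is_primitiveS (ltW a0) (ltW b1) PG.
  have := is_primitive_end ab PF; rewrite -(is_primitive_end ab PGab) /h; lra.
have hhalf x : 0 < x < 1 -> h x = h 2^-1.
  move=> /andP[x0 x1]; have [xh|hx] := leP x 2^-1; first by apply: hc => //; lra.
  by apply/esym/hc => //; lra.
have hend z : z \in `[0, 1] -> h z = h 2^-1.
  move=> z01; apply/eqP; rewrite -subr_eq0 -normr_le0; apply/ler_addgt0Pr => e e0; rewrite add0r.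
  have [r r0 hr] := within_continuous_dist ch z01 e0.
  pose y := Num.min (r / 2) 4^-1.
  have y0 : 0 < y by rewrite lt_min; apply/andP; split; lra.
  have yr : y < r by rewrite gt_min; apply/orP; left; lra.
  have y4 : y <= 4^-1 by rewrite ge_min lexx orbT.
  move: z01; rewrite in_itv/= => /andP[z0 z1].
  have [zh|hz] := leP z 2^-1.
    rewrite -(hhalf (z + y)); last by apply/andP; split; lra.
    rewrite distrC; apply: hr; first by rewrite in_itv/=; apply/andP; split; lra.
    by rewrite addrAC subrr add0r gtr0_norm.
  rewrite -(hhalf (z - y)); last by apply/andP; split; lra.
  rewrite distrC; apply: hr; first by rewrite in_itv/=; apply/andP; split; lra.
  by rewrite addrAC subrr add0r normrN gtr0_norm.
have h0 : h 0 = h 2^-1 by apply: hend; rewrite in_itv/= lexx ler01.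
have h1 : h 1 = h 2^-1 by apply: hend; rewrite in_itv/= lexx ler01.
have G0 : G 0 = 0 by rewrite /G set_itv1 Rintegral_set1.
by rewrite -/(G 1); move: h0 h1; rewrite /h G0; lra.
Qed.

Lemma integral_powR_le (nu : R) : -1 < nu ->
  (\int[mu]_(x in `]0%R, 1%R[) (x `^ nu)%:E <= ((nu + 1)^-1)%:E)%E.
Proof.
move=> nu1; have nup : 0 < nu + 1 by lra.
have mf : measurable_fun (`]0, 1[ : set R) (fun x => (x `^ nu)%:E).
  by apply/measurable_EFinP/measurable_funTS; exact: measurable_powR.
apply: (ge0_integral_oo_le mf); first by move=> x _; rewrite lee_fin powR_ge0.
move=> a b a0 ab b1.
have D x : 0 < x -> is_derive x (1 : R) (fun y => y `^ (nu + 1) * (nu + 1)^-1) (x `^ nu).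
  move=> x0; apply: is_derive_eq (fun_deriveM (is_derive_powR (nu + 1) x0) (fun_derive_cst (nu + 1)^-1 x)) _.
  by rewrite mulr0 addr0 addrK mulrAC divff ?gt_eqF// mul1r.
have cD x : 0 < x -> {for x, continuous (fun y : R => y `^ nu)}.
  by move=> x0; exact: is_derive_continuous (is_derive_powR nu x0).
have pos x : x \in `[a, b] -> 0 < x by rewrite in_itv/= => /andP[ax _]; exact: lt_le_trans ax.
have c1 : {within `[a, b], continuous (fun y => y `^ (nu + 1) * (nu + 1)^-1)}.
  apply: continuous_in_subspaceT => x /set_mem xab.
  exact: is_derive_continuous (D x (pos x xab)).
have c2 : {within `[a, b], continuous (fun y : R => y `^ nu)}.
  by apply: continuous_in_subspaceT => x /set_mem xab; exact: cD (pos x xab).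
have D' x : x \in `]a, b[ -> is_derive x (1 : R) (fun y => y `^ (nu + 1) * (nu + 1)^-1) (x `^ nu).
  by rewrite in_itv/= => /andP[ax _]; apply: D; exact: lt_trans ax.
have := FTC2_is_derive (ltW ab) c1 c2 D' => ->.
rewrite lee_fin -mulrBl; apply: ler_piMl; first by rewrite invr_ge0 ltW.
have b1' : b `^ (nu + 1) <= 1.
  rewrite -[leRHS](powRr0 b); apply: ger_powR; first by rewrite (lt_trans a0 ab) ltW.
  exact: ltW.
by have := powR_ge0 a (nu + 1); lra.
Qed.

Lemma integral_powR_onem_le (nu : R) : -1 < nu ->
  (\int[mu]_(x in `]0%R, 1%R[) ((1 - x) `^ nu)%:E <= ((nu + 1)^-1)%:E)%E.
Proof.
move=> nu1; have nup : 0 < nu + 1 by lra.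
have mf : measurable_fun (`]0, 1[ : set R) (fun x => ((1 - x) `^ nu)%:E).
  apply/measurable_EFinP/measurable_funTS.
  apply: (measurableT_comp (measurable_powR nu)).
  by apply: measurable_funB => //; exact: measurable_cst.
apply: (ge0_integral_oo_le mf); first by move=> x _; rewrite lee_fin powR_ge0.
move=> a b a0 ab b1.
have D x : x < 1 -> is_derive x (1 : R) (fun y => (1 - y) `^ (nu + 1) * (- (nu + 1)^-1)) ((1 - x) `^ nu).
  move=> x0; apply: is_derive_eq (fun_deriveM (is_derive_powR_onem (nu + 1) x0) (fun_derive_cst (- (nu + 1)^-1) x)) _.
  by rewrite mulr0 addr0 addrK mulrNN mulrAC divff ?gt_eqF// mul1r.
have cD x : x < 1 -> {for x, continuous (fun y : R => (1 - y) `^ nu)}.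
  by move=> x0; exact: is_derive_continuous (is_derive_powR_onem nu x0).
have pos x : x \in `[a, b] -> x < 1 by rewrite in_itv/= => /andP[_ xb]; exact: le_lt_trans b1.
have c1 : {within `[a, b], continuous (fun y => (1 - y) `^ (nu + 1) * (- (nu + 1)^-1))}.
  apply: continuous_in_subspaceT => x /set_mem xab.
  exact: is_derive_continuous (D x (pos x xab)).
have c2 : {within `[a, b], continuous (fun y : R => (1 - y) `^ nu)}.
  by apply: continuous_in_subspaceT => x /set_mem xab; exact: cD (pos x xab).
have D' x : x \in `]a, b[ -> is_derive x (1 : R) (fun y => (1 - y) `^ (nu + 1) * (- (nu + 1)^-1)) ((1 - x) `^ nu).
  by rewrite in_itv/= => /andP[_ xb]; apply: D; exact: lt_trans b1.
have := FTC2_is_derive (ltW ab) c1 c2 D' => ->.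
rewrite lee_fin !mulrN opprK addrC -mulrBl; apply: ler_piMl; first by rewrite invr_ge0 ltW.
have b1' : (1 - a) `^ (nu + 1) <= 1.
  rewrite -[leRHS](powRr0 (1 - a)); apply: ger_powR; first by apply/andP; split; lra.
  exact: ltW.
by have := powR_ge0 (1 - b) (nu + 1); lra.
Qed.

End ImproperIntegrals.

(** * The Jacobi weight on the unit interval *)

Section JacobiWeight.
Context (R : realType).
Local Notation leb := (@lebesgue_measure R).
Implicit Types (a b x y : R).

(** The first exponent belongs to the endpoint 0, so the weight with parameters [mu], [ups] is
    [jweight ups mu], in exchanged order. *)
Definition jweight a b x : R := x `^ a * (1 - x) `^ b.

Lemma jweight_ge0 a b x : 0 <= jweight a b x.
Proof. by rewrite mulr_ge0// powR_ge0. Qed.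

Lemma jweight_gt0 a b x : 0 < x < 1 -> 0 < jweight a b x.
Proof. by move=> /andP[x0 x1]; rewrite mulr_gt0// powR_gt0// subr_gt0. Qed.

Lemma jweightD a b c d x : 0 < x < 1 -> jweight (a + c) (b + d) x = jweight a b x * jweight c d x.
Proof.
move=> /andP[x0 x1]; have y0 : 0 < 1 - x by rewrite subr_gt0.
by rewrite /jweight !powRDp// mulrACA.
Qed.

Lemma jweight1 x : 0 < x < 1 -> jweight 1 1 x = x * (1 - x).
Proof. by move=> /andP[x0 x1]; rewrite /jweight !powRr1// ?subr_ge0 ltW. Qed.

Lemma jweight_sym a b x : jweight a b (1 - x) = jweight b a x.
Proof. have e : 1 - (1 - x) = x by ring. by rewrite /jweight e mulrC. Qed.

Lemma is_derive_jweight a b x : 0 < x < 1 ->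
  is_derive x (1 : R) (jweight a b) (jweight (a - 1) (b - 1) x * (a * (1 - x) - b * x)).
Proof.
move=> x01; have /andP[x0 x1] := x01; have y0 : 0 < 1 - x by rewrite subr_gt0.
apply: is_derive_eq (fun_deriveM (is_derive_powR a x0) (is_derive_powR_onem b x1)) _.
have xa : x `^ a = x `^ (a - 1) * x by rewrite -[X in _ = _ * X](powRr1 (ltW x0)) -powRDp// subrK.
have yb : (1 - x) `^ b = (1 - x) `^ (b - 1) * (1 - x).
  by rewrite -[X in _ = _ * X](powRr1 (ltW y0)) -powRDp// subrK.
rewrite /jweight xa yb; ring.
Qed.

Lemma continuous_jweight a b x : 0 < x < 1 -> {for x, continuous (jweight a b)}.
Proof. by move=> x01; exact: is_derive_continuous (is_derive_jweight a b x01). Qed.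

Lemma measurable_jweight a b : measurable_fun setT (jweight a b).
Proof.
apply: measurable_funM; first exact: measurable_powR.
apply: (measurableT_comp (measurable_powR b)).
by apply: measurable_funB => //; exact: measurable_cst.
Qed.

Lemma half_powR_le a y : 2^-1 <= y <= 1 -> y `^ a <= 2 `^ `|a|.
Proof.
move=> /andP[hy y1]; have y0 : 0 < y by lra.
apply: (@le_trans _ _ (y `^ (- `|a|))).
  by apply: ger_powR; [rewrite y0 y1|exact: lerNnormlW].
rewrite powRN -[leLHS]mul1r ler_pdivrMr ?powR_gt0// -(powRM _ _ (ltW y0)) ?ler0n//.
apply: (@le_trans _ _ (1 `^ `|a|)); first by rewrite powR1.
apply: ge0_ler_powR; rewrite ?nnegrE ?ler01 ?normr_ge0//.
  by rewrite mulr_ge0// ltW.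
lra.
Qed.

(** On each half of the interval the factor that is regular there is bounded by [half_powR_le]; this
    splits the weight into two one-endpoint powers. *)
Lemma jweight_le a b x : 0 < x < 1 ->
  jweight a b x <= 2 `^ `|b| * x `^ a + 2 `^ `|a| * (1 - x) `^ b.
Proof.
move=> /andP[x0 x1]; have [xh|hx] := leP x 2^-1.
  rewrite -[leLHS]addr0 lerD ?mulr_ge0 ?powR_ge0// /jweight mulrC ler_wpM2r ?powR_ge0//.
  by apply: half_powR_le; apply/andP; split; lra.
rewrite -[leLHS]add0r lerD ?mulr_ge0 ?powR_ge0// /jweight ler_wpM2r ?powR_ge0//.
by apply: half_powR_le; apply/andP; split; lra.
Qed.

Lemma jweight_integral_le a b : -1 < a -> -1 < b ->
  (\int[leb]_(x in `]0%R, 1%R[) (jweight a b x)%:E <=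
    (2 `^ `|b| / (a + 1) + 2 `^ `|a| / (b + 1))%:E)%E.
Proof.
move=> a1 b1.
have m1 : measurable_fun (`]0, 1[ : set R) (fun x => (x `^ a)%:E).
  by apply/measurable_EFinP/measurable_funTS; exact: measurable_powR.
have m2 : measurable_fun (`]0, 1[ : set R) (fun x => ((1 - x) `^ b)%:E).
  apply/measurable_EFinP/measurable_funTS.
  apply: (measurableT_comp (measurable_powR b)).
  by apply: measurable_funB => //; exact: measurable_cst.
apply: (@le_trans _ _ (\int[leb]_(x in `]0%R, 1%R[)
    ((2 `^ `|b|)%:E * (x `^ a)%:E + (2 `^ `|a|)%:E * ((1 - x) `^ b)%:E))%E).
  apply: ge0_le_integral => //.
  - by move=> x _; rewrite lee_fin jweight_ge0.
  - by apply/measurable_EFinP/measurable_funTS; exact: measurable_jweight.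
  - by apply: emeasurable_funD; apply: emeasurable_funM => //; exact: measurable_cst.
  - by move=> x; rewrite /= in_itv/= => x01; rewrite -!EFinM -EFinD lee_fin jweight_le.
rewrite ge0_integralD//; first last.
- by apply: emeasurable_funM => //; exact: measurable_cst.
- by move=> x _; rewrite mule_ge0// lee_fin powR_ge0.
- by apply: emeasurable_funM => //; exact: measurable_cst.
- by move=> x _; rewrite mule_ge0// lee_fin powR_ge0.
have k0 c : (0 <= (2 `^ c)%:E :> \bar R)%E by rewrite lee_fin powR_ge0.
rewrite !ge0_integralZl//; try by move=> x _; rewrite lee_fin powR_ge0.
rewrite EFinD !EFinM leeD// lee_wpmul2l ?lee_fin ?powR_ge0//.
  exact: integral_powR_le.
exact: integral_powR_onem_le.
Qed.

Lemma integrable_jweight a b : -1 < a -> -1 < b ->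
  leb.-integrable `[0, 1] (EFin \o jweight a b).
Proof.
move=> a1 b1; have mj : measurable_fun setT (EFin \o jweight a b).
  by apply/measurable_EFinP; exact: measurable_jweight.
apply/integrableP; split; first exact: measurable_funTS.
under eq_integral do rewrite /= ger0_norm ?jweight_ge0//.
rewrite integral_itv_bndoo; last exact: measurable_funTS.
by apply: (le_lt_trans (jweight_integral_le a1 b1)); rewrite ltry.
Qed.

End JacobiWeight.

Lemma horner_jpoly (R : realType) (x : R) : (jpoly R).[x] = x * (1 - x).
Proof. by rewrite /jpoly hornerM hornerD hornerN hornerX -polyC1 hornerC. Qed.

Lemma horner_jtau (R : realType) (mu ups x : R) :
  (jtau mu ups).[x] = (ups + 1) * (1 - x) - (mu + 1) * x.
Proof.
by rewrite /jtau hornerD hornerN !hornerZ hornerD hornerN hornerX -polyC1 hornerC.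
Qed.

Section JacobiFunctional.
Context (R : realType) (mu ups : R).
Hypotheses (mu1 : -1 < mu) (ups1 : -1 < ups).
Local Notation leb := (@lebesgue_measure R).
Local Notation w := (jweight ups mu).

Definition jint (r : {poly R}) : R := \int[leb]_(x in `[0, 1]) (w x * r.[x]).

Lemma integrable_jint r : leb.-integrable `[0, 1] (EFin \o (fun x => w x * r.[x])).
Proof.
apply: integrable_mul_continuous; first exact: integrable_jweight.
by apply: continuous_subspaceT => x; exact: is_derive_continuous (fun_derive_poly r x).
Qed.

Lemma jintD u v : jint (u + v) = jint u + jint v.
Proof.
rewrite /jint -RintegralD//; try exact: integrable_jint.
by apply: eq_Rintegral => x _; rewrite hornerD mulrDr.
Qed.

Lemma jintZ c u : jint (c *: u) = c * jint u.
Proof.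
rewrite /jint -RintegralZl//; last exact: integrable_jint.
by apply: eq_Rintegral => x _; rewrite hornerZ mulrCA.
Qed.

(** The integrand is the derivative of [p w r], which vanishes at both endpoints because [ups + 1]
    and [mu + 1] are positive. *)
Lemma jint_ibp r : jint (jpoly R * r^`() + jtau mu ups * r) = 0.
Proof.
pose F (x : R) := x `^ (ups + 1) * (1 - x) `^ (mu + 1) * r.[x].
have up : 0 < ups + 1 by rewrite -ltrBlDr sub0r.
have mp : 0 < mu + 1 by rewrite -ltrBlDr sub0r.
have u0 := lt0r_neq0 up.
have F0 : F 0 = 0 by rewrite /F (powR0 u0) !mul0r.
have m0 := lt0r_neq0 mp.
have F1 : F 1 = 0 by rewrite /F subrr (powR0 m0) mulr0 mul0r.
have cx := within_continuous_powR up.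
have cy := within_continuous_onem (within_continuous_powR mp).
transitivity (F 1 - F 0); last by rewrite F0 F1 subrr.
apply: FTC_improper.
- have cr : {within `[0, 1], continuous (fun x => r.[x])}.
    by apply: continuous_subspaceT => x; exact: is_derive_continuous (fun_derive_poly r x).
  move=> x; apply: cvgM; last exact: cr.
  by apply: cvgM; [exact: cx|exact: cy].
- move=> x; rewrite in_itv/= => x01; apply: cvgM; first exact: continuous_jweight.
  exact: is_derive_continuous (fun_derive_poly _ x).
- move=> x x01.
  apply: is_derive_eq (fun_deriveM (is_derive_jweight (ups + 1) (mu + 1) x01) (fun_derive_poly r x)) _.
  rewrite !addrK jweightD// jweight1// hornerD (hornerM (jpoly R)) (hornerM (jtau mu ups)) horner_jpoly horner_jtau.
  by ring.
- exact: integrable_jint.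
Qed.

Lemma jint_ge0 r : (forall x, 0 < x < 1 -> 0 <= r.[x]) -> 0 <= jint r.
Proof.
move=> r0; rewrite /jint /Rintegral integral_itv_bndoo.
  apply/fine_ge0/integral_ge0 => x; rewrite /= in_itv/= => x01.
  by rewrite lee_fin mulr_ge0 ?jweight_ge0 ?r0.
apply: measurable_funS (measurable_int _ (integrable_jint r)) => //.
by apply: subset_itv; rewrite bnd_simp.
Qed.

End JacobiFunctional.

(** * Energy of the Liouville form *)

Section JacobiEnergy.
Context (R : realType) (mu ups lam : R) (P : {poly R}).
Hypotheses (lam0 : 0 < lam) (ode : jop mu ups P + lam *: P = 0).
Implicit Types x : R.
Local Notation al := (ups + 2^-1).
Local Notation be := (mu + 2^-1).

(** This is [W' / (2 W)] for [W = jweight al be]. *)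
Definition half_slope x : R := (al * (1 - x) - be * x) / (2 * (x * (1 - x))).

Definition liouville_deriv x : R := P^`().[x] + half_slope x * P.[x].

Definition energy x : R :=
  jweight al be x * (x * (1 - x) * liouville_deriv x ^+ 2 + lam * P.[x] ^+ 2).

(** Writing [b] for [half_slope], this is [q = p b^2 + p' b / 2 + p b'], the potential that survives
    when the equation for [P] is rewritten in terms of [Y]. *)
Definition liouville_potential x : R :=
  ((al * (1 - x) - be * x) ^+ 2 + (1 - 2 * x) * (al * (1 - x) - be * x)
   - 2 * (al * (1 - x) ^+ 2 + be * x ^+ 2)) / (4 * (x * (1 - x))).

Lemma ode_horner x :
  x * (1 - x) * P^`()^`().[x] + ((ups + 1) * (1 - x) - (mu + 1) * x) * P^`().[x]
  + lam * P.[x] = 0.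
Proof.
have := congr1 (fun p => p.[x]) ode.
by rewrite /jop !hornerD hornerZ (hornerM (jpoly R)) (hornerM (jtau mu ups)) horner_jpoly horner_jtau horner0.
Qed.

Lemma is_derive_half_slope x : 0 < x < 1 ->
  is_derive x (1 : R) half_slope
   (- (al * (1 - x) ^+ 2 + be * x ^+ 2) / (2 * (x * (1 - x)) ^+ 2)).
Proof.
move=> /andP[x0 x1]; have y0 : 1 - x != 0 by rewrite subr_eq0 gt_eqF.
have x0' : x != 0 by rewrite gt_eqF.
have h : 2 * (x * (1 - x)) != 0 by rewrite !mulf_neq0// pnatr_eq0.
have D1 := fun_deriveB (fun_deriveM (fun_derive_cst al x) (fun_deriveB (fun_derive_cst 1 x) (fun_derive_id x))) (fun_deriveM (fun_derive_cst be x) (fun_derive_id x)).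
have D2 := fun_deriveM (fun_derive_cst 2 x) (fun_deriveM (fun_derive_id x) (fun_deriveB (fun_derive_cst 1 x) (fun_derive_id x))).
apply: is_derive_eq (fun_deriveM D1 (@fun_deriveV R (fun y => 2 * (y * (1 - y))) x _ h D2)) _.
by field; apply/andP; split.
Qed.

(** The equation gives [p Y' = - (p b + p' / 2) Y + (q - lam) P] with [b = W' / (2 W)] and [q] the
    potential. In [H'] all other terms cancel, in particular those with [lam], and [2 q W P Y]
    remains. *)
Lemma is_derive_energy x : 0 < x < 1 ->
  is_derive x (1 : R) energy
    (2 * liouville_potential x * jweight al be x * P.[x] * liouville_deriv x).
Proof.
move=> x01; have /andP[x0 x1] := x01; have y0 : 1 - x != 0 by rewrite subr_eq0 gt_eqF.
have x0' : x != 0 by rewrite gt_eqF.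
have DY := fun_deriveD (fun_derive_poly P^`() x) (fun_deriveM (is_derive_half_slope x01) (fun_derive_poly P x)).
have D1 := fun_deriveD (fun_deriveM (fun_deriveM (fun_derive_id x) (fun_deriveB (fun_derive_cst 1 x) (fun_derive_id x))) (fun_deriveX 2 DY)) (fun_deriveM (fun_derive_cst lam x) (fun_deriveX 2 (fun_derive_poly P x))).
apply: is_derive_eq (fun_deriveM (is_derive_jweight al be x01) D1) _.
have -> : jweight al be x = jweight (al - 1) (be - 1) x * (x * (1 - x)).
  by rewrite -jweight1// -jweightD// !subrK.
have -> : P^`()^`().[x] = - (((ups + 1) * (1 - x) - (mu + 1) * x) * P^`().[x] + lam * P.[x]) / (x * (1 - x)).
  apply: (canRL (mulfK _)); first by rewrite mulf_neq0.
  by rewrite mulrC; apply/eqP; rewrite -subr_eq0 opprK addrA ode_horner.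
rewrite /liouville_potential /liouville_deriv /half_slope /=.
move: (jweight _ _ x) P^`().[x] P.[x] => W p1 p0.
by field; rewrite x0' y0.
Qed.

Lemma energy_ge x : 0 < x < 1 -> lam * jweight al be x * P.[x] ^+ 2 <= energy x.
Proof.
move=> /andP[x0 x1].
rewrite /energy mulrDr -mulrA [lam * _]mulrCA lerDr mulr_ge0 ?jweight_ge0//.
by rewrite mulr_ge0 ?sqr_ge0// mulr_ge0 ?subr_ge0// ltW.
Qed.

(** The arithmetic-geometric inequality between the two squares in [H]; [jweight 2^-1 2^-1] is the
    square root of [p]. *)
Lemma energy_cross x : 0 < x < 1 ->
  2 * Num.sqrt lam * jweight 2^-1 2^-1 x * jweight al be x * `|P.[x] * liouville_deriv x| <= energy x.
Proof.
move=> x01.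
have mE : x * (1 - x) = jweight 2^-1 2^-1 x ^+ 2.
  have e : 2^-1 + 2^-1 = 1 :> R by field.
  by rewrite expr2 -jweightD// e jweight1.
have lE : lam = Num.sqrt lam ^+ 2 by rewrite sqr_sqrtr// ltW.
rewrite /energy mE {2}lE normrM -(real_normK (num_real P.[x])) -(real_normK (num_real (liouville_deriv x))).
set m := jweight 2^-1 _ _; set l := Num.sqrt lam; set p := `|P.[x]|; set y := `|_ x|.
have -> : 2 * l * m * jweight al be x * (p * y) = jweight al be x * (2 * (l * p) * (m * y)) by ring.
apply: ler_wpM2l; first exact: jweight_ge0.
have := sqr_ge0 (l * p - m * y); lra.
Qed.

Definition liouville_const : R := (`|al| + `|be|) ^+ 2 + (`|al| + `|be|).

Lemma liouville_const_ge0 : 0 <= liouville_const.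
Proof. by rewrite addr_ge0 ?sqr_ge0// addr_ge0. Qed.

Lemma slope_le x : 0 < x < 1 -> `|al * (1 - x) - be * x| <= `|al| + `|be|.
Proof.
move=> /andP[x0 x1]; apply: le_trans (ler_normB _ _) _; rewrite !normrM lerD//.
  by rewrite ler_piMr// ger0_norm; lra.
by rewrite ler_piMr// ger0_norm; lra.
Qed.

Lemma half_slope_le x : 0 < x < 1 -> `|half_slope x| <= (`|al| + `|be|) / (2 * (x * (1 - x))).
Proof.
move=> x01; have /andP[x0 x1] := x01.
have h : 0 < 2 * (x * (1 - x)) by rewrite !mulr_gt0// subr_gt0.
by rewrite /half_slope normrM normfV (gtr0_norm h) ler_pM2r ?invr_gt0// slope_le.
Qed.

Lemma liouville_potential_le x : 0 < x < 1 ->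
  `|liouville_potential x| <= liouville_const / (x * (1 - x)).
Proof.
move=> x01; have /andP[x0 x1] := x01.
have h : 0 < x * (1 - x) by rewrite mulr_gt0// subr_gt0.
have -> : liouville_const / (x * (1 - x)) = (4 * liouville_const) / (4 * (x * (1 - x))).
  by rewrite -mulf_div divff ?pnatr_eq0// mul1r.
have h4 : 0 < 4 * (x * (1 - x)) by rewrite mulr_gt0.
rewrite /liouville_potential normrM normfV (gtr0_norm h4) ler_pM2r ?invr_gt0//.
have A := slope_le x01.
set c := al * (1 - x) - be * x in A *.
have B : `|al * (1 - x) ^+ 2 + be * x ^+ 2| <= `|al| + `|be|.
  apply: le_trans (ler_normD _ _) _; rewrite (normrM al) (normrM be) lerD//.
    by rewrite ler_piMr// ger0_norm ?sqr_ge0// exprn_ile1//; lra.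
  by rewrite ler_piMr// ger0_norm ?sqr_ge0// exprn_ile1//; lra.
set d := al * _ + _ in B *.
rewrite /liouville_const; set s := _ + _ in A B *.
have C : `|(1 - 2 * x) * c| <= s.
  rewrite normrM -[leRHS]mul1r ler_pM// ler_norml; apply/andP; split; lra.
have E : c ^+ 2 <= s ^+ 2 by rewrite -real_normK ?num_real// lerXn2r ?nnegrE// (le_trans _ A).
have s0 : 0 <= s by apply: le_trans A.
move: B C; rewrite !ler_norml => /andP[B1 B2] /andP[C1 C2].
have c0 := sqr_ge0 c; have ss := sqr_ge0 s; apply/andP; split; lra.
Qed.

(** The potential costs [K / p] and the product [W P Y] costs [H / sqrt (lam p)]; together they give
    the integrable-away-from-the-ends rate [p^(-3/2) / sqrt lam]. *)
Lemma energy_growth x : 0 < x < 1 ->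
  `|2 * liouville_potential x * jweight al be x * P.[x] * liouville_deriv x| <=
  liouville_const / Num.sqrt lam * jweight (- (3 / 2)) (- (3 / 2)) x * energy x.
Proof.
move=> x01; have /andP[x0 x1] := x01.
have h : 0 < x * (1 - x) by rewrite mulr_gt0// subr_gt0.
have m0 := jweight_gt0 2^-1 2^-1 x01.
have l0 : 0 < Num.sqrt lam by rewrite sqrtr_gt0.
have -> : jweight (- (3 / 2)) (- (3 / 2)) x = (x * (1 - x) * jweight 2^-1 2^-1 x)^-1.
  have hm := lt0r_neq0 (mulr_gt0 h m0); apply: (mulIf hm).
  rewrite (mulVf hm) -[X in _ * (X * _)](jweight1 x01) -!jweightD//.
  rewrite (_ : - (3 / 2) + (1 + 2^-1) = 0 :> R); last by field.
  by rewrite /jweight !powRr0 mulr1.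
have -> : 2 * liouville_potential x * jweight al be x * P.[x] * liouville_deriv x =
  liouville_potential x * (2 * jweight al be x * (P.[x] * liouville_deriv x)) by ring.
rewrite normrM [X in _ * X]normrM (ger0_norm (mulr_ge0 (ler0n _ 2) (jweight_ge0 _ _ _))).
have -> : liouville_const / Num.sqrt lam / (x * (1 - x) * jweight 2^-1 2^-1 x) * energy x =
   (liouville_const / (x * (1 - x))) * (energy x / (Num.sqrt lam * jweight 2^-1 2^-1 x)).
  by field; rewrite !lt0r_neq0//= ?subr_gt0.
apply: ler_pM => //; [by rewrite mulr_ge0// mulr_ge0// jweight_ge0|exact: liouville_potential_le|].
rewrite (ler_pdivlMr _ _ (mulr_gt0 l0 m0)).
apply: le_trans _ (energy_cross x01).
by rewrite le_eqVlt; apply/orP; left; apply/eqP; ring.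
Qed.

End JacobiEnergy.

Section Gronwall.
Context (R : realType).
Implicit Types f df H h B slope : R -> R.

Lemma is_derive_le0_nonincreasing f df (a b : R) : a <= b ->
  (forall x, a <= x <= b -> is_derive x (1 : R) f (df x)) ->
  (forall x, a <= x <= b -> df x <= 0) -> f b <= f a.
Proof.
rewrite le_eqVlt => /predU1P[-> //|ab] fdf df0.
have oc x : x \in `]a, b[ -> a <= x <= b by rewrite in_itv/= => /andP[/ltW -> /ltW].
have cf : {within `[a, b], continuous f}.
  apply: continuous_in_subspaceT => x /set_mem; rewrite /= in_itv/= => xab.
  exact: is_derive_continuous (fdf x xab).
have [c cab fE] := MVT ab (fun x xab => fdf x (oc x xab)) cf.
rewrite -subr_le0 fE; apply: mulr_le0_ge0; first exact/df0/oc.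
by rewrite subr_ge0 ltW.
Qed.

(** With [B] a primitive of the rate, [H exp B] is nondecreasing and [H exp (- B)] nonincreasing,
    which gives the comparison in both directions. *)
Lemma gronwall H h B slope (a b : R) : a <= b ->
  (forall x, a <= x <= b -> is_derive x (1 : R) H (h x)) ->
  (forall x, a <= x <= b -> is_derive x (1 : R) B (slope x)) ->
  (forall x, a <= x <= b -> `|h x| <= slope x * H x) ->
  H a <= expR (B b - B a) * H b /\ H b <= expR (B b - B a) * H a.
Proof.
move=> ab dH dBD hH; rewrite expRD expRN.
have eD x : a <= x <= b -> is_derive x (1 : R) (fun y => expR (B y)) (expR (B x) * slope x).
  by move=> xab; exact: (@fun_derive_comp R (@expR R) B x _ _ (is_derive_expR _) (dBD x xab)).
have eD' x : a <= x <= b -> is_derive x (1 : R) (fun y => expR (- B y)) (expR (- B x) * - slope x).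
  by move=> xab; exact: (@fun_derive_comp R (@expR R) (fun y => - B y) x _ _ (is_derive_expR _) (fun_deriveN (dBD x xab))).
have := @is_derive_le0_nonincreasing (fun x => - (H x * expR (B x))) _ a b ab
  (fun x xab => fun_deriveN (fun_deriveM (dH x xab) (eD x xab))).
have := @is_derive_le0_nonincreasing (fun x => H x * expR (- B x)) _ a b ab
  (fun x xab => fun_deriveM (dH x xab) (eD' x xab)).
move=> G1 G2; have {G2}G2 : H a * expR (B a) <= H b * expR (B b).
  rewrite -lerN2; apply: G2 => x xab; rewrite oppr_le0.
  have -> : h x * expR (B x) + H x * (expR (B x) * slope x) = (h x + slope x * H x) * expR (B x) by ring.
  rewrite mulr_ge0 ?expR_ge0//; have := hH x xab; rewrite ler_norml => /andP[hx _]; lra.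
have {G1}G1 : H b * expR (- B b) <= H a * expR (- B a).
  apply: G1 => x xab.
  have -> : h x * expR (- B x) + H x * (expR (- B x) * - slope x) = (h x - slope x * H x) * expR (- B x) by ring.
  rewrite mulr_le0_ge0 ?expR_ge0//; have := hH x xab; rewrite ler_norml => /andP[_ hx]; lra.
split.
  by rewrite [leRHS]mulrAC ler_pdivlMr ?expR_gt0// [leRHS]mulrC.
move: G1; rewrite !expRN ler_pdivrMr ?expR_gt0// => G1.
by rewrite (le_trans G1)// le_eqVlt; apply/orP; left; apply/eqP; ring.
Qed.

End Gronwall.

Section EnergyBounds.
Context (R : realType) (mu ups lam : R) (P : {poly R}).
Hypotheses (lam0 : 0 < lam) (ode : jop mu ups P + lam *: P = 0).
Implicit Types d : R.
Local Notation al := (ups + 2^-1).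
Local Notation be := (mu + 2^-1).
Local Notation H := (energy mu ups lam P).
Local Notation K := (liouville_const mu ups).

(** The rate integrated over [[d, 1 - d]] is of order [1 / sqrt (lam d)], so the comparison factor
    stays bounded when [d] is of order [1 / lam]. *)
Lemma energy_comparable d (x' y' : R) : 0 < d -> d <= x' <= 1 - d -> d <= y' <= 1 - d ->
  H x' <= expR (16 * K / (Num.sqrt lam * Num.sqrt d)) * H y'.
Proof.
move=> d0.
pose C := K / Num.sqrt lam.
have C0 : 0 <= C by rewrite divr_ge0 ?sqrtr_ge0 ?liouville_const_ge0.
have C4 : 0 <= 4 * C by rewrite mulr_ge0.
(* A primitive of [4 C (x^(-3/2) + (1 - x)^(-3/2))], where 4 bounds the factor [2^(3/2)] lost in
   [jweight_le]. Its modulus is at most [8 C / sqrt d], whence the 16 for a difference of two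
   values. *)
pose B x := 4 * C * (2 * (1 - x) `^ (- 2^-1) - 2 * x `^ (- 2^-1)).
pose B' x := 4 * C * ((1 - x) `^ (- (3 / 2)) + x `^ (- (3 / 2))).
have e32 : - 2^-1 - 1 = - (3 / 2) :> R by field.
have BD (x : R) : 0 < x < 1 -> is_derive x (1 : R) B (B' x).
  move=> /andP[x0 x1].
  apply: is_derive_eq (fun_deriveM (fun_derive_cst (4 * C) x) (fun_deriveB (fun_deriveM (fun_derive_cst 2 x) (is_derive_powR_onem (- 2^-1) x1))
    (fun_deriveM (fun_derive_cst 2 x) (is_derive_powR (- 2^-1) x0)))) _.
  by rewrite e32 /B'; field.
have Bd (x : R) : d <= x <= 1 - d -> `|B x| <= 8 * C / Num.sqrt d.
  move=> /andP[dx xd]; have dm z : d <= z -> z `^ (- 2^-1) <= (Num.sqrt d)^-1.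
    move=> dz; have z0 : 0 < z by lra.
    rewrite powRN lef_pV2 ?posrE ?powR_gt0 ?sqrtr_gt0// -(powR12_sqrt (ltW d0)).
    by apply: ge0_ler_powR; rewrite ?nnegrE ?invr_ge0 ?ler0n// ltW.
  have a1 := dm x dx; have a2 : (1 - x) `^ (- 2^-1) <= (Num.sqrt d)^-1 by apply: dm; lra.
  have p1 := powR_ge0 x (- 2^-1); have p2 := powR_ge0 (1 - x) (- 2^-1).
  have -> : 8 * C / Num.sqrt d = 4 * C * (2 * (Num.sqrt d)^-1) by ring.
  rewrite /B normrM (ger0_norm C4).
  apply: ler_wpM2l => //.
  by rewrite ler_norml; apply/andP; split; lra.
have main : forall x y : R, d <= x <= 1 - d -> d <= y <= 1 - d -> x <= y ->
    H x <= expR (16 * K / (Num.sqrt lam * Num.sqrt d)) * H y /\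
    H y <= expR (16 * K / (Num.sqrt lam * Num.sqrt d)) * H x.
  move=> x y xd yd xy.
  have ins z : x <= z <= y -> 0 < z < 1 by move: xd yd; lra.
  have [] := @gronwall R H (fun z => 2 * liouville_potential mu ups z * jweight al be z * P.[z] * liouville_deriv mu ups P z) B B' x y xy
    (fun z zxy => is_derive_energy ode (ins z zxy)) (fun z zxy => BD z (ins z zxy)).
    move=> z /ins z01; rewrite (le_trans (energy_growth mu ups P lam0 z01))//.
    have H0 : 0 <= H z.
      apply: le_trans (energy_ge mu ups lam P z01).
      by rewrite mulr_ge0 ?sqr_ge0// mulr_ge0 ?jweight_ge0 ?ltW.
    apply: ler_wpM2r => //; rewrite -/C /B' (mulrC 4 C) -[leRHS]mulrA; apply: ler_wpM2l => //.
    apply: le_trans (jweight_le _ _ z01) _; rewrite -mulrDr addrC normrN ger0_norm ?divr_ge0//.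
    apply: ler_wpM2r; first by rewrite addr_ge0 ?powR_ge0.
    apply: (@le_trans _ _ (2 `^ 2%:R)); last by rewrite powR_mulrn//; lra.
    by apply: ler_powR; lra.
  have le_exp : expR (B y - B x) <= expR (16 * K / (Num.sqrt lam * Num.sqrt d)).
    rewrite ler_expR; apply: le_trans (ler_norm _) _; apply: le_trans (ler_normB _ _) _.
    apply: le_trans (lerD (Bd y yd) (Bd x xd)) _.
    by rewrite le_eqVlt; apply/orP; left; apply/eqP; rewrite /C invfM; ring.
  have He z : d <= z <= 1 - d -> 0 <= H z.
    move=> zd; have z01 : 0 < z < 1 by move: zd; lra.
    apply: le_trans (energy_ge mu ups lam P z01).
    by rewrite mulr_ge0 ?sqr_ge0// mulr_ge0 ?jweight_ge0 ?ltW.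
  move=> A1 A2; split.
    by apply: le_trans A1 _; apply: ler_wpM2r => //; exact: He.
  by apply: le_trans A2 _; apply: ler_wpM2r => //; exact: He.
move=> xd yd; have [xy|/ltW yx] := leP x' y'; first by have [] := main x' y' xd yd xy.
by have [] := main y' x' yd xd yx.
Qed.

(** Moves the weight from a point near the edge to [d]. If [a + 1/2] is nonnegative,
    [x^a <= x^(-1/2) d^(a + 1/2)]; otherwise [d^(a + 1/2)] is at least one and [x^a] itself
    suffices. Both powers are integrable when [a > -1]. *)
Lemma jweight_edge (a b x d : R) : 0 < x <= d -> d <= 4^-1 ->
  jweight a b x <= 2 `^ `|b| * 2 `^ `|b + 2^-1| *
    (x `^ (- 2^-1) + x `^ a) * jweight (a + 2^-1) (b + 2^-1) d.
Proof.
move=> /andP[x0 xd] d4; have d0 : 0 < d by lra.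
have d1 : 0 < 1 - d by lra.
have e1 : (1 - x) `^ b <= 2 `^ `|b| by apply: half_powR_le; apply/andP; split; lra.
have e2 : 1 <= 2 `^ `|b + 2^-1| * (1 - d) `^ (b + 2^-1).
  rewrite -ler_pdivrMr ?powR_gt0// div1r -powRN -[X in 2 `^ X]normrN.
  by apply: half_powR_le; apply/andP; split; lra.
have e3 : x `^ a <= (x `^ (- 2^-1) + x `^ a) * d `^ (a + 2^-1).
  have [ha|ha] := leP 0 (a + 2^-1).
    apply: (@le_trans _ _ (x `^ (- 2^-1) * d `^ (a + 2^-1))).
      have -> : x `^ a = x `^ (- 2^-1) * x `^ (a + 2^-1) by rewrite -powRDp// addrC addrK.
      apply: ler_wpM2l; first exact: powR_ge0.
      by apply: ge0_ler_powR; rewrite ?nnegrE// ltW.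
    by apply: ler_wpM2r; rewrite ?powR_ge0// lerDl powR_ge0.
  have e4 : 1 <= d `^ (a + 2^-1).
    rewrite -[leLHS](powRr0 d); apply: ger_powR; last exact: ltW.
    by apply/andP; split; lra.
  apply: (@le_trans _ _ (x `^ a * d `^ (a + 2^-1))); first by rewrite ler_peMr// powR_ge0.
  by apply: ler_wpM2r; rewrite ?powR_ge0// lerDr powR_ge0.
rewrite /jweight.
have -> : 2 `^ `|b| * 2 `^ `|b + 2^-1| * (x `^ (- 2^-1) + x `^ a) * (d `^ (a + 2^-1) * (1 - d) `^ (b + 2^-1))
  = ((x `^ (- 2^-1) + x `^ a) * d `^ (a + 2^-1)) * (2 `^ `|b| * (2 `^ `|b + 2^-1| * (1 - d) `^ (b + 2^-1))) by ring.
apply: ler_pM; rewrite ?powR_ge0//.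
by apply: le_trans e1 _; rewrite ler_peMr// powR_ge0.
Qed.

End EnergyBounds.

Section Majorant.
Context (R : realType) (mu ups : R).
Hypotheses (mu1 : -1 < mu) (ups1 : -1 < ups).
Local Notation leb := (@lebesgue_measure R).
Local Notation w := (jweight ups mu).

(** An integrable function independent of the degree that absorbs the bulk and both edges. The pure
    powers are written as weights with a zero exponent so that [integrable_jweight] applies. *)
Definition jmajorant (x : R) : R :=
  jweight (- 2^-1) 0 x + jweight ups 0 x + (jweight 0 (- 2^-1) x + jweight 0 mu x).

Definition jmajorant_mass : R := \int[leb]_(x in `[0, 1]) jmajorant x.

Lemma jmajorantE x : 0 < x < 1 ->
  jmajorant x = x `^ (- 2^-1) + x `^ ups + ((1 - x) `^ (- 2^-1) + (1 - x) `^ mu).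
Proof. by move=> _; rewrite /jmajorant /jweight !powRr0 !mulr1 !mul1r. Qed.

Lemma jmajorant_ge0 x : 0 <= jmajorant x.
Proof. by rewrite /jmajorant; do !apply: addr_ge0; exact: jweight_ge0. Qed.

Lemma jmajorant_mass_ge0 : 0 <= jmajorant_mass.
Proof. by apply: Rintegral_ge0 => x _; exact: jmajorant_ge0. Qed.

Lemma integrable_jmajorant : leb.-integrable `[0, 1] (EFin \o jmajorant).
Proof.
have m12 : -1 < - 2^-1 :> R by rewrite ltrN2 invf_lt1 ?ltr1n.
have m0 : -1 < 0 :> R by rewrite ltrN10.
have D (f g : R -> R) : leb.-integrable `[0, 1] (EFin \o f) -> leb.-integrable `[0, 1] (EFin \o g) ->
    leb.-integrable `[0, 1] (EFin \o (fun x => f x + g x)).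
  by move=> fi gi; exact: (@integrableD _ _ _ leb `[0, 1]%classic (measurable_itv _) _ _ fi gi).
by apply: (D (fun x => _ + _) (fun x => _ + _)); apply: D; exact: integrable_jweight.
Qed.

Lemma jint_majorant r (c : R) :
  (forall x, 0 < x < 1 -> w x * r.[x] <= c * jmajorant x) -> jint mu ups r <= c * jmajorant_mass.
Proof.
move=> H; have i1 := integrable_jint mu1 ups1 r; have i2 := integrable_jmajorant.
have ic : leb.-integrable `[0, 1] (EFin \o (fun x => c * jmajorant x)).
  rewrite (_ : EFin \o _ = (fun x => c%:E * (EFin \o jmajorant) x)%E).
    exact: integrableZl.
  by apply/funext => x; rewrite /= EFinM.
rewrite /jmajorant_mass -RintegralZl// /jint.
have sub : `]0, 1[ `<=` (`[0, 1] : set R) by apply: subset_itv; rewrite bnd_simp.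
have j1 : leb.-integrable `]0, 1[ (EFin \o (fun x => w x * r.[x])) by apply: integrableS i1.
have j2 : leb.-integrable `]0, 1[ (EFin \o (fun x => c * jmajorant x)) by apply: integrableS ic.
have bndoo (f : R -> R) : leb.-integrable `]0, 1[ (EFin \o f) ->
    \int[leb]_(x in `[0, 1]) f x = \int[leb]_(x in `]0, 1[) f x.
  by move=> fi; rewrite /Rintegral integral_itv_bndoo//; exact: measurable_int fi.
rewrite (bndoo _ j1) (bndoo _ j2); by apply: le_Rintegral.
Qed.

End Majorant.

(** * Location of the nodes and control of the polynomial at the edges *)

Section JacobiNodes.
Context (R : realType) (mu ups lam : R) (n : nat) (x : 'I_n -> R) (P : {poly R}).
Hypotheses (mu1 : -1 < mu) (ups1 : -1 < ups).
Hypotheses (lam1 : 1 <= lam) (ode : jop mu ups P + lam *: P = 0).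
Hypotheses (xinj : injective x) (sizeP : (size P <= n.+1)%N) (P0 : P != 0).
Hypotheses (Px : forall i, P.[x i] = 0) (x01 : forall i, 0 < x i < 1).
Local Notation al := (ups + 2^-1).
Local Notation be := (mu + 2^-1).
Local Notation H := (energy mu ups lam P).
Local Notation K := (liouville_const mu ups).
Local Notation Y := (liouville_deriv mu ups P).
Local Notation w := (jweight ups mu).

Lemma root_is_node z : P.[z] = 0 -> exists i, z = x i.
Proof.
move=> Pz; have := nodal_factor xinj sizeP P0 Px => PE.
move: Pz; rewrite PE hornerZ => /eqP; rewrite mulf_eq0 lead_coef_eq0 (negPf P0)/=.
rewrite horner_prod prodf_seq_eq0 => /hasP[i _ /=]; rewrite hornerXsubC subr_eq0 => /eqP ->.
by exists i.
Qed.

Lemma liouville_deriv_node i : Y (x i) = P^`().[x i].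
Proof. by rewrite /liouville_deriv Px mulr0 addr0. Qed.

Lemma energy_node i : H (x i) = jweight al be (x i) * (x i * (1 - x i) * P^`().[x i] ^+ 2).
Proof. by rewrite /energy liouville_deriv_node Px expr0n /= mulr0 addr0. Qed.

Let lam0 : 0 < lam. Proof. exact: lt_le_trans lam1. Qed.

(** The polynomial has simple roots, so [P] and [Y] never vanish together. This licenses the
    division by [H] in the cutoff. *)
Lemma energy_gt0 z : 0 < z < 1 -> 0 < H z.
Proof.
move=> z01; have [Pz|Pz] := eqVneq P.[z] 0.
  have [i zi] := root_is_node Pz; rewrite zi energy_node mulr_gt0 ?jweight_gt0//.
  have /andP[x0 x1] := x01 i; apply: mulr_gt0; first by rewrite mulr_gt0// subr_gt0.
  by rewrite exprn_even_gt0//=; exact: nodal_deriv_neq0 xinj sizeP P0 Px i.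
apply: lt_le_trans (energy_ge mu ups lam P z01).
apply: mulr_gt0; last by rewrite exprn_even_gt0.
by apply: mulr_gt0 => //; exact: jweight_gt0.
Qed.

(** At the singular endpoint 0 the second-order term drops out, leaving
    [(ups + 1) P'(0) + lam P(0) = 0], and the logarithmic derivative of [P] at 0 is minus this
    sum. *)
Lemma sum_node_inv : \sum_i (x i)^-1 = lam / (ups + 1).
Proof.
have u0 : ups + 1 != 0 by apply: lt0r_neq0; move: ups1; lra.
have x0 i : 0 != x i by have /andP[h _] := x01 i; rewrite lt_eqF.
have P00 : P.[0] != 0 by apply/eqP => /root_is_node[i /eqP]; rewrite (negPf (x0 i)).
have := ode_horner ode 0; rewrite (nodal_log_deriv xinj sizeP P0 Px x0).
have -> : \sum_(i < n) (0 - x i)^-1 = - \sum_i (x i)^-1.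
  by rewrite -sumrN; apply: eq_bigr => i _; rewrite sub0r invrN.
move: P00; move: (\sum_i (x i)^-1) P.[0] P^`()^`().[0] => S p p2 p0 E.
apply: (mulIf u0); rewrite divfK//; apply: (mulIf p0); lra.
Qed.

Lemma sum_node_onem_inv : \sum_i (1 - x i)^-1 = lam / (mu + 1).
Proof.
have m0 : mu + 1 != 0 by apply: lt0r_neq0; move: mu1; lra.
have x1 i : 1 != x i by have /andP[_ h] := x01 i; rewrite gt_eqF.
have P10 : P.[1] != 0 by apply/eqP => /root_is_node[i /eqP]; rewrite (negPf (x1 i)).
have := ode_horner ode 1; rewrite (nodal_log_deriv xinj sizeP P0 Px x1).
move: P10; move: (\sum_i (1 - x i)^-1) P.[1] P^`()^`().[1] => S p p2 p0 E.
apply: (mulIf m0); rewrite divfK//; apply: (mulIf p0); lra.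
Qed.

Variable d : R.
Hypotheses (d0 : 0 < d) (dups : d * (lam / (ups + 1)) <= 2^-1)
  (dmu : d * (lam / (mu + 1)) <= 2^-1).

(** All reciprocals are positive, so each one is at most the whole sum, hence at most
    [1 / (2 d)]. *)
Lemma node_ge i : 2 * d <= x i <= 1 - 2 * d.
Proof.
have half (y s : R) : 0 < y -> y^-1 <= s -> d * s <= 2^-1 -> 2 * d <= y.
  move=> y0 ys ds; have : d * y^-1 <= 2^-1 by apply: le_trans ds; rewrite ler_pM2l.
  by rewrite ler_pdivrMr//; lra.
have /andP[xi0 xi1] := x01 i.
have a1 : (x i)^-1 <= lam / (ups + 1).
  rewrite -sum_node_inv (bigD1 i)//= lerDl sumr_ge0// => j _.
  by rewrite invr_ge0; have /andP[/ltW] := x01 j.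
have a2 : (1 - x i)^-1 <= lam / (mu + 1).
  rewrite -sum_node_onem_inv (bigD1 i)//= lerDl sumr_ge0// => j _.
  by rewrite invr_ge0 subr_ge0; have /andP[_ /ltW] := x01 j.
have b1 := half _ _ xi0 a1 dups.
have b2 : 2 * d <= 1 - x i by apply: half a2 dmu; rewrite subr_gt0.
by apply/andP; split => //; lra.
Qed.

(** With every node beyond [2 d], [nodal_near] at the endpoint gives [|P z| <= |P 0|]. The sum of
    [d / x_i] being at most one half, it also gives [|P 0| <= 2 |P d|]; squaring yields the factor
    4. *)
Lemma edge_left z : 0 < z <= d -> P.[z] ^+ 2 <= 4 * P.[d] ^+ 2.
Proof.
move=> /andP[z0 zd].
have x0 i : 0 != x i by have /andP[h _] := x01 i; rewrite lt_eqF.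
have ok y i : 0 < y <= d -> 0 <= (0 - x i)^-1 * (0 - y) <= 1.
  move=> /andP[y0 yd]; have /andP[h _] := x01 i; have /andP[g _] := node_ge i.
  rewrite !sub0r invrN mulrNN; apply/andP; split; first by rewrite mulr_ge0 ?invr_ge0 ?ltW.
  by rewrite mulrC ler_pdivrMr// mul1r; move: d0; lra.
have /andP[_ A] := nodal_near xinj sizeP P0 Px x0 (fun i => ok z i (introT andP (conj z0 zd))).
have /andP[B _] := nodal_near xinj sizeP P0 Px x0 (fun i => ok d i (introT andP (conj d0 (lexx d)))).
have {}B : `|P.[0]| <= 2 * `|P.[d]|.
  have S : \sum_(i < n) (0 - x i)^-1 * (0 - d) <= 2^-1.
    apply: le_trans dups; rewrite -sum_node_inv mulr_sumr; apply: ler_sum => i _.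
    by rewrite !sub0r invrN mulrNN mulrC.
  have : `|P.[0]| * 2^-1 <= `|P.[d]|.
    by apply: le_trans B; apply: ler_wpM2l => //; lra.
  lra.
rewrite -(real_normK (num_real P.[z])) -(real_normK (num_real P.[d])).
have -> : 4 * `|P.[d]| ^+ 2 = (2 * `|P.[d]|) ^+ 2 by ring.
by rewrite lerXn2r ?nnegrE ?mulr_ge0// (le_trans A).
Qed.

Lemma edge_right z : 1 - d <= z < 1 -> P.[z] ^+ 2 <= 4 * P.[1 - d] ^+ 2.
Proof.
move=> /andP[zd z1].
have x1 i : 1 != x i by have /andP[_ h] := x01 i; rewrite gt_eqF.
have ok y i : 1 - d <= y < 1 -> 0 <= (1 - x i)^-1 * (1 - y) <= 1.
  move=> /andP[y0 yd]; have /andP[_ h] := x01 i; have /andP[_ g] := node_ge i.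
  apply/andP; split; first by rewrite mulr_ge0 ?invr_ge0 ?subr_ge0 ?ltW.
  by rewrite mulrC ler_pdivrMr ?subr_gt0// mul1r; move: d0; lra.
have d1 : 1 - d < 1 by move: d0; lra.
have /andP[_ A] := nodal_near xinj sizeP P0 Px x1 (fun i => ok z i (introT andP (conj zd z1))).
have /andP[B _] := nodal_near xinj sizeP P0 Px x1 (fun i => ok (1 - d) i (introT andP (conj (lexx _) d1))).
have {}B : `|P.[1]| <= 2 * `|P.[1 - d]|.
  have S : \sum_(i < n) (1 - x i)^-1 * (1 - (1 - d)) <= 2^-1.
    apply: le_trans dmu; rewrite -sum_node_onem_inv mulr_sumr; apply: ler_sum => i _.
    by rewrite (_ : 1 - (1 - d) = d) 1?mulrC//; ring.
  have : `|P.[1]| * 2^-1 <= `|P.[1 - d]|.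
    by apply: le_trans B; apply: ler_wpM2l => //; lra.
  lra.
rewrite -(real_normK (num_real P.[z])) -(real_normK (num_real P.[1 - d])).
have -> : 4 * `|P.[1 - d]| ^+ 2 = (2 * `|P.[1 - d]|) ^+ 2 by ring.
by rewrite lerXn2r ?nnegrE ?mulr_ge0// (le_trans A).
Qed.

End JacobiNodes.

(** * Upper bound for the Christoffel numbers *)

Section NodalMass.
Context (R : realType) (mu ups lam : R) (n : nat) (x : 'I_n -> R) (P : {poly R}).
Hypotheses (mu1 : -1 < mu) (ups1 : -1 < ups).
Hypotheses (lam1 : 1 <= lam) (ode : jop mu ups P + lam *: P = 0).
Hypotheses (xinj : injective x) (sizeP : (size P <= n.+1)%N) (P0 : P != 0).
Hypotheses (Px : forall i, P.[x i] = 0) (x01 : forall i, 0 < x i < 1).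
Local Notation al := (ups + 2^-1).
Local Notation be := (mu + 2^-1).
Local Notation H := (energy mu ups lam P).
Local Notation K := (liouville_const mu ups).
Local Notation w := (jweight ups mu).
Variable d : R.
Hypotheses (d0 : 0 < d) (dups : d * (lam / (ups + 1)) <= 2^-1)
  (dmu : d * (lam / (mu + 1)) <= 2^-1) (d4 : d <= 4^-1).

Let lam0 : 0 < lam. Proof. exact: lt_le_trans lam1. Qed.

(** One summand for each region: the bulk, the left edge and the right edge. The 4 is the loss in
    [edge_left] and [edge_right]. *)
Definition edge_const : R := 4 * (2 `^ 2^-1 + 2 `^ `|mu| * 2 `^ `|be| + 2 `^ `|ups| * 2 `^ `|al|).

Local Notation E := (expR (16 * K / (Num.sqrt lam * Num.sqrt d))).

(** In the bulk, [w = W p^(-1/2)] and [lam W P^2] is at most the energy, which is comparable to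
    [H y]. Near an edge the polynomial and the weight are first transported to [d] or [1 - d], where
    the same bound applies. *)
Lemma weighted_square_le y z : d <= y <= 1 - d -> 0 < z < 1 ->
  w z * (lam * P.[z] ^+ 2) <= edge_const * (E * H y) * jmajorant mu ups z.
Proof.
move=> yd z01; have /andP[z0 z1] := z01; set M := E * H y.
have dd : d <= d <= 1 - d by move: d0 d4; lra.
have dd' : d <= 1 - d <= 1 - d by move: d0 d4; lra.
have M0 : 0 <= M.
  apply: mulr_ge0; first exact: expR_ge0.
  by apply/ltW; apply: (energy_gt0 mu ups lam1 xinj sizeP P0 Px x01); move: d0 yd; lra.
have HM u : d <= u <= 1 - d -> lam * jweight al be u * P.[u] ^+ 2 <= M.
  move=> ud; have u01 : 0 < u < 1 by move: d0; lra.
  exact: le_trans (energy_ge mu ups lam P u01) (energy_comparable lam0 ode d0 ud yd).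
have HM0 u : 0 <= lam * jweight al be u * P.[u] ^+ 2.
  by apply: mulr_ge0; [apply: mulr_ge0; [exact: ltW|exact: jweight_ge0]|exact: sqr_ge0].
rewrite jmajorantE//.
set g1 := z `^ _ + z `^ _; set g2 := (1 - z) `^ _ + (1 - z) `^ _.
have g10 : 0 <= g1 by rewrite addr_ge0 ?powR_ge0.
have g20 : 0 <= g2 by rewrite addr_ge0 ?powR_ge0.
pose c1 : R := 2 `^ 2^-1; pose c2 := 2 `^ `|mu| * 2 `^ `|be|; pose c3 := 2 `^ `|ups| * 2 `^ `|al|.
have c10 : 0 <= c1 by exact: powR_ge0.
have c20 : 0 <= c2 by rewrite mulr_ge0 ?powR_ge0.
have c30 : 0 <= c3 by rewrite mulr_ge0 ?powR_ge0.
suff [c [cc c0 cE]] : exists c, [/\ c <= c1 + c2 + c3, 0 <= c & w z * (lam * P.[z] ^+ 2) <= 4 * c * M * (g1 + g2)].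
  apply: le_trans cE _; apply: ler_wpM2r; first by rewrite addr_ge0.
  apply: ler_wpM2r => //; rewrite /edge_const -/c1 -/c2 -/c3; lra.
have [zd|dz] := leP z d.
  exists c2; split => //; first by lra.
  have ze : 0 < z <= d by rewrite z0.
  have A := edge_left mu1 ups1 ode xinj sizeP P0 Px x01 d0 dups dmu ze.
  have B := jweight_edge ups mu ze d4; rewrite -/g1 -/c2 in B.
  have C := HM d dd.
  have D : lam * P.[z] ^+ 2 <= 4 * (lam * P.[d] ^+ 2) by rewrite (mulrCA 4) ler_pM2l.
  apply: (@le_trans _ _ (c2 * g1 * jweight al be d * (4 * (lam * P.[d] ^+ 2)))).
    by apply: ler_pM => //; [exact: jweight_ge0|rewrite mulr_ge0 ?sqr_ge0// ltW].
  have -> : c2 * g1 * jweight al be d * (4 * (lam * P.[d] ^+ 2)) = 4 * c2 * (lam * jweight al be d * P.[d] ^+ 2) * g1 by ring.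
  apply: ler_pM => //; last by rewrite lerDl.
    by apply: mulr_ge0; [apply: mulr_ge0|exact: HM0].
  by apply: ler_wpM2l => //; rewrite mulr_ge0.
have [zd|dz'] := leP (1 - d) z.
  exists c3; split => //; first by lra.
  have ze : 1 - d <= z < 1 by rewrite zd.
  have A := edge_right mu1 ups1 ode xinj sizeP P0 Px x01 d0 dups dmu ze.
  have ze' : 0 < 1 - z <= d by apply/andP; split; lra.
  have B := jweight_edge mu ups ze' d4; rewrite -/g2 -/c3 jweight_sym in B.
  have C := HM (1 - d) dd'.
  have D : lam * P.[z] ^+ 2 <= 4 * (lam * P.[1 - d] ^+ 2) by rewrite (mulrCA 4) ler_pM2l.
  apply: (@le_trans _ _ (c3 * g2 * jweight be al d * (4 * (lam * P.[1 - d] ^+ 2)))).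
    by apply: ler_pM => //; [exact: jweight_ge0|rewrite mulr_ge0 ?sqr_ge0// ltW].
  have -> : jweight be al d = jweight al be (1 - d) by rewrite jweight_sym.
  have -> : c3 * g2 * jweight al be (1 - d) * (4 * (lam * P.[1 - d] ^+ 2)) =
    4 * c3 * (lam * jweight al be (1 - d) * P.[1 - d] ^+ 2) * g2 by ring.
  apply: ler_pM => //; last by rewrite lerDr.
    by apply: mulr_ge0; [apply: mulr_ge0|exact: HM0].
  by apply: ler_wpM2l => //; rewrite mulr_ge0.
exists c1; split => //; first by lra.
have zd : d <= z <= 1 - d by rewrite !ltW.
have -> : w z = jweight al be z * jweight (- 2^-1) (- 2^-1) z by rewrite -jweightD// !addrK.
have -> : jweight al be z * jweight (- 2^-1) (- 2^-1) z * (lam * P.[z] ^+ 2) =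
  lam * jweight al be z * P.[z] ^+ 2 * jweight (- 2^-1) (- 2^-1) z by ring.
have J : jweight (- 2^-1) (- 2^-1) z <= c1 * (g1 + g2).
  apply: le_trans (jweight_le _ _ z01) _; rewrite -mulrDr normrN ger0_norm ?invr_ge0//.
  by apply: ler_wpM2l => //; rewrite lerD// lerDl powR_ge0.
apply: (@le_trans _ _ (M * (c1 * (g1 + g2)))).
  by apply: ler_pM => //; [exact: jweight_ge0|exact: HM].
have : 0 <= c1 * M * (g1 + g2) by apply: mulr_ge0; [exact: mulr_ge0|exact: addr_ge0].
lra.
Qed.

Lemma jint_energy_le y : d <= y <= 1 - d ->
  lam * jint mu ups (P * P) <= edge_const * (E * H y) * jmajorant_mass mu ups.
Proof.
move=> yd; rewrite -jintZ//; apply: jint_majorant => // z z01.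
by rewrite hornerZ hornerM -expr2; exact: weighted_square_le.
Qed.

(** At a node [H = W p P'^2], and [p P'^2] is exactly the factor accompanying the Christoffel number
    in [lagrange_poly_weight]; it cancels and leaves [W (x j)]. *)
Lemma christoffel_le j : lam = jeig mu ups n ->
  jint mu ups (lagrange_poly x j ^+ 2) <=
  (2 * n%:R + mu + ups + 1) / lam * (edge_const * E * jmajorant_mass mu ups) * jweight al be (x j).
Proof.
move=> lamE; have lE := ode; rewrite lamE in lE.
have := lagrange_poly_weight xinj sizeP P0 Px (jintD mu1 ups1) (jintZ mu1 ups1) (jint_ibp mu1 ups1) mu1 ups1 lE j.
have /andP[xj0 xj1] := x01 j.
have q0 : 0 < (jpoly R).[x j] * P^`().[x j] ^+ 2.
  rewrite horner_jpoly mulr_gt0//; first by rewrite mulr_gt0// subr_gt0.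
  by rewrite exprn_even_gt0//=; exact: nodal_deriv_neq0 xinj sizeP P0 Px j.
have xjd : d <= x j <= 1 - d.
  by have := node_ge mu1 ups1 ode xinj sizeP P0 Px x01 d0 dups dmu j; move: d0; lra.
have A := jint_energy_le xjd.
rewrite (energy_node mu ups lam Px) -horner_jpoly in A.
move=> e; rewrite -(ler_pM2r q0) e.
have s0 : 0 <= 2 * n%:R + mu + ups + 1.
  have n1 : (1 : R) <= n%:R by rewrite ler1n (leq_ltn_trans _ (ltn_ord j)).
  by move: mu1 ups1 n1; lra.
set C := edge_const * E * _; set wj := jweight _ _ _; set q := _ * P^`().[x j] ^+ 2; set t := _ + 1.
have -> : t / lam * C * wj * q = t * (C * (wj * q) / lam) by ring.
apply: ler_wpM2l => //; rewrite ler_pdivlMr// mulrC.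
by apply: le_trans A _; rewrite le_eqVlt; apply/orP; left; apply/eqP; rewrite /C /wj /q; ring.
Qed.

End NodalMass.

Lemma is_derive_jweight_log (R : realType) (a b x : R) : 0 < x < 1 ->
  is_derive x (1 : R) (jweight a b) ((a * (1 - x) - b * x) / (x * (1 - x)) * jweight a b x).
Proof.
move=> x01; apply: is_derive_eq (is_derive_jweight a b x01) _.
have /andP[x0 x1] := x01.
have -> : jweight a b x = jweight (a - 1) (b - 1) x * (x * (1 - x)).
  by rewrite -jweight1// -jweightD// !subrK.
by field; rewrite !gt_eqF// subr_gt0.
Qed.

(** * The function that equals the weight at nodes and vanishes between them *)

Section Cutoff.
Context (R : realType) (mu ups lam : R) (n : nat) (x : 'I_n -> R) (P : {poly R}).
Hypotheses (lam1 : 1 <= lam) (ode : jop mu ups P + lam *: P = 0).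
Hypotheses (xinj : injective x) (sizeP : (size P <= n.+1)%N) (P0 : P != 0).
Hypotheses (Px : forall i, P.[x i] = 0) (x01 : forall i, 0 < x i < 1).
Local Notation al := (ups + 2^-1).
Local Notation be := (mu + 2^-1).
Local Notation H := (energy mu ups lam P).
Local Notation K := (liouville_const mu ups).
Local Notation Y := (liouville_deriv mu ups P).
Local Notation W := (jweight al be).
Local Notation w := (jweight ups mu).
Local Notation b := (half_slope mu ups).
Local Notation q := (liouville_potential mu ups).

Let lam0 : 0 < lam. Proof. exact: lt_le_trans lam1. Qed.

Definition cutoff (z : R) : R := W z - lam * (W z * P.[z]) ^+ 2 / H z.

Definition cutoff_deriv (z : R) : R :=
  2 * b z * W z - lam * (2 * (W z * P.[z]) * (W z * (b z * P.[z] + Y z)) / H z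
   - (W z * P.[z]) ^+ 2 * (2 * q z * W z * P.[z] * Y z) / H z ^+ 2).

Implicit Types z d : R.

Lemma is_derive_bweight z : 0 < z < 1 -> is_derive z (1 : R) W (2 * b z * W z).
Proof.
move=> z01; apply: is_derive_eq (is_derive_jweight_log al be z01) _.
have /andP[x0 x1] := z01.
by rewrite /half_slope; congr (_ * _); field; rewrite !gt_eqF// subr_gt0.
Qed.

Lemma is_derive_bweight_poly z : 0 < z < 1 ->
  is_derive z (1 : R) (fun y => W y * P.[y]) (W z * (b z * P.[z] + Y z)).
Proof.
move=> z01; apply: is_derive_eq (fun_deriveM (is_derive_bweight z01) (fun_derive_poly P z)) _.
by rewrite /liouville_deriv; ring.
Qed.

Lemma is_derive_cutoff z : 0 < z < 1 -> is_derive z (1 : R) cutoff (cutoff_deriv z).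
Proof.
move=> z01; have Hz := energy_gt0 mu ups lam1 xinj sizeP P0 Px x01 z01.
have H0 : H z != 0 by rewrite gt_eqF.
have D1 := fun_deriveM (fun_derive_cst lam z) (fun_deriveX 2 (is_derive_bweight_poly z01)).
have D2 := @fun_deriveV R H z _ H0 (is_derive_energy ode z01).
apply: is_derive_eq (fun_deriveB (is_derive_bweight z01) (fun_deriveM D1 D2)) _.
rewrite /cutoff_deriv; move: H0; move: (H z) (W z) (b z) (q z) (Y z) P.[z] => h w0 b0 q0 y p h0.
by rewrite expr1; field.
Qed.

Lemma continuous_cutoff_deriv z : 0 < z < 1 -> {for z, continuous cutoff_deriv}.
Proof.
move=> z01; have /andP[z0 z1] := z01.
have H0 : H z != 0 by rewrite gt_eqF// (energy_gt0 mu ups lam1 xinj sizeP P0 Px x01 z01).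
have y0 : 4 * (z * (1 - z)) != 0 by rewrite !mulf_neq0 ?pnatr_eq0// gt_eqF// subr_gt0.
have Db := is_derive_half_slope mu ups z01.
have DW := is_derive_bweight z01; have DP := fun_derive_poly P z.
have DWP := is_derive_bweight_poly z01.
have DY := fun_deriveD (fun_derive_poly P^`() z) (fun_deriveM Db DP).
have DH := is_derive_energy ode z01.
have D1 := fun_deriveB (fun_derive_cst 1 z) (fun_derive_id z).
have Dc := fun_deriveB (fun_deriveM (fun_derive_cst al z) D1) (fun_deriveM (fun_derive_cst be z) (fun_derive_id z)).
have D2 := fun_deriveB (fun_deriveD (fun_deriveX 2 Dc) (fun_deriveM (fun_deriveB (fun_derive_cst 1 z) (fun_deriveM (fun_derive_cst 2 z) (fun_derive_id z))) Dc))
  (fun_deriveM (fun_derive_cst 2 z) (fun_deriveD (fun_deriveM (fun_derive_cst al z) (fun_deriveX 2 D1)) (fun_deriveM (fun_derive_cst be z) (fun_deriveX 2 (fun_derive_id z))))).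
have Dq := fun_deriveM D2 (@fun_deriveV R (fun y => 4 * (y * (1 - y))) z _ y0 (fun_deriveM (fun_derive_cst 4 z) (fun_deriveM (fun_derive_id z) D1))).
have DH1 := @fun_deriveV R H z _ H0 DH.
have H2 : H z ^+ 2 != 0 by rewrite expf_neq0.
have DH2 := @fun_deriveV R (fun y => H y ^+ 2) z _ H2 (fun_deriveX 2 DH).
have Da := fun_deriveM (fun_deriveM (fun_deriveM (fun_derive_cst 2 z) DWP) (fun_deriveM DW (fun_deriveD (fun_deriveM Db DP) DY))) DH1.
have Dd := fun_deriveM (fun_deriveM (fun_deriveX 2 DWP) (fun_deriveM (fun_deriveM (fun_deriveM (fun_deriveM (fun_derive_cst 2 z) Dq) DW) DP) DY)) DH2.
have D := fun_deriveB (fun_deriveM (fun_deriveM (fun_derive_cst 2 z) Db) DW) (fun_deriveM (fun_derive_cst lam z) (fun_deriveB Da Dd)).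
exact: is_derive_continuous D.
Qed.

Lemma cutoff_itv z : 0 < z < 1 -> 0 <= cutoff z <= W z.
Proof.
move=> z01; have Hz := energy_gt0 mu ups lam1 xinj sizeP P0 Px x01 z01.
have W0 := jweight_gt0 al be z01.
have A := energy_ge mu ups lam P z01.
have -> : cutoff z = W z * (1 - lam * W z * P.[z] ^+ 2 / H z).
  by rewrite /cutoff; ring.
have B : 0 <= lam * W z * P.[z] ^+ 2 / H z <= 1.
  rewrite ler_pdivrMr// mul1r A andbT; apply: divr_ge0; last exact: ltW.
  by apply: mulr_ge0; [apply: mulr_ge0; exact: ltW|exact: sqr_ge0].
have /andP[B0 B1] := B; apply/andP; split; first by apply: mulr_ge0; rewrite ?subr_ge0// ltW.
by apply: ler_piMr; [exact: ltW|rewrite gerBl].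
Qed.

Lemma cutoff_node i : cutoff (x i) = W (x i).
Proof. by rewrite /cutoff Px mulr0 expr0n/= mulr0 mul0r subr0. Qed.

(** The function [F = sqrt W * P] vanishes at both nodes and has derivative [sqrt W * Y], so Rolle
    gives a zero of [Y]. There [H = lam W P^2], and the two terms of the cutoff cancel. *)
Lemma cutoff_zero_between i j : x i < x j -> exists2 z, x i < z < x j & cutoff z = 0.
Proof.
move=> xij; have /andP[xi0 xi1] := x01 i; have /andP[xj0 xj1] := x01 j.
pose F z := jweight (al / 2) (be / 2) z * P.[z].
have DF z : x i <= z <= x j -> is_derive z (1 : R) F (jweight (al / 2) (be / 2) z * Y z).
  move=> zij; have z01 : 0 < z < 1 by lra.
  have /andP[z0 z1] := z01.
  apply: is_derive_eq (fun_deriveM (is_derive_jweight_log _ _ z01) (fun_derive_poly P z)) _.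
  by rewrite /liouville_deriv /half_slope; field; rewrite !gt_eqF// subr_gt0.
have oc z : z \in `]x i, x j[ -> x i <= z <= x j by rewrite in_itv/= => /andP[/ltW -> /ltW].
have [] := @Rolle R F _ _ xij.
- by move=> z /oc zij; have [] := DF z zij.
- apply: continuous_in_subspaceT => z /set_mem; rewrite /= in_itv/= => zij.
  exact: is_derive_continuous (DF z zij).
- by rewrite /F !Px !mulr0.
move=> z zij [_ z0]; exists z; first by move: zij; rewrite in_itv.
have [_ zD] := DF z (oc z zij).
have z01 : 0 < z < 1 by move: (oc z zij); lra.
have Yz : Y z = 0.
  have /eqP := etrans (esym zD) z0; rewrite mulf_eq0 gt_eqF ?jweight_gt0//=.
  by move/eqP.
have Hz := energy_gt0 mu ups lam1 xinj sizeP P0 Px x01 z01.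
have HE : H z = W z * (lam * P.[z] ^+ 2) by rewrite /energy Yz expr0n/= mulr0 add0r.
have -> : cutoff z = W z - W z * (W z * (lam * P.[z] ^+ 2)) / H z by rewrite /cutoff; ring.
by rewrite -HE -mulrA divff ?gt_eqF// mulr1 subrr.
Qed.

(** The summands come from the cross term [P Y], from the slope of [W], and from the derivative of
    the energy. *)
Definition cutoff_const (c : R) : R := 1 + 4 * (`|al| + `|be|) / Num.sqrt c + 2 * K / c.

Lemma cutoff_deriv_le d z : 0 < d -> d <= 2^-1 -> d <= z <= 1 - d ->
  `|cutoff_deriv z| <= cutoff_const (lam * d) * Num.sqrt lam * w z.
Proof.
move=> d0 d2 zd; have z01 : 0 < z < 1 by move: zd; lra.
have /andP[z0 z1] := z01.
have Hz := energy_gt0 mu ups lam1 xinj sizeP P0 Px x01 z01.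
have W0 := jweight_gt0 al be z01; have w0 := jweight_gt0 ups mu z01.
pose m := jweight 2^-1 2^-1 z; have m0 : 0 < m := jweight_gt0 2^-1 2^-1 z01.
have e : 2^-1 + 2^-1 = 1 :> R by field.
have mE : z * (1 - z) = m ^+ 2 by rewrite expr2 -jweightD// e jweight1.
have WE : W z = w z * m by rewrite -jweightD.
pose l := Num.sqrt lam; have l0 : 0 < l by rewrite sqrtr_gt0.
have lE : lam = l ^+ 2 by rewrite sqr_sqrtr// ltW.
pose D := Num.sqrt d; have D0 : 0 < D by rewrite sqrtr_gt0.
have DE : d = D ^+ 2 by rewrite sqr_sqrtr// ltW.
have K0 := liouville_const_ge0 mu ups.
have A := energy_ge mu ups lam P z01.
have B := energy_cross mu ups P lam0 z01 : 2 * l * m * W z * `|P.[z] * Y z| <= H z.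
have C := energy_growth mu ups P lam0 z01.
have S := half_slope_le mu ups z01; rewrite mE in S.
set s := `|al| + `|be| in S *; have s0 : 0 <= s by rewrite addr_ge0.
have JE : jweight (- (3 / 2)) (- (3 / 2)) z = (m ^+ 2 * m)^-1.
  have hm : m ^+ 2 * m != 0 by rewrite mulf_neq0 ?expf_neq0// gt_eqF.
  apply: (mulIf hm); rewrite (mulVf hm) -mE -[X in _ * (X * _)](jweight1 z01) -!jweightD//.
  rewrite (_ : - (3 / 2) + (1 + 2^-1) = 0 :> R); last by field.
  by rewrite /jweight !powRr0 mulr1.
rewrite JE -/l in C.
pose a := lam * W z * P.[z] ^+ 2 / H z.
have a01 : 0 <= a <= 1.
  rewrite /a ler_pdivrMr// mul1r A andbT; apply: divr_ge0; last exact: ltW.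
  by apply: mulr_ge0; [apply: mulr_ge0; exact: ltW|exact: sqr_ge0].
pose r := P.[z] * Y z / H z.
have rE : `|r| * (2 * l * m * W z) <= 1.
  rewrite /r normrM normfV (gtr0_norm Hz) mulrAC ler_pdivrMr// mul1r mulrC; exact: B.
pose h := (2 * q z * W z * P.[z] * Y z) / H z.
have hE : `|h| <= K / l / (m ^+ 2 * m).
  by rewrite /h normrM normfV (gtr0_norm Hz) ler_pdivrMr.
(* Here [a] is the share of [lam W P^2] in the energy, [r = P Y / H], and [h = H' / H]. Each of the
   three terms is bounded separately, by [half_slope_le], [energy_cross] and [energy_growth]. *)
have -> : cutoff_deriv z = W z * (2 * b z * (1 - a)) + - (2 * lam * W z * W z * r) + W z * a * h.
  rewrite /cutoff_deriv /a /r /h; move: (lt0r_neq0 Hz); move: (H z) (W z) (b z) (q z) (Y z) P.[z] => h1 w1 b1 q1 y1 p1 h0.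
  by field.
have T1 : `|W z * (2 * b z * (1 - a))| <= w z * (s / m).
  rewrite normrM (gtr0_norm W0) WE -[leLHS]mulrA (ler_pM2l w0) normrM.
  have -> : s / m = m * ((s / m ^+ 2) * 1) by field; rewrite gt_eqF.
  rewrite (ler_pM2l m0); apply: ler_pM => //; last by rewrite ler_norml; lra.
  rewrite normrM ger0_norm//; have -> : s / m ^+ 2 = 2 * (s / (2 * m ^+ 2)) by field; rewrite gt_eqF.
  by rewrite ler_pM2l.
have T2 : `|- (2 * lam * W z * W z * r)| <= w z * l.
  have g0 : 0 <= 2 * lam * W z * W z.
    by apply: mulr_ge0; [apply: mulr_ge0; [apply: mulr_ge0|]|]; rewrite ?ler0n//; exact: ltW.
  rewrite normrN normrM (ger0_norm g0).
  have -> : 2 * lam * W z * W z * `|r| = w z * l * (`|r| * (2 * l * m * W z)).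
    by rewrite {1}lE {1}WE; ring.
  by apply: ler_piMr => //; apply: mulr_ge0; exact: ltW.
have T3 : `|W z * a * h| <= w z * (K / l / m ^+ 2).
  rewrite normrM normrM (gtr0_norm W0) WE.
  have -> : w z * (K / l / m ^+ 2) = w z * m * 1 * (K / l / (m ^+ 2 * m)).
    by field; rewrite !gt_eqF.
  have wm : 0 <= w z * m by apply: mulr_ge0; exact: ltW.
  apply: ler_pM => //; first by apply: mulr_ge0.
  by apply: ler_wpM2l => //; rewrite ler_norml; lra.
(* On [[d, 1 - d]] one has [p >= d (1 - d) >= d / 2], which turns negative powers of [p] into powers
   of [1 / d]. *)
have pd : D ^+ 2 <= 2 * m ^+ 2.
  rewrite -DE -mE; have : 0 <= (z - d) * (1 - d - z) by apply: mulr_ge0; lra.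
  have : 0 <= d * (1 - 2 * d) by apply: mulr_ge0; lra.
  by nra.
have m2 : m ^- 2 <= 2 / D ^+ 2.
  by rewrite ler_pdivlMr ?exprn_gt0// mulrC ler_pdivrMr ?exprn_gt0.
have m1 : m^-1 <= 2 / D.
  rewrite ler_pdivlMr// mulrC ler_pdivrMr//.
  have m20 : 0 <= 2 * m by lra.
  have -> : D = Num.sqrt (D ^+ 2) by rewrite sqrtr_sqr gtr0_norm.
  have -> : 2 * m = Num.sqrt ((2 * m) ^+ 2) by rewrite sqrtr_sqr ger0_norm.
  by apply: ler_wsqrtr; have := sqr_ge0 m; lra.
apply: le_trans (ler_normD _ _) _; apply: le_trans (lerD (ler_normD _ _) (lexx _)) _.
apply: le_trans (lerD (lerD T1 T2) T3) _.
have -> : cutoff_const (lam * d) * Num.sqrt lam * w z =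
   w z * (2 * s * (2 / D)) + w z * l + w z * (K / l * (2 / D ^+ 2)).
  rewrite /cutoff_const sqrtrM ?(ltW lam0)// -/l -/D -/s lE DE.
  by field; rewrite !gt_eqF.
apply: lerD.
  apply: lerD => //; apply: ler_wpM2l; first exact: ltW.
  apply: ler_pM => //; first by rewrite invr_ge0 ltW.
  lra.
apply: ler_wpM2l; first exact: ltW.
by apply: ler_wpM2l => //; rewrite divr_ge0// ltW.
Qed.

End Cutoff.

(** * Interpolation estimate *)

Section Substitution.
Context (R : realType) (rho : R).
Hypothesis rho0 : 0 < rho.
Local Notation leb := (@lebesgue_measure R).
Implicit Types t a b : R.

Definition subst t : R := 1 - (1 - t) `^ rho.
Definition dsubst t : R := rho * (1 - t) `^ (rho - 1).

Lemma onem_subst t : 1 - subst t = (1 - t) `^ rho.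
Proof. by rewrite /subst; ring. Qed.

Lemma subst_itv t : 0 < t < 1 -> 0 < subst t < 1.
Proof.
move=> /andP[t0 t1]; have p0 : 0 < (1 - t) `^ rho by rewrite powR_gt0// subr_gt0.
have : (1 - t) `^ rho < 1 `^ rho by apply: gt0_ltr_powR; rewrite ?nnegrE ?subr_ge0 ?(ltW t1)//; lra.
by rewrite powR1 /subst; lra.
Qed.

Lemma subst_lt t1 t2 : t1 < t2 -> t2 <= 1 -> subst t1 < subst t2.
Proof.
by move=> t12 t21; rewrite /subst ltrD2l ltrN2; apply: gt0_ltr_powR; rewrite ?nnegrE//; lra.
Qed.

Lemma subst_inv t : t < 1 -> 1 - (1 - subst t) `^ rho^-1 = t.
Proof.
move=> t1; rewrite onem_subst -powRrM divff ?gt_eqF// powRr1; last by lra.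
by ring.
Qed.

Lemma dsubst_gt0 t : t < 1 -> 0 < dsubst t.
Proof. by move=> t1; rewrite mulr_gt0// powR_gt0// subr_gt0. Qed.

Lemma is_derive_subst t : t < 1 -> is_derive t (1 : R) subst (dsubst t).
Proof.
move=> t1; apply: is_derive_eq (fun_deriveB (fun_derive_cst 1 t) (is_derive_powR_onem rho t1)) _.
by rewrite sub0r opprK.
Qed.

Lemma continuous_dsubst t : t < 1 -> {for t, continuous dsubst}.
Proof.
move=> t1; exact: is_derive_continuous (fun_deriveM (fun_derive_cst rho t) (is_derive_powR_onem (rho - 1) t1)).
Qed.

Lemma measurable_powR_onem (c : R) : measurable_fun setT (fun t => (1 - t) `^ c).
Proof.
apply: (measurableT_comp (measurable_powR c)).
by apply: measurable_funB => //; exact: measurable_cst.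
Qed.

Lemma measurable_subst : measurable_fun setT subst.
Proof. by apply: measurable_funB; [exact: measurable_cst|exact: measurable_powR_onem]. Qed.

Lemma measurable_dsubst : measurable_fun setT dsubst.
Proof. by apply: measurable_funM; [exact: measurable_cst|exact: measurable_powR_onem]. Qed.

(** * The substitution on compact subintervals, away from a possible singularity of [dsubst] at 1 *)

Section Compact.
Variables (a b : R).
Hypotheses (a0 : 0 < a) (ab : a < b) (b1 : b < 1).

Lemma subst_homo : {in `[a, b] &, {homo subst : x y / x < y}}.
Proof.
move=> x y _; rewrite in_itv/= => /andP[_ yb] xy; apply: subst_lt => //.
by move: b1; lra.
Qed.

Lemma within_continuous_subst : {within `[a, b], continuous subst}.
Proof.
apply: continuous_in_subspaceT => x /set_mem; rewrite /= in_itv/= => /andP[_ xb].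
exact: is_derive_continuous (is_derive_subst (le_lt_trans xb b1)).
Qed.

Lemma within_continuous_dsubst : {within `[a, b], continuous dsubst}.
Proof.
apply: continuous_in_subspaceT => x /set_mem; rewrite /= in_itv/= => /andP[_ xb].
exact: continuous_dsubst (le_lt_trans xb b1).
Qed.

Lemma dsubst_ge0_itv x : x \in `[a, b] -> 0 <= dsubst x.
Proof. by rewrite in_itv/= => /andP[_ xb]; exact/ltW/dsubst_gt0/(le_lt_trans xb b1). Qed.

Lemma is_derive_subst_itv x : x \in `]a, b[ -> is_derive x (1 : R) subst (dsubst x).
Proof. by rewrite in_itv/= => /andP[_ xb]; exact/is_derive_subst/(lt_trans xb b1). Qed.

Lemma is_primitive_subst (w g : R -> R) : is_primitive (subst a) (subst b) w g ->
  is_primitive a b (fun t => w (subst t) * dsubst t) (g \o subst).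
Proof.
exact: (is_primitive_comp ab subst_homo measurable_subst within_continuous_subst
  within_continuous_dsubst dsubst_ge0_itv is_derive_subst_itv).
Qed.

Lemma ge0_integral_subst (f : R -> \bar R) : measurable_fun setT f -> (forall x, 0 <= f x)%E ->
  (\int[leb]_(y in `]subst a, subst b]) f y =
   \int[leb]_(t in `]a, b]) (f (subst t) * (dsubst t)%:E) :> \bar R)%E.
Proof.
exact: (ge0_change_of_variables ab subst_homo measurable_subst within_continuous_subst
  within_continuous_dsubst dsubst_ge0_itv is_derive_subst_itv).
Qed.

End Compact.

(** The weight is the Jacobi weight in the variable [s] with the Jacobian included, so weighted
    norms in [t] are Jacobi norms in [s]. *)
Lemma weightE (mu ups t : R) : 0 < t < 1 ->
  weight mu ups rho t = jweight ups mu (subst t) * dsubst t.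
Proof.
move=> /andP[t0 t1]; have t1' : 0 < 1 - t by rewrite subr_gt0.
rewrite /weight /jweight onem_subst -powRrM /dsubst -/(subst t).
have -> : rho * (mu + 1) - 1 = rho * mu + (rho - 1) by ring.
by rewrite (powRDp (rho * mu) _ t1'); ring.
Qed.

(** The operator is the derivative of [f] with respect to the variable [s]. *)
Lemma DrhoE (f : R -> R) t : t < 1 -> Drho rho f t = weak_deriv f t / dsubst t.
Proof.
move=> t1; have t1' : 0 < 1 - t by rewrite subr_gt0.
rewrite /Drho /dsubst invfM -powRN opprB mulrC; congr (_ * _); rewrite mulrC; congr (_ * _).
Qed.

Lemma compact_subset_itv (A : set R) : compact A -> A `<=` `]0, 1[ ->
  exists a b, [/\ 0 < a, a < b, b < 1 & A `<=` `[a, b]].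
Proof.
move=> cA A01; have clA := compact_closed (@norm_hausdorff _ R) cA.
have out z : ~ A z -> exists2 r, 0 < r & forall y, `|z - y| < r -> ~ A y.
  move=> Az; have /open_nbhs_nbhs : open_nbhs z (~` A) by split => //; exact: closed_openC.
  by move=> /nbhs_ballP[r /= r0 hr]; exists r => // y zy; apply: hr.
have [|r r0 hr] := out 0; first by move=> /A01; rewrite /= in_itv/= ltxx.
have [|q q0 hq] := out 1; first by move=> /A01; rewrite /= in_itv/= ltxx andbF.
pose e := Num.min (Num.min r q) 4^-1.
have e0 : 0 < e by rewrite !lt_min r0 q0 invr_gt0 ltr0n.
have er : e <= r by rewrite !ge_min lexx.
have eq' : e <= q by rewrite !ge_min lexx orbT.
have e4 : e <= 4^-1 by rewrite !ge_min lexx !orbT.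
exists e, (1 - e); split => //; [lra|lra|] => y Ay.
have := A01 y Ay; rewrite /= !in_itv/= => /andP[y0 y1]; apply/andP; split; rewrite leNgt; apply/negP => ye.
  by apply: (hr y) => //; rewrite sub0r normrN gtr0_norm//; lra.
by apply: (hq y) => //; rewrite gtr0_norm//; lra.
Qed.

Lemma locally_integrable_of_itv (w : R -> R) : measurable_fun (`]0, 1[ : set R) w ->
  (forall a b, 0 < a -> a < b -> b < 1 -> leb.-integrable `[a, b] (EFin \o w)) ->
  locally_integrable `]0, 1[ w.
Proof.
move=> mw iw; split => //.
move=> A A01 cA; have [a [b [a0 ab b1 Aab]]] := compact_subset_itv cA A01.
have /integrableP[mab] := iw a b a0 ab b1; apply: le_lt_trans.
apply: ge0_subset_integral => //; first exact: compact_measurable.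
by apply/measurable_EFinP; apply: measurableT_comp => //; exact/measurable_EFinP.
Qed.

Variable f : R -> R.
Let g s : R := f (1 - (1 - s) `^ rho^-1).

Lemma subst_nearE t : 0 < t < 1 -> \forall y \near t, (g \o subst) y = f y.
Proof.
move=> /andP[_ t1]; near=> y; rewrite /= /g subst_inv//.
by near: y; exact: lt_nbhsl.
Unshelve. all: by end_near. Qed.

Lemma continuous_unsubst : {in `]0, 1[, continuous g} -> {in `]0, 1[, continuous f}.
Proof.
move=> cg t; rewrite in_itv/= => t01; have /andP[t0 t1] := t01.
have : {for t, continuous (g \o subst)}.
  apply: continuous_comp; first exact: is_derive_continuous (is_derive_subst t1).
  by apply: cg; rewrite in_itv/=; exact: subst_itv.
have e : (g \o subst) t = f t by rewrite /= /g subst_inv.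
move=> H; have {}H : (g \o subst) y @[y --> t] --> (f t : R) by rewrite -e; exact: H.
apply: cvg_trans H; apply: near_eq_cvg.
by apply: filterS (subst_nearE t01) => y ->.
Qed.

(** A chain rule for weak derivatives, through primitives on compact subintervals. It guarantees
    that [weak_deriv f] is a genuine weak derivative and not the default value. *)
Lemma weakly_derivable_unsubst : {in `]0, 1[, continuous g} -> weakly_derivable g ->
  weakly_derivable f.
Proof.
move=> cg [w gw]; exists (fun t => w (subst t) * dsubst t).
have PR a b : 0 < a -> a < b -> b < 1 -> is_primitive a b (fun t => w (subst t) * dsubst t) f.
  move=> a0 ab b1.
  have /andP[sa0 _] : 0 < subst a < 1 by apply: subst_itv; lra.
  have /andP[_ sb1] : 0 < subst b < 1 by apply: subst_itv; lra.
  have [i E] := is_primitive_subst ab b1 (weak_derivative_is_primitive cg gw sa0 sb1).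
  have gE x : x <= b -> (g \o subst) x = f x by move=> xb; rewrite /= /g subst_inv//; lra.
  split=> // x xab; have xb : x <= b by move: xab; rewrite in_itv/= => /andP[].
  by rewrite -(gE x xb) -(gE a (ltW ab)); exact: E.
apply: (is_primitive_weak_derivative _ _ PR); first exact: continuous_unsubst.
apply: locally_integrable_of_itv; last by move=> a b a0 ab b1; have [] := PR a b a0 ab b1.
have [_ [mw _ _] _] := gw; apply: measurable_funM; last by apply: measurable_funTS; exact: measurable_dsubst.
apply: (measurable_comp (measurable_itv `]0, 1[) _ mw).
  by move=> _ [t + <-]; rewrite /= !in_itv/=; exact: subst_itv.
by apply: measurable_funTS; exact: measurable_subst.
Qed.

End Substitution.

(** * From neighbouring nodes to the sum over all nodes *)

Section SumIntegral.
Context (R : realType).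
Local Notation leb := (@lebesgue_measure R).
Variables (n : nat) (t : 'I_n -> R) (F : R -> R) (G : R -> \bar R).
Hypotheses (tinj : injective t) (t01 : forall i, 0 < t i < 1).
Hypotheses (mG : measurable_fun (`]0, 1[ : set R) G) (G0 : forall x, 0 < x < 1 -> (0 <= G x)%E).
Hypothesis FG : forall i j, t i < t j ->
  ((F (t i))%:E <= \int[leb]_(y in `]t i, t j]) G y)%E /\
  ((F (t j))%:E <= \int[leb]_(y in `]t i, t j]) G y)%E.

Let sub_oc i j : `]t i, t j] `<=` (`]0, 1[%classic : set R).
Proof.
have /andP[ti0 _] := t01 i; have /andP[_ tj1] := t01 j.
by apply: subset_itv; rewrite bnd_simp// ltW.
Qed.

Lemma path_sum_le_integral i (s : seq 'I_n) : path (fun i j => t i < t j) i s ->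
  (\sum_(j <- s) (F (t j))%:E <= \int[leb]_(y in `]t i, t (last i s)]) G y)%E.
Proof.
elim: s i => [|k s ih] i /=.
  by move=> _; rewrite big_nil set_itvoc0 integral_set0.
move=> /andP[ik ks]; rewrite big_cons.
have kl : t k <= t (last k s).
  elim: s k ks {ih ik} => [|l s ih] k //= /andP[kl ls].
  exact: le_trans (ltW kl) (ih _ ls).
have split : `]t i, t (last k s)]%classic = `]t i, t k]%classic `|` `]t k, t (last k s)]%classic.
  apply/seteqP; split => y /=; rewrite !in_itv/=.
    by move=> /andP[iy yl]; have [yk|ky] := leP y (t k); [left|right]; rewrite ?iy ?yl.
  by move=> [] /andP[iy yl]; apply/andP; split; [|exact: le_trans kl| exact: lt_trans iy |].
have disj : [disjoint `]t i, t k]%classic & `]t k, t (last k s)]%classic].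
  by apply/disj_setPS => y [] /=; rewrite !in_itv/= => /andP[_ yk] /andP[]; rewrite ltNge yk.
have -> : (\int[leb]_(y in `]t i, t (last k s)]) G y = \int[leb]_(y in `]t i, t k]) G y +
    \int[leb]_(y in `]t k, t (last k s)]) G y :> \bar R)%E.
  rewrite split; apply: ge0_integral_setU => //.
  - by rewrite -split; apply: measurable_funS mG => //; exact: sub_oc.
  - rewrite -split => y /(@sub_oc i (last k s)); rewrite /= in_itv/=; exact: G0.
by apply: leeD; [have [] := FG ik|exact: ih].
Qed.

(** In increasing order, each node except the first is charged to the interval on its left, and
    these intervals are disjoint. The first node is charged to the interval on its right; this is
    the reason for the factor 2 and for the presence of two nodes. *)
Lemma sum_le_integral : (2 <= n)%N ->
  ((\sum_i F (t i))%:E <= 2%:E * \int[leb]_(y in `]0%R, 1%R[) G y)%E.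
Proof.
move=> n2.
pose le i j := t i <= t j.
have le_total : total le by move=> i j; exact: le_total.
have le_tr : transitive le by move=> i j k; exact: le_trans.
pose s := sort le (enum 'I_n).
have us : uniq s by rewrite sort_uniq enum_uniq.
have sz : size s = n by rewrite size_sort size_enum_ord.
have ps : perm_eq s (enum 'I_n) by rewrite perm_sort.
have ss : sorted (fun i j => t i < t j) s.
  have := sort_sorted le_total (enum 'I_n); rewrite -/s.
  elim: s us {sz ps} => [|i s ih] //= /andP[is' us]; case: s is' us ih => [|j s] //= + us ih /andP[ij js].
  rewrite inE negb_or => /andP[nij _]; rewrite ih// andbT lt_neqAle [t i <= _]ij andbT.
  by apply: contra_neq nij; exact: tinj.
have -> : (\sum_i F (t i))%:E = (\sum_(i <- s) (F (t i))%:E)%E.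
  by rewrite (perm_big _ ps)/= sumEFin big_enum.
have s2 : (2 <= size s)%N by rewrite sz.
case: s ss s2 {sz us ps} => [|i [|j s]] //= /andP[ij js] _.
have sub k l : (\int[leb]_(y in `]t k, t l]) G y <= \int[leb]_(y in `]0%R, 1%R[) G y)%E.
  by apply: ge0_subset_integral => //; exact: sub_oc.
rewrite big_cons.
have -> : (2%:E = 1 + 1 :> \bar R)%E by rewrite -EFinD.
rewrite ge0_muleDl// mul1e; apply: leeD.
  by have [h _] := FG ij; exact: le_trans h (sub _ _).
have := @path_sum_le_integral i (j :: s); rewrite /= ij js => /(_ isT) h.
exact: le_trans h (sub _ _).
Qed.

End SumIntegral.

Section PrimitiveBound.
Context (R : realType).
Local Notation leb := (@lebesgue_measure R).

Lemma is_primitive_le (a b : R) (u F : R -> R) (G : R -> \bar R) : a <= b ->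
  is_primitive a b u F -> measurable_fun (`[a, b] : set R) G ->
  (forall y, y \in `[a, b] -> (`|u y|%:E <= G y)%E) ->
  (`|F b - F a|%:E <= \int[leb]_(y in `[a, b]) G y)%E.
Proof.
move=> ab PF mG uG; rewrite (is_primitive_end ab PF); have [iu _] := PF.
apply: (@le_trans _ _ (\int[leb]_(y in `[a, b]) `|(u y)%:E|)%E).
  rewrite -abse_EFin /Rintegral fineK; last exact: integrable_fin_num.
  by apply: le_abse_integral => //; exact: measurable_int iu.
apply: ge0_le_integral => //.
by apply: measurableT_comp => //; exact: measurable_int iu.
Qed.

End PrimitiveBound.

Section InterpolantNorm.
Context (R : realType) (mu ups rho : R).
Hypotheses (mu1 : -1 < mu) (ups1 : -1 < ups) (rho0 : 0 < rho).
Local Notation leb := (@lebesgue_measure R).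
Variables (N : nat) (t : 'I_N.+1 -> R).
Hypotheses (t01 : forall i, 0 < t i < 1).

Lemma lagrangeE j y :
  Defs.lagrange rho t j y = (lagrange_poly (fun i => subst rho (t i)) j).[subst rho y].
Proof.
rewrite /Defs.lagrange /lagrange_poly horner_prod; apply: eq_bigr => i ij.
have e (a b : R) : 1 - a - (1 - b) = - (a - b) by ring.
by rewrite hornerZ hornerXsubC -!onem_subst !e invrN mulrNN mulrC.
Qed.

Lemma interpE f y :
  interp rho t f y = (\sum_j f (t j) *: lagrange_poly (fun i => subst rho (t i)) j).[subst rho y].
Proof. by rewrite horner_sum; apply: eq_bigr => j _; rewrite hornerZ lagrangeE. Qed.

(** Substitution turns the squared norm into the integral of [r^2] against the Jacobi weight. It is
    available on compact subintervals only, so the bound is proved there and passed to the limit. *)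
Lemma wnorm_interp_le f (r : {poly R}) (c : R) : (forall y, f y = r.[subst rho y]) ->
  jint mu ups (r ^+ 2) <= c ->
  (wnorm (weight mu ups rho) f <= sqrte c%:E)%E.
Proof.
move=> fE rc; rewrite /wnorm.
have c0 : 0 <= c.
  by apply: le_trans rc; apply: jint_ge0 => // x _; rewrite expr2 hornerM -expr2 sqr_ge0.
rewrite lee_sqrt ?lee_fin//.
pose q x := jweight ups mu x * (r ^+ 2).[x].
have q0 x : 0 <= q x by rewrite mulr_ge0 ?jweight_ge0// expr2 hornerM -expr2 sqr_ge0.
have mq : measurable_fun setT q.
  apply: measurable_funM; first exact: measurable_jweight.
  by apply: continuous_measurable_fun => x; exact: is_derive_continuous (fun_derive_poly (r ^+ 2) x).
have qE y : 0 < y < 1 -> f y ^+ 2 * weight mu ups rho y = q (subst rho y) * dsubst rho y.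
  by move=> y01; rewrite weightE// fE /q expr2 (expr2 r) hornerM; ring.
have mqs : measurable_fun (`]0, 1[ : set R) (fun y => (q (subst rho y) * dsubst rho y)%:E).
  apply/measurable_EFinP/measurable_funTS; apply: measurable_funM; last exact: measurable_dsubst.
  by apply: (measurableT_comp mq); exact: measurable_subst.
have qE' y : y \in (`]0, 1[%classic : set R) ->
    (q (subst rho y) * dsubst rho y)%:E = (f y ^+ 2 * weight mu ups rho y)%:E.
  by move=> /set_mem; rewrite /= in_itv/= => y01; rewrite qE.
have mf := eq_measurable_fun _ qE' mqs.
rewrite integral_itv_bndoo//; apply: ge0_integral_oo_le => //.
  move=> y y01; rewrite lee_fin qE// mulr_ge0//; apply/ltW/dsubst_gt0 => //.
  by case/andP: y01.
move=> a b a0 ab b1.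
have sub : `]a, b] `<=` (`]0, 1[%classic : set R) by apply: subset_itv; rewrite bnd_simp// ltW.
rewrite -integral_itv_obnd_cbnd; last exact: measurable_funS mf.
have -> : (\int[leb]_(y in `]a, b]) (f y ^+ 2 * weight mu ups rho y)%:E =
    \int[leb]_(y in `]a, b]) ((EFin \o q) (subst rho y) * (dsubst rho y)%:E) :> \bar R)%E.
  by apply: eq_integral => y /set_mem /sub; rewrite /= in_itv/= => y01; rewrite qE.
have mqE : measurable_fun setT (EFin \o q) by exact/measurable_EFinP.
have H := @ge0_integral_subst _ rho rho0 a b ab b1 (EFin \o q) mqE (fun x => q0 x).
rewrite -H.
have /andP[sa0 _] : 0 < subst rho a < 1 by apply: subst_itv => //; lra.
have /andP[_ sb1] : 0 < subst rho b < 1 by apply: subst_itv => //; lra.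
apply: (@le_trans _ _ (\int[leb]_(x in `[0%R, 1%R]) (EFin \o q) x)%E).
  apply: ge0_subset_integral => //; last by apply: subset_itv; rewrite bnd_simp// ltW.
  - by apply: measurable_funTS.
  - by move=> x _; exact: q0.
have iq := integrable_jint mu1 ups1 (r ^+ 2).
apply: (@le_trans _ _ (jint mu ups (r ^+ 2))%:E); last by rewrite lee_fin.
rewrite /jint /Rintegral fineK; [exact: lexx|exact: integrable_fin_num].
Qed.

End InterpolantNorm.

(** * Local estimate between two nodes *)

Section NodeEstimate.
Context (R : realType) (mu ups rho lam : R) (n : nat) (t : 'I_n -> R) (P : {poly R}).
Hypotheses (mu1 : -1 < mu) (ups1 : -1 < ups) (rho0 : 0 < rho).
Hypotheses (lam1 : 1 <= lam) (ode : jop mu ups P + lam *: P = 0).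
Local Notation x := (fun i => subst rho (t i)).
Hypotheses (xinj : injective x) (sizeP : (size P <= n.+1)%N) (P0 : P != 0).
Hypotheses (t01 : forall i, 0 < t i < 1) (Px : forall i, P.[x i] = 0).
Variable d : R.
Hypotheses (d0 : 0 < d) (dups : d * (lam / (ups + 1)) <= 2^-1)
  (dmu : d * (lam / (mu + 1)) <= 2^-1) (d4 : d <= 4^-1).
Local Notation leb := (@lebesgue_measure R).
Variables (f v : R -> R).
Hypotheses (cf : {in `]0, 1[, continuous f}) (fv : is_weak_derivative f v).
Local Notation W := (jweight (ups + 2^-1) (mu + 2^-1)).
Local Notation w := (jweight ups mu).
Local Notation C := (cutoff_const mu ups (lam * d)).
Local Notation l := (Num.sqrt lam).
Local Notation s := (subst rho).
Local Notation ds := (dsubst rho).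

Let x01 i : 0 < x i < 1. Proof. exact: subst_itv. Qed.

(** The integrands of the two squared norms on the right, in the variable [s], weighted by
    [sqrt lam] and its inverse. In [1 + C], the 1 is the share of the product [f f'] and [C] that of
    the derivative of the cutoff. *)
Definition node_majorant (y : R) : R :=
  (1 + C) * l * (f y ^+ 2 * (w (s y) * ds y)) +
  l^-1 * ((v y / ds y) ^+ 2 * (jweight (ups + 1) (mu + 1) (s y) * ds y)).

Let u y := (v y * f y + v y * f y) * cutoff mu ups lam P (s y) +
  (cutoff_deriv mu ups lam P (s y) * ds y) * (f y * f y).

Let lam0 : 0 < lam. Proof. exact: lt_le_trans lam1. Qed.
Let l0 : 0 < l. Proof. by rewrite sqrtr_gt0. Qed.

Lemma node_derivative_le y : 0 < y < 1 -> d <= s y <= 1 - d -> `|u y| <= node_majorant y.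
Proof.
move=> y01 sd; have /andP[_ y1] := y01; have s01 := subst_itv rho0 y01.
have ds0 := dsubst_gt0 rho0 y1.
pose m := jweight 2^-1 2^-1 (s y); have m0 : 0 < m := jweight_gt0 2^-1 2^-1 s01.
have WE : W (s y) = w (s y) * m by rewrite -jweightD.
have W1E : jweight (ups + 1) (mu + 1) (s y) = w (s y) * m ^+ 2.
  have e : 2^-1 + 2^-1 = 1 :> R by field.
  have mE : m * m = jweight 1 1 (s y) by rewrite /m -jweightD// e.
  by rewrite jweightD// expr2 mE.
have w0 := jweight_gt0 ups mu s01.
have d2 : d <= 2^-1 by move: d4; lra.
have D := cutoff_deriv_le mu ups lam1 xinj sizeP P0 Px x01 d0 d2 sd.
have /andP[c0 cW] := cutoff_itv mu ups lam1 xinj sizeP P0 Px x01 s01.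
have T1 : `|(v y * f y + v y * f y) * cutoff mu ups lam P (s y)| <= w (s y) * (2 * (`|v y| * m * `|f y|)).
  have -> : w (s y) * (2 * (`|v y| * m * `|f y|)) = (2 * (`|v y| * `|f y|)) * (w (s y) * m) by ring.
  rewrite normrM (ger0_norm c0) -WE; apply: ler_pM => //.
  have -> : v y * f y + v y * f y = 2 * (v y * f y) by ring.
  by rewrite normrM normrM ger0_norm.
have T2 : `|(cutoff_deriv mu ups lam P (s y) * ds y) * (f y * f y)| <= C * l * w (s y) * (ds y * f y ^+ 2).
  rewrite -expr2 -mulrA normrM; apply: ler_pM => //.
  by rewrite ger0_norm// mulr_ge0 ?sqr_ge0 ?(ltW ds0).
apply: le_trans (ler_normD _ _) _; apply: le_trans (lerD T1 T2) _.
(* Arithmetic-geometric mean with parameter [l * ds y]: the value receives the factor [sqrt lam],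
   the derivative its inverse. *)
have AG : 2 * (`|v y| * m * `|f y|) <= l * ds y * f y ^+ 2 + (v y * m) ^+ 2 / (l * ds y).
  have A0 : 0 < l * ds y by exact: mulr_gt0.
  rewrite -(real_normK (num_real (f y))) exprMn -(real_normK (num_real (v y))).
  set A := l * ds y in A0 *; rewrite -exprMn.
  have -> : A * `|f y| ^+ 2 + (`|v y| * m) ^+ 2 / A =
      2 * (`|v y| * m * `|f y|) + (A * `|f y| - `|v y| * m) ^+ 2 / A by field; rewrite gt_eqF.
  by rewrite lerDl divr_ge0 ?sqr_ge0// ltW.
have -> : node_majorant y = w (s y) * (l * ds y * f y ^+ 2 + (v y * m) ^+ 2 / (l * ds y)) +
   C * l * w (s y) * (ds y * f y ^+ 2).
  by rewrite /node_majorant W1E; field; rewrite !gt_eqF.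
by rewrite lerD2r ler_pM2l.
Qed.

Lemma node_primitive a b : 0 < a -> a < b -> b < 1 ->
  is_primitive a b u (fun y => f y * f y * cutoff mu ups lam P (s y)).
Proof.
move=> a0 ab b1.
have /andP[sa0 _] : 0 < s a < 1 by apply: subst_itv => //; lra.
have /andP[_ sb1] : 0 < s b < 1 by apply: subst_itv => //; lra.
have sab : s a < s b by apply: subst_lt => //; exact: ltW.
have inab z : z \in `[s a, s b] -> 0 < z < 1 by rewrite in_itv/=; lra.
have PF := weak_derivative_is_primitive cf fv a0 b1.
have Pc : is_primitive (s a) (s b) (cutoff_deriv mu ups lam P) (cutoff mu ups lam P).
  apply: C1_is_primitive; first exact: ltW.
  - apply: continuous_in_subspaceT => z /set_mem zab.
    exact: is_derive_continuous (is_derive_cutoff lam1 ode xinj sizeP P0 Px x01 (inab z zab)).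
  - apply: continuous_in_subspaceT => z /set_mem zab.
    exact: (continuous_cutoff_deriv lam1 ode xinj sizeP P0 Px x01 (inab z zab)).
  - move=> z zab; apply: (is_derive_cutoff lam1 ode xinj sizeP P0 Px x01).
    by apply: inab; move: zab; rewrite !in_itv/= => /andP[/ltW -> /ltW ->].
have Ps := is_primitive_subst rho0 ab b1 Pc.
exact: is_primitiveM (ltW ab) (is_primitiveM (ltW ab) PF PF) Ps.
Qed.

Lemma measurable_node_terms :
  measurable_fun (`]0, 1[ : set R) (fun y => f y ^+ 2 * (w (s y) * ds y)) /\
  measurable_fun (`]0, 1[ : set R)
    (fun y => (v y / ds y) ^+ 2 * (jweight (ups + 1) (mu + 1) (s y) * ds y)).
Proof.
have mf : measurable_fun (`]0, 1[ : set R) f.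
  apply: open_continuous_measurable_fun; first exact: interval_open.
  by move=> y /set_mem; rewrite /= => y01; exact: cf.
have [_ [mv _ _] _] := fv.
have mds : measurable_fun (`]0, 1[ : set R) ds.
  by apply: measurable_funTS; exact: measurable_dsubst.
have mj (a b : R) : measurable_fun (`]0, 1[ : set R) (fun y => jweight a b (s y)).
  apply: measurable_funTS; apply: (measurableT_comp (measurable_jweight a b)).
  exact: measurable_subst.
have mi : measurable_fun (`]0, 1[ : set R) (fun y => (ds y)^-1).
  apply/measurable_funTS.
  have -> : (fun y => (ds y)^-1) = (fun y => rho^-1 * (1 - y) `^ (- (rho - 1))).
    by apply/funext => y; rewrite /dsubst invfM powRN.
  by apply: measurable_funM; [exact: measurable_cst|exact: measurable_powR_onem].
split; apply: measurable_funM.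
- exact: measurable_funX.
- exact: measurable_funM.
- by apply: measurable_funX; exact: measurable_funM.
- exact: measurable_funM.
Qed.

Lemma measurable_node_majorant : measurable_fun (`]0, 1[ : set R) (EFin \o node_majorant).
Proof.
have [m0 m1] := measurable_node_terms.
by apply/measurable_EFinP; apply: measurable_funD; apply: measurable_funM => //; exact: measurable_cst.
Qed.

Lemma cutoff_const_ge0 : 0 <= C.
Proof.
have ld0 : 0 <= lam * d by apply: mulr_ge0; exact: ltW.
have K0 := liouville_const_ge0 mu ups.
have T1 : 0 <= 4 * (`|ups + 2^-1| + `|mu + 2^-1|) / Num.sqrt (lam * d).
  by apply: divr_ge0 => //; apply: mulr_ge0 => //; exact: addr_ge0.
have T2 : 0 <= 2 * liouville_const mu ups / (lam * d).
  by apply: divr_ge0 => //; exact: mulr_ge0.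
by rewrite /cutoff_const; lra.
Qed.

Lemma node_majorant_ge0 y : 0 < y < 1 -> 0 <= node_majorant y.
Proof.
move=> y01; have /andP[_ y1] := y01; have ds0 := ltW (dsubst_gt0 rho0 y1).
have C0 : 0 <= 1 + C by rewrite addr_ge0// cutoff_const_ge0.
have W0 a b : 0 <= jweight a b (s y) * ds y by apply: mulr_ge0 => //; exact: jweight_ge0.
apply: addr_ge0; apply: mulr_ge0.
- by apply: mulr_ge0 => //; exact: ltW.
- by apply: mulr_ge0 => //; exact: sqr_ge0.
- by rewrite invr_ge0 ltW.
- by apply: mulr_ge0 => //; exact: sqr_ge0.
Qed.

(** The product of [f^2] and the cutoff equals [W f^2] at both nodes and vanishes at some point
    between them. Each nodal value is thus an increment over part of the interval, bounded by the
    integral of the majorant. *)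
Lemma node_estimate i j : t i < t j ->
  ((W (s (t i)) * f (t i) ^+ 2)%:E <= \int[leb]_(y in `]t i, t j]) (EFin \o node_majorant) y)%E /\
  ((W (s (t j)) * f (t j) ^+ 2)%:E <= \int[leb]_(y in `]t i, t j]) (EFin \o node_majorant) y)%E.
Proof.
move=> tij; have /andP[ti0 ti1] := t01 i; have /andP[tj0 tj1] := t01 j.
have xij : x i < x j by apply: subst_lt => //; exact: ltW.
have [z /andP[xz zx] cz] := cutoff_zero_between mu ups lam1 xinj sizeP P0 Px x01 xij.
have /andP[xi0 _] := x01 i; have /andP[_ xj1] := x01 j.
pose tau := 1 - (1 - z) `^ rho^-1.
have stau : s tau = z.
  rewrite /subst /tau (_ : 1 - (1 - (1 - z) `^ rho^-1) = (1 - z) `^ rho^-1); last by ring.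
  by rewrite -powRrM mulVf ?gt_eqF// powRr1; [ring|lra].
have mono (a b : R) : a < 1 -> b < 1 -> s a < s b -> a < b.
  move=> a1 b1 sab; rewrite ltNge; apply/negP; rewrite le_eqVlt => /predU1P[ba|ba].
    by move: sab; rewrite ba ltxx.
  by have := subst_lt rho0 ba (ltW a1); lra.
have tau1 : tau < 1 by rewrite /tau ltrBlDr ltrDl powR_gt0//; lra.
have itau : t i < tau by apply: mono => //; rewrite stau.
have tauj : tau < t j by apply: mono => //; rewrite stau.
have PU := node_primitive ti0 tij tj1.
have sub a b : t i <= a -> b <= t j -> (`[a, b] : set R) `<=` `]0, 1[%classic.
  by move=> ta bt; apply: subset_itv; rewrite bnd_simp ?(lt_le_trans ti0)// (le_lt_trans bt).
have key a b : t i <= a -> a <= b -> b <= t j ->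
    (`|f b * f b * cutoff mu ups lam P (s b) - f a * f a * cutoff mu ups lam P (s a)|%:E
     <= \int[leb]_(y in `]t i, t j]) (EFin \o node_majorant) y)%E.
  move=> ta ab bt; have Pab := is_primitiveS ta bt PU.
  have mab : measurable_fun (`[a, b] : set R) (EFin \o node_majorant).
    by apply: measurable_funS measurable_node_majorant => //; exact: sub.
  apply: le_trans (is_primitive_le ab Pab mab _) _.
    move=> y; rewrite in_itv/= => /andP[ay yb].
    have ty : t i <= y <= t j by rewrite (le_trans ta ay) (le_trans yb bt).
    have y01 : 0 < y < 1 by lra.
    rewrite /= lee_fin; apply: node_derivative_le => //.
    have sle (p q : R) : p <= q -> q < 1 -> s p <= s q.
      by rewrite le_eqVlt => /predU1P[-> //|pq] q1; apply/ltW/subst_lt => //; exact: ltW.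
    have /andP[h1 h2] := ty.
    (* The nodes stay at distance [2 d] from the endpoints, so the whole interval lies where the
       bound on the derivative of the cutoff is valid. *)
    have /andP[n1 _] := node_ge mu1 ups1 ode xinj sizeP P0 Px x01 d0 dups dmu i.
    have /andP[_ n2] := node_ge mu1 ups1 ode xinj sizeP P0 Px x01 d0 dups dmu j.
    have s1 := sle _ _ h1 (le_lt_trans h2 tj1); have s2 := sle _ _ h2 tj1.
    by move: d0 n1 n2 s1 s2; lra.
  have mij : measurable_fun (`[t i, t j] : set R) (EFin \o node_majorant).
    by apply: measurable_funS measurable_node_majorant => //; exact: sub.
  rewrite integral_itv_obnd_cbnd; last first.
    by apply: measurable_funS mij => //; apply: subset_itv; rewrite bnd_simp.
  apply: ge0_subset_integral => //.
    move=> y yij; have := sub _ _ (lexx (t i)) (lexx (t j)) y yij.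
    by rewrite /= in_itv/= => y01; rewrite lee_fin; exact: node_majorant_ge0.
  by apply: subset_itv; rewrite bnd_simp.
have nodeE k : W (s (t k)) * f (t k) ^+ 2 = `|f (t k) * f (t k) * cutoff mu ups lam P (s (t k))|.
  rewrite (cutoff_node mu ups lam Px) ger0_norm; first by rewrite mulrC expr2.
  by apply: mulr_ge0; [rewrite -expr2 sqr_ge0|exact: jweight_ge0].
split.
  have := key (t i) tau (lexx _) (ltW itau) (ltW tauj).
  by rewrite stau cz mulr0 sub0r normrN -nodeE.
have := key tau (t j) (ltW itau) (ltW tauj) (lexx _).
by rewrite stau cz mulr0 subr0 -nodeE.
Qed.

Lemma integral_node_majorant : v = weak_deriv f ->
  (\int[leb]_(y in `]0%R, 1%R[) (EFin \o node_majorant) y =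
   ((1 + C) * l)%:E * \int[leb]_(y in `[0%R, 1%R]) (f y ^+ 2 * weight mu ups rho y)%:E +
   (l^-1)%:E * \int[leb]_(y in `[0%R, 1%R])
     (Drho rho f y ^+ 2 * weight (mu + 1) (ups + 1) rho y)%:E :> \bar R)%E.
Proof.
move=> vE; pose h0 (y : R) : R := f y ^+ 2 * (w (s y) * ds y).
pose h1 (y : R) : R := (v y / ds y) ^+ 2 * (jweight (ups + 1) (mu + 1) (s y) * ds y).
have [/measurable_EFinP m0 /measurable_EFinP m1] := measurable_node_terms.
have C0 : 0 <= 1 + C by rewrite addr_ge0// cutoff_const_ge0.
have W0 (a b y : R) : 0 < y < 1 -> 0 <= jweight a b (s y) * ds y.
  move=> /andP[_ y1]; apply: mulr_ge0; first exact: jweight_ge0.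
  by apply/ltW; exact: dsubst_gt0.
have e0 (y : R) : y \in (`]0, 1[%classic : set R) -> (h0 y)%:E = (f y ^+ 2 * weight mu ups rho y)%:E.
  by move=> /set_mem; rewrite /= in_itv/= => y01; rewrite weightE.
have e1 (y : R) : y \in (`]0, 1[%classic : set R) ->
    (h1 y)%:E = (Drho rho f y ^+ 2 * weight (mu + 1) (ups + 1) rho y)%:E.
  move=> /set_mem; rewrite /= in_itv/= => y01; rewrite weightE// DrhoE ?vE//.
    by rewrite /h1 vE.
  by case/andP: y01.
have i0 : (\int[leb]_(y in `[0%R, 1%R]) (f y ^+ 2 * weight mu ups rho y)%:E =
    \int[leb]_(y in `]0%R, 1%R[) (h0 y)%:E :> \bar R)%E.
  rewrite integral_itv_bndoo; last exact: eq_measurable_fun e0 m0.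
  by apply: eq_integral => y yy; rewrite -e0.
have i1 : (\int[leb]_(y in `[0%R, 1%R]) (Drho rho f y ^+ 2 * weight (mu + 1) (ups + 1) rho y)%:E =
    \int[leb]_(y in `]0%R, 1%R[) (h1 y)%:E :> \bar R)%E.
  rewrite integral_itv_bndoo; last exact: eq_measurable_fun e1 m1.
  by apply: eq_integral => y yy; rewrite -e1.
rewrite i0 i1.
have p0 (y : R) : (`]0, 1[%classic : set R) y -> (0 <= (h0 y)%:E)%E.
  by rewrite /= in_itv/= => y01; rewrite lee_fin; apply: mulr_ge0; [exact: sqr_ge0|exact: W0].
have p1 (y : R) : (`]0, 1[%classic : set R) y -> (0 <= (h1 y)%:E)%E.
  by rewrite /= in_itv/= => y01; rewrite lee_fin; apply: mulr_ge0; [exact: sqr_ge0|exact: W0].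
have k0 : (0 <= ((1 + C) * l)%:E)%E by rewrite lee_fin; apply: mulr_ge0 => //; exact: ltW.
have k1 : (0 <= (l^-1)%:E)%E by rewrite lee_fin invr_ge0 ltW.
rewrite -ge0_integralZl// -ge0_integralZl// -ge0_integralD//.
- by move=> y y01; apply: mule_ge0 => //; exact: p0.
- exact: measurable_funeM.
- by move=> y y01; apply: mule_ge0 => //; exact: p1.
- exact: measurable_funeM.
Qed.

End NodeEstimate.

(** * Assembly of the estimates *)

Section FinalEstimate.
Context (R : realType).

Lemma sqrtrD_le (a b : R) : 0 <= a -> 0 <= b -> Num.sqrt (a + b) <= Num.sqrt a + Num.sqrt b.
Proof.
move=> a0 b0; rewrite -[leRHS]ger0_norm ?addr_ge0// -sqrtr_sqr; apply: ler_wsqrtr.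
rewrite sqrrD !sqr_sqrtr//; have := mulr_ge0 (sqrtr_ge0 a) (sqrtr_ge0 b); lra.
Qed.

(** An infinite norm on the right makes the claim trivial, the constant being positive. Otherwise
    [J <= 2 A (k I0 + I1 / l^2)]; then [1 / l <= 1 / N], [1 <= k] and subadditivity of the square
    root finish. *)
Lemma sqrte_estimate (S J A k l N : R) (I0 I1 : \bar R) :
  0 < A -> 1 <= k -> 0 < N -> N <= l -> (0 <= I0)%E -> (0 <= I1)%E ->
  J <= A / l * S -> (S%:E <= 2%:E * ((k * l)%:E * I0 + (l^-1)%:E * I1))%E ->
  (sqrte J%:E <= (Num.sqrt (2 * A * k))%:E * (sqrte I0 + (N^-1)%:E * sqrte I1))%E.
Proof.
move=> A0 k1 N0 Nl I00 I10 JS.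
have l0 : 0 < l by exact: lt_le_trans Nl.
have c0 : 0 < 2 * A * k by rewrite !mulr_gt0// (lt_le_trans ltr01).
have s0 : 0 < Num.sqrt (2 * A * k) by rewrite sqrtr_gt0.
have Ni : 0 < N^-1 by rewrite invr_gt0.
have neqNy (y : \bar R) : (0 <= y)%E -> y != -oo%E by case: y.
have y1 : (0 <= (N^-1)%:E * sqrte I1)%E by rewrite mule_ge0 ?sqrte_ge0// lee_fin ltW.
case: I0 I00 => [a|_|//]; last first.
  by move=> _; rewrite [sqrte +oo]/= addye ?neqNy// gt0_muley ?lte_fin// leey.
case: I1 I10 y1 => [b|_ _|//]; last first.
  by move=> _ _; rewrite [sqrte +oo]/= (gt0_muley (x := (N^-1)%:E)) ?lte_fin// addey// gt0_muley ?lte_fin// leey.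
move=> b0 _ a0.
move=> SE0; have {SE0}SE : S <= 2 * (k * l * a + l^-1 * b) by rewrite -lee_fin; exact: SE0.
have {}a0 : 0 <= a by rewrite -lee_fin.
have {}b0 : 0 <= b by rewrite -lee_fin.
suff: Num.sqrt J <= Num.sqrt (2 * A * k) * (Num.sqrt a + N^-1 * Num.sqrt b).
  by rewrite -lee_fin; exact.
have NE : N^-1 * Num.sqrt b = Num.sqrt (b / N ^+ 2).
  by rewrite sqrtrM// sqrtrV ?sqr_ge0// sqrtr_sqr gtr0_norm// mulrC.
have b0' : 0 <= b / N ^+ 2 by rewrite divr_ge0 ?sqr_ge0.
rewrite NE; apply: (@le_trans _ _ (Num.sqrt (2 * A * k) * Num.sqrt (a + b / N ^+ 2))); last first.
  by rewrite ler_pM2l// sqrtrD_le.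
rewrite -sqrtrM ?(ltW c0)//; apply: ler_wsqrtr; apply: le_trans JS _.
have Al : 0 <= A / l by rewrite divr_ge0// ltW.
apply: le_trans (ler_wpM2l Al SE) _.
have -> : A / l * (2 * (k * l * a + l^-1 * b)) = 2 * A * (k * a + b / l ^+ 2).
  by field; rewrite gt_eqF.
rewrite -[2 * A * k * _]mulrA; apply: ler_wpM2l; first by rewrite mulr_ge0// ltW.
rewrite mulrDr lerD2l.
have h : b / l ^+ 2 <= b / N ^+ 2.
  rewrite ler_wpM2l// lef_pV2 ?posrE ?exprn_gt0// lerXn2r ?nnegrE// ltW//.
by apply: le_trans h _; rewrite ler_peMl.
Qed.

End FinalEstimate.

(** For the zero polynomial every point of []0, 1[] would be a node, and half of the smallest node
    gives a contradiction. *)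
Lemma jacobi01_neq0_of_nodes (R : realType) (mu ups rho : R) (N : nat) (t : 'I_N.+1 -> R) :
  jacobi_nodes mu ups rho t -> jacobi01 mu ups N.+1 != 0.
Proof.
move=> [tinj tP]; apply/eqP => P0.
have zero y : jacobi_rho mu ups rho N.+1 y = 0.
  rewrite /jacobi_rho (_ : 1 - 2 * (1 - y) `^ rho = 2 * (1 - (1 - y) `^ rho) - 1); last by ring.
  by rewrite jacobi01E P0 horner0.
have [i _ imin] := @Order.TotalTheory.arg_minP _ R _ ord0 xpredT t isT.
have [/andP[ti0 ti1] _] := (tP (t i)).1 (ex_intro _ i erefl).
have [k tk] : exists k, t k = t i / 2.
  by apply/(tP _); split; [apply/andP; split; lra|exact: zero].
by have := imin k isT; rewrite tk; lra.
Qed.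

Theorem proposition4p1 (R : realType) (mu ups rho : R) :
  -1 < mu -> -1 < ups -> 0 < rho <= 1 ->
  exists c : R,
    forall (N : nat) (t : 'I_N.+1 -> R) (f : R -> R),
      (1 <= N)%N ->
      jacobi_nodes mu ups rho t ->
      B11 mu ups (fun s => f (1 - (1 - s) `^ rho^-1)) ->
      (wnorm (weight mu ups rho) (interp rho t f) <=
       c%:E * (wnorm (weight mu ups rho) f +
               (N%:R^-1)%:E *
               wnorm (weight (mu + 1) (ups + 1) rho) (Drho rho f)))%E.
Proof.
move=> mu1 ups1 /andP[rho0 _].
(* With [d = c1 / lam], the first two entries give the edge conditions at 0 and 1, and the last one,
   since [lam >= 1], gives [d <= 1/4]. *)
pose c1 : R := Num.min (Num.min ((ups + 1) / 2) ((mu + 1) / 2)) 4^-1.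
have u0 : 0 < ups + 1 by lra.
have m0 : 0 < mu + 1 by lra.
have c10 : 0 < c1 by rewrite !lt_min !divr_gt0// invr_gt0 ltr0n.
pose E := expR (16 * liouville_const mu ups / Num.sqrt c1).
pose M := edge_const mu ups * E * jmajorant_mass mu ups.
have M0 : 0 <= M.
  apply: mulr_ge0; last exact: jmajorant_mass_ge0.
  apply: mulr_ge0; last exact: expR_ge0.
  by apply: mulr_ge0 => //; do !apply: addr_ge0; rewrite ?mulr_ge0 ?powR_ge0.
pose k := 1 + cutoff_const mu ups c1.
(* The first summand absorbs [2 n + mu + ups + 1], which is at most [2 (3 + |mu| + |ups|) sqrt lam];
   the final 1 keeps [A] positive whatever [M] is. *)
pose A := 2 * (3 + `|mu| + `|ups|) * M + 1.
exists (Num.sqrt (2 * A * k)) => N t f N1 nodes [cg _ wg _].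
have [tinj tP] := nodes.
have weight_ge0 a b y : 0 <= weight a b rho y.
  by apply: mulr_ge0; [apply: mulr_ge0; [exact: ltW|exact: powR_ge0]|exact: powR_ge0].
have t01 i : 0 < t i < 1 by have [] := (tP (t i)).1 (ex_intro _ i erefl).
have cf := continuous_unsubst rho0 cg.
have fv : is_weak_derivative f (weak_deriv f).
  exact: xgetPex (weakly_derivable_unsubst rho0 cg wg).
pose P := jacobi01 mu ups N.+1; pose lam := jeig mu ups N.+1.
pose x i := subst rho (t i).
have P0 : P != 0 := jacobi01_neq0_of_nodes nodes.
have sizeP : (size P <= N.+2)%N := size_jacobi01 mu ups N.+1.
have ode : jop mu ups P + lam *: P = 0 := jacobi01_ode mu ups N.+1.
have Px i : P.[x i] = 0.
  have [_ <-] := (tP (t i)).1 (ex_intro _ i erefl).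
  rewrite -jacobi01E /jacobi_rho /x /subst; congr (_.[_]); ring.
have xinj : injective x.
  move=> i j; rewrite /x => sij; apply: tinj; have /andP[_ ti1] := t01 i; have /andP[_ tj1] := t01 j.
  by rewrite -(subst_inv rho0 ti1) sij subst_inv.
have x01 i : 0 < x i < 1 by exact: subst_itv.
have NR : (1 : R) <= N%:R by rewrite ler1n.
(* The degree is [N + 1], so [lam = (N + 1) (N + 2 + mu + ups)], and the second factor exceeds
   [N]. *)
have lamN : N%:R ^+ 2 <= lam.
  have -> : lam = (N%:R + 1) * (N%:R + 1 + mu + ups + 1) by rewrite /lam /jeig -natr1.
  by move: (N%:R : R) NR => y y1; nra.
have lam1 : 1 <= lam by apply: le_trans lamN; rewrite exprn_ege1.
have lam0 : 0 < lam by exact: lt_le_trans lam1.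
have l0 : 0 < Num.sqrt lam by rewrite sqrtr_gt0.
have Nl : N%:R <= Num.sqrt lam.
  by rewrite -[leLHS]ger0_norm// -sqrtr_sqr; exact: ler_wsqrtr.
pose d := c1 / lam.
have d0 : 0 < d by rewrite divr_gt0.
have ldE : lam * d = c1 by rewrite /d mulrC divfK// gt_eqF.
have cu : c1 <= (ups + 1) / 2 by rewrite !ge_min lexx.
have cm : c1 <= (mu + 1) / 2 by rewrite !ge_min lexx orbT.
have c4 : c1 <= 4^-1 by rewrite !ge_min lexx !orbT.
have dups : d * (lam / (ups + 1)) <= 2^-1.
  by rewrite mulrA [d * _]mulrC ldE ler_pdivrMr//; lra.
have dmu : d * (lam / (mu + 1)) <= 2^-1.
  by rewrite mulrA [d * _]mulrC ldE ler_pdivrMr//; lra.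
have d4 : d <= 4^-1.
  by apply: le_trans c4; rewrite /d ler_pdivrMr// ler_peMr// ltW.
have EE : expR (16 * liouville_const mu ups / (Num.sqrt lam * Num.sqrt d)) = E.
  by rewrite -sqrtrM ?(ltW lam0)// ldE.
pose W := jweight (ups + 2^-1) (mu + 2^-1).
pose S := \sum_i W (x i) * f (t i) ^+ 2.
pose r := \sum_j f (t j) *: lagrange_poly x j.
have K0 : 0 <= cutoff_const mu ups c1.
  by rewrite -ldE; exact: cutoff_const_ge0.
have A0 : 0 < A.
  by apply: ltr_pwDr => //; apply: mulr_ge0 => //; apply: mulr_ge0 => //; do !apply: addr_ge0.
have JS : jint mu ups (r ^+ 2) <= A / Num.sqrt lam * S.
  have lE := ode; rewrite /lam in lE.
  rewrite (quadrature_square xinj sizeP P0 Px (jintD mu1 ups1) (jintZ mu1 ups1) (jint_ibp mu1 ups1) mu1 ups1 lE).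
  rewrite mulr_sumr; apply: ler_sum => j _; rewrite [leLHS]mulrC [leRHS]mulrA; apply: ler_wpM2r; first exact: sqr_ge0.
  apply: le_trans (christoffel_le mu1 ups1 lam1 ode xinj sizeP P0 Px x01 d0 dups dmu d4 j erefl) _.
  rewrite EE -/M; apply: ler_wpM2r; first exact: jweight_ge0.
  have B : 2 * N.+1%:R + mu + ups + 1 <= 2 * (3 + `|mu| + `|ups|) * Num.sqrt lam.
    have b1 := ler_norm mu; have b2 := ler_norm ups.
    have p1 : 0 <= `|mu| * (Num.sqrt lam - 1) by apply: mulr_ge0 => //; lra.
    have p2 : 0 <= `|ups| * (Num.sqrt lam - 1) by apply: mulr_ge0 => //; lra.
    have q1 := normr_ge0 mu; have q2 := normr_ge0 ups; rewrite -[N.+1%:R]natr1; lra.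
  have lE2 : lam = Num.sqrt lam ^+ 2 by rewrite sqr_sqrtr// ltW.
  apply: (@le_trans _ _ (2 * (3 + `|mu| + `|ups|) * Num.sqrt lam / lam * M)).
    by apply: ler_wpM2r => //; apply: ler_wpM2r => //; rewrite invr_ge0 ltW.
  have -> : 2 * (3 + `|mu| + `|ups|) * Num.sqrt lam / lam * M = 2 * (3 + `|mu| + `|ups|) * M / Num.sqrt lam.
    by rewrite {2}lE2; field; rewrite gt_eqF.
  by apply: ler_wpM2r; [rewrite invr_ge0 ltW|rewrite /A lerDl].
pose v := weak_deriv f.
pose G := EFin \o node_majorant mu ups rho lam d f v.
have mG : measurable_fun (`]0, 1[ : set R) G by exact: measurable_node_majorant.
have G0 y : 0 < y < 1 -> (0 <= G y)%E.
  by move=> y01; rewrite lee_fin; exact: node_majorant_ge0.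
have FG i j (tij : t i < t j) := node_estimate mu1 ups1 rho0 lam1 ode xinj sizeP P0 t01 Px d0 dups dmu d4 cf fv tij.
(* The hypothesis [N >= 1] says that the [N + 1] nodes are at least two. *)
have := @sum_le_integral R _ t (fun y => W (subst rho y) * f y ^+ 2) G tinj t01 mG G0 FG N1.
rewrite integral_node_majorant// ldE -/k => SE.
apply: le_trans (wnorm_interp_le mu1 ups1 rho0 (interpE rho t f) (lexx _)) _.
rewrite /wnorm; apply: sqrte_estimate JS SE => //.
- by rewrite /k lerDl.
- by apply: lt_le_trans NR.
- by apply: integral_ge0 => y _; rewrite lee_fin mulr_ge0 ?sqr_ge0.
- by apply: integral_ge0 => y _; rewrite lee_fin mulr_ge0 ?sqr_ge0.
Qed.
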